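(* Let $U$ be an open subset of $\mathbf{C}^n$, let $Q:\mathbf{C}^{\hat m}\to\mathbf{C}^q$ be a polynomial map, and let $F:U\to\mathbf{C}^{\hat m}$ be a holomorphic map such that $Q(F(x))=0$ for every $x\in U$. Then for every $x_0\in U$ there are an open neighborhood $U_0\subset U$ of $x_0$ and a sequence $\{F^{\nu}:U_0\to\mathbf{C}^{\hat m}\}_{\nu\in\mathbf{N}}$ of Nash maps converging uniformly to $F|_{U_0}$ on $U_0$ such that $Q(F^{\nu}(x))=0$ for every $x\in U_0$ and every $\nu\in\mathbf{N}$.
   Context: Let $\Omega$ be an open subset of $\mathbf{C}^n$ and let $f$ be a holomorphic function on $\Omega$. We say that $f$ is a Nash function at $x_0\in\Omega$ if there exist an open neighborhood $U'\subset\Omega$ of $x_0$ and a nonzero polynomial $P:\mathbf{C}^n\times\mathbf{C}\to\mathbf{C}$ such that $P(x,f(x))=0$ for all $x\in U'$. A holomorphic function on $\Omega$ is a Nash function if it is a Nash function at every point of $\Omega$. A holomorphic map $\Omega\to\mathbf{C}^N$ is a Nash map if each of its components is a Nash function. *)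

(* Defs.v *)
From HB Require Import structures.
From mathcomp Require Import all_boot all_order all_algebra.
From mathcomp Require Import all_classical all_reals all_analysis.
From mathcomp Require Import complex.
(* The notations of mpoly clash with those of MathComp-Analysis. *)
From mathcomp Require Import -(notations) mpoly.

Set Implicit Arguments.
Unset Strict Implicit.
Unset Printing Implicit Defensive.

Import Order.TTheory GRing.Theory Num.Theory.
Import numFieldNormedType.Exports.

Local Open Scope ring_scope.
Local Open Scope complex_scope.
Local Open Scope classical_set_scope.

(* R[i] is given the topology and norm carried by every numFieldType. *)
HB.instance Definition _ (R : realType) := NormedModule.copy R[i] R[i]^o.

Section Nash.
Variable R : realType.
Local Notation C := R[i].

(* [differentiable] over the scalar field C is complex (Frechet)
   differentiability; functions on Omega are total functions of which only the
   values on Omega matter, Omega being open in all uses. *)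
Definition holomorphic_on (n : nat) (V : normedModType C)
    (Omega : set 'rV[C]_n) (f : 'rV[C]_n -> V) : Prop :=
  forall x, Omega x -> differentiable f x.

(* A polynomial on C^n x C is a polynomial in n + 1 variables, the last one
   standing for the factor C. *)
Definition nash_at (n : nat) (Omega : set 'rV[C]_n) (f : 'rV[C]_n -> C)
    (x0 : 'rV[C]_n) : Prop :=
  exists U' : set 'rV[C]_n, [/\ open U', U' x0, U' `<=` Omega &
    exists2 P : mpoly (n + 1) C, P != 0 &
      forall x, U' x -> meval (row_mx x (f x)%:M 0) P = 0].

Definition nash_function (n : nat) (Omega : set 'rV[C]_n)
    (f : 'rV[C]_n -> C) : Prop :=
  holomorphic_on Omega f /\ forall x0, Omega x0 -> nash_at Omega f x0.

Definition nash_map (n N : nat) (Omega : set 'rV[C]_n)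
    (f : 'rV[C]_n -> 'rV[C]_N) : Prop :=
  holomorphic_on Omega f /\
  forall i : 'I_N, nash_function Omega (fun x => f x 0 i).

Definition polynomial_map (m q : nat) (Q : 'I_q -> mpoly m C)
    (y : 'rV[C]_m) : 'rV[C]_q := \row_j meval (y 0) (Q j).

End Nash.

(* Main.v *)
(* Tougeron's implicit function argument, run by induction on n.  Write F for
   the map near x0.  It suffices to factor F = G o Phi with G algebraic (Nash)
   near 0 and Phi holomorphic, in such a way that every polynomial relation
   between the components of F also holds between those of G: then Phi may be
   replaced by polynomial approximations.  The relations form a prime ideal I of
   C[y_1..y_m]; choose h outside I that plays the role of a Jacobian minor.  After
   a linear change of coordinates and Weierstrass preparation t h(F) is, up to a
   unit, a polynomial w in the last coordinate t, and Weierstrass division gives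
   F = w^M q + r, where w and r are polynomials in t with coefficients a that are
   holomorphic in n - 1 variables.  That t h(r) is a multiple of w and that Q(r) is
   a multiple of w^M for Q in I are polynomial relations between the a, so they
   survive when, by induction, a is replaced by algebraic functions.  For
   algebraic w and r the implicit function theorem in one unknown, used once for
   each coordinate y_i, corrects r to an algebraic zero of I; by uniqueness of the
   corrections, evaluating at Phi = (Phi_0, t, w^(i+2) q_i) recovers F.

   Holomorphic functions are handled as local uniform limits of polynomials: the
   Cauchy estimates come from discrete averages over roots of unity, and Goursat's
   bisection replaces contour integration. *)

From HB Require Import structures.
Require Import Defs.
From mathcomp Require Import all_boot all_order all_algebra.
From mathcomp Require Import all_classical all_reals all_analysis.
From mathcomp Require Import complex.
From mathcomp Require Import -(notations) mpoly.
From mathcomp Require Import ring lra zify.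
Import Order.TTheory GRing.Theory Num.Theory.
Import numFieldNormedType.Exports.
Import ComplexField.Normc.

Set Implicit Arguments.
Unset Strict Implicit.
Unset Printing Implicit Defensive.

Local Open Scope ring_scope.
Local Open Scope complex_scope.
Local Open Scope classical_set_scope.

Require Import Defs.
From mathcomp Require Import all_boot all_order all_algebra.
From mathcomp Require Import all_classical all_reals all_analysis.
From mathcomp Require Import complex.
From mathcomp Require Import -(notations) mpoly.
From mathcomp Require Import ring lra zify.
Import Order.TTheory GRing.Theory Num.Theory.
Import numFieldNormedType.Exports.
Import ComplexField.Normc.

Set Implicit Arguments.
Unset Strict Implicit.
Unset Printing Implicit Defensive.

Local Open Scope ring_scope.
Local Open Scope complex_scope.
Local Open Scope classical_set_scope.

(** The factor t in t h(F) makes the degree of w positive, so that w vanishes at 0 and Phi is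
    centred there. Solving for one coordinate divides by a derivative that is only known to divide w
    up to a unit, so every coordinate costs one power of w: the correction of y_i carries w^(M-2-i),
    and M = m+2 keeps the last exponent positive. Of the two extra powers, one pays for the
    derivative belonging to the first coordinate, the other makes the constant term of the equation
    to be solved vanish at 0. Divisibility by w becomes a system of equations by dividing with
    indeterminate coefficients: the coefficients of the remainder are polynomials in these, and they
    vanish at a because a polynomial of degree less than that of w^k which is w^k times a continuous
    function around the roots of w must be 0. Factors w are cancelled without power series: w is
    nonzero on a dense set, and identities between continuous functions extend from it. Coordinates
    that are transcendental over the preceding ones are unconstrained; their corrections are new
    variables of G, hence the components w^(i+2) q_i of Phi. *)

Section Modulus.
Variable R : realType.
Local Notation C := R[i].
Implicit Types (x y z : C).

(** * The modulus with real values *)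

Lemma normE z : `|z| = (normc z)%:C. Proof. by []. Qed.

Lemma normc_ge0 z : 0 <= normc z.
Proof. by rewrite -lecR -normE normr_ge0. Qed.

Lemma normc_eq0 z : (normc z == 0) = (z == 0).
Proof. by apply/eqP/eqP => [/eq0_normc //|->]; exact: normc0. Qed.

Lemma normc_gt0 z : (0 < normc z) = (z != 0).
Proof. by rewrite lt0r normc_eq0 normc_ge0 andbT. Qed.

Lemma normc_distC x y : normc (x - y) = normc (y - x).
Proof. by rewrite -normcN opprB. Qed.

Lemma le_normcB x y : normc (x - y) <= normc x + normc y.
Proof. by rewrite -(normcN y); exact: le_normcD. Qed.

Lemma normcX z k : normc (z ^+ k) = normc z ^+ k.
Proof. by elim: k => [|k IH]; rewrite ?expr0 ?normc1 // !exprS normcM IH. Qed.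

Lemma normc_real (a : R) : normc a%:C = `|a|.
Proof. by apply: (@complexI R); rewrite -normE normc_def /= expr0n addr0 sqrtr_sqr. Qed.

Lemma normc_nat k : normc (k%:R : C) = k%:R.
Proof. by rewrite -(rmorph_nat (real_complex R)) normc_real normr_nat. Qed.

Lemma normc_sum (I : Type) (r : seq I) (P : pred I) (F : I -> C) :
  normc (\sum_(i <- r | P i) F i) <= \sum_(i <- r | P i) normc (F i).
Proof.
elim/big_rec2: _ => [|i a b _ ab]; first by rewrite normc0.
by apply: le_trans (le_normcD _ _) _; rewrite lerD2l.
Qed.

Lemma normc_sub_ge x y : normc x - normc y <= normc (x - y).
Proof. by rewrite lerBlDr -{1}(subrK y x) le_normcD. Qed.

Lemma ReM_normc z : `|complex.Re z| <= normc z.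
Proof.
rewrite -lecR -normE normc_def lecR -sqrtr_sqr ler_wsqrtr //.
by rewrite lerDl sqr_ge0.
Qed.

Lemma ImM_normc z : `|complex.Im z| <= normc z.
Proof.
rewrite -lecR -normE normc_def lecR -sqrtr_sqr ler_wsqrtr //.
by rewrite lerDr sqr_ge0.
Qed.

Lemma normc_le_ReIm z : normc z <= `|complex.Re z| + `|complex.Im z|.
Proof.
rewrite [z in normc z]complexE; apply: le_trans (le_normcD _ _) _.
rewrite normc_real lerD2l normcM normc_real.
by rewrite /normc /= expr0n expr1n add0r sqrtr1 mul1r.
Qed.

(** Positive elements for the order of C are real; this turns the C-valued radii of the topology
    into real ones. *)
Lemma gt0_complex (e : C) : 0 < e -> exists2 d : R, 0 < d & e = d%:C.
Proof.
move=> e0; exists (complex.Re e); last by rewrite RRe_real // realE ltW.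
by move: e0; rewrite ltcE => /andP[_].
Qed.

Lemma nbhs_C (a : C) (P : set C) :
  nbhs a P <-> exists2 d : R, 0 < d & forall x, normc (x - a) < d -> P x.
Proof.
split=> [/nbhs_ballP[e /= /gt0_complex[d d0 ->] dP]|[d d0 dP]].
  by exists d => // x xa; apply: dP; rewrite -ball_normE /= distrC normE ltcR.
apply/nbhs_ballP; exists d%:C => /=; first by rewrite ltcR.
by move=> x; rewrite -ball_normE /= distrC normE ltcR => /dP.
Qed.

Lemma nbhs_rV n (a : 'rV[C]_n) (P : set 'rV[C]_n) :
  nbhs a P <-> exists2 d : R, 0 < d &
    forall x : 'rV[C]_n, (forall i, normc (x 0 i - a 0 i) < d) -> P x.
Proof.
split=> [/nbhs_ballP[e /= /gt0_complex[d d0 ->] dP]|[d d0 dP]].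
  exists d => // x xa; apply: dP; split; first by rewrite ltcR.
  by move=> i j; rewrite (ord1 i) -ball_normE /= distrC normE ltcR.
apply/nbhs_ballP; exists d%:C => /=; first by rewrite ltcR.
move=> x [_ ax]; apply: dP => i; have := ax 0 i.
by rewrite -ball_normE /= distrC normE ltcR.
Qed.

Lemma continuous_C n (f : 'rV[C]_n -> C) a : {for a, continuous f} <->
  forall e : R, 0 < e -> \forall x \near a, normc (f x - f a) < e.
Proof.
split=> [cf e e0|H].
  have := cf [set y | normc (y - f a) < e]; apply.
  by apply/nbhs_C; exists e.
move=> P /nbhs_C[d d0 dP]; have := H d d0.
by apply: filterS => x; exact: dP.
Qed.

End Modulus.

Require Import Defs.
From mathcomp Require Import all_boot all_order all_algebra.
From mathcomp Require Import all_classical all_reals all_analysis.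
From mathcomp Require Import complex.
From mathcomp Require Import -(notations) mpoly.
From mathcomp Require Import ring lra zify.
Import Order.TTheory GRing.Theory Num.Theory.
Import numFieldNormedType.Exports.
Import ComplexField.Normc.

Set Implicit Arguments.
Unset Strict Implicit.
Unset Printing Implicit Defensive.

Local Open Scope ring_scope.
Local Open Scope complex_scope.
Local Open Scope classical_set_scope.

(** * Polynomial approximation by averages over circles *)
Section CircleSums.
Variable R : realType.
Local Notation C := R[i].

(** This is exp(2 pi i s), of period 1, so that a parameter in [0, 1] runs once around the
    circle. *)
Definition turn (s : R) : C := Complex (cos (pi *+ 2 * s)) (sin (pi *+ 2 * s)).

Lemma turnD a b : turn (a + b) = turn a * turn b.
Proof.
by rewrite /turn mulrDr cosD sinD; congr Complex; rewrite [RHS]addrC [X in X + _]mulrC.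
Qed.

Lemma turn0 : turn 0 = 1.
Proof. by rewrite /turn mulr0 cos0 sin0. Qed.

Lemma turn1 : turn 1 = 1.
Proof. by rewrite /turn mulr1 cos2pi sin2pi. Qed.

Lemma turn_half : turn 2^-1 = -1.
Proof.
rewrite /turn -[pi *+ 2]mulr_natr mulfK ?pnatr_eq0 // cospi sinpi.
by apply/eqP; rewrite eq_complex /= oppr0 !eqxx.
Qed.

Lemma turnMn a k : turn (a *+ k) = turn a ^+ k.
Proof. by elim: k => [|k IH]; rewrite ?mulr0n ?turn0 // mulrS turnD IH exprS. Qed.

Lemma normc_turn s : normc (turn s) = 1.
Proof. by rewrite /normc /turn /= cos2Dsin2 sqrtr1. Qed.

Lemma turn_neq0 s : turn s != 0.
Proof. by rewrite -normc_gt0 normc_turn. Qed.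

(** The mean value theorem contributes 2 pi for the cosine and 2 pi for the sine. *)
Lemma turn_lipschitz a b : normc (turn a - turn b) <= (pi *+ 4) * `|a - b|.
Proof.
have lip (f g : R -> R) : (forall x : R, is_derive x 1 f (g x)) ->
    (forall x : R, `|g x| <= 1) -> forall x y : R, `|f x - f y| <= `|x - y|.
  move=> df g1; suff le x y : x <= y -> `|f y - f x| <= `|y - x|.
    move=> x y; have [/le|/ltW/le //] := leP x y.
    by rewrite distrC (distrC y).
  move=> xy; have cf z : {for z, continuous f}.
    by apply/differentiable_continuous/derivable1_diffP; case: (df z).
  have [|c _ ->] := @MVT_segment _ f g x y xy (fun z _ => df z).
    exact: continuous_subspaceT.
  by rewrite normrM ler_piMl.
apply: le_trans (normc_le_ReIm _) _; rewrite /turn /=.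
have e : `|pi *+ 2 * a - pi *+ 2 * b| = pi *+ 2 * `|a - b|.
  by rewrite -mulrBr normrM ger0_norm // mulrn_wge0 // pi_ge0.
rewrite (_ : pi *+ 4 * _ = pi *+ 2 * `|a - b| + pi *+ 2 * `|a - b|); last first.
  by rewrite -mulrDl -mulrnDr.
rewrite lerD // -e.
  by apply: (lip _ (fun x => - sin x)) => x; rewrite normrN sin_max.
by apply: (lip _ cos) => x; rewrite cos_max.
Qed.

(** Only orders that are powers of two occur, since contours are refined by bisection. *)
Definition root2 l : C := turn (2 ^+ l)^-1.

Lemma root2X l j : root2 l ^+ j = turn (j%:R / 2 ^+ l).
Proof. by rewrite -turnMn mulr_natl. Qed.

Lemma normc_root2X l j : normc (root2 l ^+ j) = 1.
Proof. by rewrite root2X normc_turn. Qed.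

Lemma root2_neq0 l : root2 l != 0. Proof. exact: turn_neq0. Qed.

Lemma root2_expN l : root2 l ^+ (2 ^ l)%N = 1.
Proof. by rewrite root2X natrX mulfV ?turn1 // expf_neq0 // pnatr_eq0. Qed.

Lemma root2_expX l i : (root2 l ^+ i) ^+ (2 ^ l)%N = 1.
Proof. by rewrite exprAC root2_expN expr1n. Qed.

(** The order divides [2 ^ l]. A proper divisor would divide [2 ^ l.-1], but that power of the root
    is [turn 2^-1], which is -1. *)
Lemma root2_prim l : (2 ^ l)%N.-primitive_root (root2 l).
Proof.
have [m pm] := prim_order_exists (expn_gt0 2 l) (root2_expN l).
move=> /(dvdn_pfactor _ _ (erefl : prime 2))[i il mE]; rewrite mE in pm.
case: ltngtP il pm => // [il _ pm|-> _ //].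
have : root2 l ^+ (2 ^ l.-1)%N = 1.
  rewrite -(subnK (_ : i <= l.-1)%N) ?expnD 1?mulnC ?exprM; last by lia.
  by rewrite (prim_expr_order pm) expr1n.
case: l il {pm} => // l _ /=; rewrite root2X natrX exprS invfM mulrCA divff.
  rewrite mulr1 turn_half => /eqP; rewrite eq_sym -subr_eq0 opprK.
  by rewrite (_ : 1 + 1 = 2%:R) // pnatr_eq0.
by rewrite expf_neq0 // pnatr_eq0.
Qed.

Lemma root2_orth l k : (k < 2 ^ l)%N -> (0 < k)%N ->
  \sum_(j < 2 ^ l) (root2 l ^+ j) ^+ k = 0.
Proof.
move=> kl k0; set z := root2 l ^+ k.
have z1 : z - 1 != 0.
  rewrite subr_eq0 -(prim_order_dvd (root2_prim l)).
  by apply/negP => /(dvdn_leq k0); rewrite leqNgt kl.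
apply: (mulfI z1); rewrite mulr0.
rewrite (eq_bigr (fun j : 'I__ => z ^+ j)); last by move=> j _; rewrite exprAC.
by rewrite -subrX1 -exprM mulnC exprM root2_expN expr1n subrr.
Qed.

Lemma root2_orthV l k : (k < 2 ^ l)%N -> (0 < k)%N ->
  \sum_(j < 2 ^ l) ((root2 l ^+ j) ^+ k)^-1 = 0.
Proof.
move=> kl k0; rewrite -[RHS](@root2_orth l (2 ^ l - k)) ?subn_gt0 //; last first.
  by rewrite ltn_subrL k0 expn_gt0.
apply: eq_bigr => j _; apply: (mulfI (_ : (root2 l ^+ j) ^+ k != 0)).
  by rewrite !expf_neq0 ?root2_neq0.
rewrite mulfV ?expf_neq0 ?root2_neq0 // -exprD subnKC ?(ltnW kl) //.
by rewrite root2_expX.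
Qed.

(** A Riemann sum for Cauchy's integral formula for the k-th Taylor coefficient, over the circle of
    radius [rho]. *)
Definition dcoef (f : C -> C) (rho : R) l k : C :=
  (2 ^ l)%:R^-1 * \sum_(j < 2 ^ l) f (rho%:C * root2 l ^+ j) / (rho%:C * root2 l ^+ j) ^+ k.

(** The polynomial of degree below [2 ^ l] that interpolates [f] at the equidistant nodes of the
    circle. *)
Definition dpoly (f : C -> C) (rho : R) l : {poly C} :=
  \poly_(k < 2 ^ l) dcoef f rho l k.

Lemma natN_neq0 l : (2 ^ l)%:R != 0 :> C.
Proof. by rewrite pnatr_eq0 -lt0n expn_gt0. Qed.

Lemma normc_avg l (F : 'I_(2 ^ l) -> C) B : (forall j, normc (F j) <= B) ->
  normc ((2 ^ l)%:R^-1 * \sum_j F j) <= B.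
Proof.
move=> FB; rewrite normcM normcV normc_nat ler_pdivrMl ?ltr0n ?expn_gt0 //.
apply: le_trans (normc_sum _ _ _) _; rewrite mulr_natl.
rewrite -[X in _ *+ X]card_ord -sumr_const; exact: ler_sum.
Qed.

Lemma normc_node (rho : R) l j : 0 < rho ->
  normc (rho%:C * root2 l ^+ j) = rho.
Proof. by move=> r0; rewrite normcM normc_root2X mulr1 normc_real gtr0_norm. Qed.

Lemma node_neq0 (rho : R) l j : 0 < rho -> rho%:C * root2 l ^+ j != 0.
Proof. by move=> r0; rewrite -normc_gt0 normc_node. Qed.

Lemma normc_dcoef f (rho M : R) l k : 0 < rho ->
  (forall z, normc z = rho -> normc (f z) <= M) ->
  normc (dcoef f rho l k) <= M / rho ^+ k.
Proof.
move=> r0 fM; apply: normc_avg => j.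
rewrite normcM normcV normcX normc_node //.
by apply: ler_wpM2r; [rewrite invr_ge0 exprn_ge0 // ltW|apply: fM; rewrite normc_node].
Qed.

(** Orthogonality of the powers of the root of unity kills every monomial but the k-th: all
    exponents differ by less than [2 ^ l], so there is no aliasing. *)
Lemma dcoef_poly (p : {poly C}) (rho : R) l k : 0 < rho ->
  (size p <= 2 ^ l)%N -> (k < 2 ^ l)%N -> dcoef (horner p) rho l k = p`_k.
Proof.
move=> r0 sp kl; rewrite /dcoef.
under eq_bigr => j _ do rewrite (horner_coef_wide _ sp) mulr_suml.
rewrite exchange_big /= mulr_sumr (bigD1 (Ordinal kl)) //= [X in _ + X]big1 ?addr0; last first.
  move=> i ik'; have {ik'} ik : (i : nat) != k by apply: contra_neq ik' => E; apply: val_inj.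
  have rC : rho%:C != 0 :> C by rewrite -normc_gt0 normc_real gtr0_norm.
  rewrite (eq_bigr (fun j : 'I__ => p`_i * (rho%:C ^+ i / rho%:C ^+ k) *
      ((root2 l ^+ j) ^+ i / (root2 l ^+ j) ^+ k))); last first.
    by move=> j _; rewrite !exprMn invfM; ring.
  rewrite -mulr_sumr (_ : \sum_j _ = 0) ?mulr0 //.
  have w0 j : root2 l ^+ j != 0 by rewrite expf_neq0 ?root2_neq0.
  case: (ltngtP i k) ik => // [ik|ki] _.
    rewrite -[RHS](@root2_orthV l (k - i)) ?subn_gt0 //; last lia.
    apply: eq_bigr => j _; rewrite -{1}(subnK (ltnW ik)) exprD invfM mulrCA.
    by rewrite divff ?mulr1 // expf_neq0.
  rewrite -[RHS](@root2_orth l (i - k)) ?subn_gt0 //; last first.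
    by apply: leq_ltn_trans (ltn_ord i); exact: leq_subr.
  by apply: eq_bigr => j _; rewrite -{1}(subnK (ltnW ki)) exprD mulfK // expf_neq0.
under eq_bigr => j _ do rewrite mulfK ?expf_neq0 ?node_neq0 //.
by rewrite sumr_const card_ord -[p`_k *+ _]mulr_natl mulKf // natN_neq0.
Qed.

Lemma dpoly_poly (p : {poly C}) (rho : R) l : 0 < rho ->
  (size p <= 2 ^ l)%N -> dpoly (horner p) rho l = p.
Proof.
move=> r0 sp; apply/polyP => k; rewrite coef_poly.
case: ltnP => kl; first by rewrite dcoef_poly.
by rewrite nth_default // (leq_trans sp).
Qed.

Lemma cauchy_estimate (p : {poly C}) (rho M : R) k : 0 < rho ->
  (forall z, normc z = rho -> normc p.[z] <= M) -> normc p`_k <= M / rho ^+ k.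
Proof.
move=> r0 pM; pose l := maxn (size p) k.+1.
have sl : (l < 2 ^ l)%N by exact: ltn_expl.
rewrite -(@dcoef_poly p rho l) //; first exact: normc_dcoef.
  by apply: leq_trans (ltnW sl); rewrite leq_maxl.
by apply: leq_trans (ltnW sl); rewrite leq_maxr.
Qed.

Lemma dcoefB f g (rho : R) l k :
  dcoef (fun z => f z - g z) rho l k = dcoef f rho l k - dcoef g rho l k.
Proof.
rewrite /dcoef -mulrBr -sumrB; congr (_ * _); apply: eq_bigr => j _.
by rewrite mulrBl.
Qed.

Lemma dpolyB f g (rho : R) l :
  dpoly (fun z => f z - g z) rho l = dpoly f rho l - dpoly g rho l.
Proof.
apply/polyP => k; rewrite coefB !coef_poly.
by case: ltnP => // _; rewrite ?dcoefB ?subr0.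
Qed.

(** Summing the geometric series in z/x over each node x gives the discrete Cauchy kernel x/(x - z).
    The numerator 1 - (z/x)^N is the same at all nodes because x^N = rho^N. *)
Lemma dpoly_horner f (rho : R) l z : 0 < rho -> normc z < rho ->
  (dpoly f rho l).[z] = (1 - (z / rho%:C) ^+ (2 ^ l)%N) *
   ((2 ^ l)%:R^-1 * \sum_(j < 2 ^ l) f (rho%:C * root2 l ^+ j) *
     (rho%:C * root2 l ^+ j) / (rho%:C * root2 l ^+ j - z)).
Proof.
move=> r0 zr; rewrite horner_poly /dcoef.
under eq_bigr => k _ do rewrite -mulrA.
rewrite -mulr_sumr mulrCA; congr (_ * _).
under eq_bigr => k _ do rewrite mulr_suml.
rewrite exchange_big /= mulr_sumr; apply: eq_bigr => j _.
set x := rho%:C * root2 l ^+ j.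
have x0 : x != 0 by exact: node_neq0.
have xz : x - z != 0.
  rewrite subr_eq0; apply: contraTneq zr => <-.
  by rewrite normc_node // ltxx.
rewrite (eq_bigr (fun k : 'I__ => f x * (z / x) ^+ k)); last first.
  by move=> k _; rewrite expr_div_n mulrAC -mulrA.
rewrite -mulr_sumr.
have e : (1 - z / x) * \sum_(k < 2 ^ l) (z / x) ^+ k = 1 - (z / rho%:C) ^+ (2 ^ l).
  rewrite -[LHS]opprK -mulNr opprB -subrX1 opprB; congr (1 - _).
  rewrite !expr_div_n; congr (_ / _); rewrite exprMn.
  by rewrite root2_expX mulr1.
apply: (mulfI (_ : 1 - z / x != 0)).
  by rewrite -(divff x0) -mulrBl mulf_neq0 ?invr_eq0.
rewrite mulrCA e; move: (1 - _ ^+ _) => A; field; apply/andP; split; [exact: xz|exact: x0].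
Qed.

End CircleSums.

Lemma half_pow_small (R : realType) (x delta : R) : 0 < delta ->
  exists k, x / 2 ^+ k < delta.
Proof.
move=> d0; have [x0|x0] := ltP x 0; first by exists 0%N; rewrite expr0 divr1 (lt_trans x0).
exists (Num.bound (x / delta)); rewrite ltr_pdivrMr ?exprn_gt0 // mulrC -ltr_pdivrMr //.
apply: lt_trans (archi_boundP _) _; first by rewrite divr_ge0 // ltW.
by rewrite -natrX ltr_nat ltn_expl.
Qed.

(** * Goursat's bisection for sums along a parametrized rectangle *)

Section Goursat.
Variable R : realType.
Local Notation C := R[i].
Variables (gam G : R * R -> C).

Let mid (p q : R * R) : R * R := ((p.1 + q.1) / 2, (p.2 + q.2) / 2).

(** The trapezoid sum for the integral of [G] d[gam] along the segment from p to q, cut into 2^l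
    equal pieces. *)
Fixpoint trap l (p q : R * R) : C :=
  if l is l'.+1 then trap l' p (mid p q) + trap l' (mid p q) q
  else (G p + G q) / 2 * (gam q - gam p).

Definition bdry l a b c d : C :=
  trap l (a, c) (b, c) + trap l (b, c) (b, d) + trap l (b, d) (a, d) + trap l (a, d) (a, c).

Lemma trapN l p q : trap l q p = - trap l p q.
Proof.
elim: l p q => [p q|l IH p q] /=.
  ring.
have -> : mid q p = mid p q.
  by rewrite /mid; congr pair; congr (_ / _); rewrite addrC.
by rewrite (IH (mid p q) q) (IH p (mid p q)) opprD addrC.
Qed.

(** The inner edges are run through in both directions and cancel by [trapN]. *)
Lemma bdryS l a b c d : let m := (a + b) / 2 in let n := (c + d) / 2 in
  bdry l.+1 a b c d =
  bdry l a m c n + bdry l m b c n + bdry l a m n d + bdry l m b n d.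
Proof.
move=> m n; have h (x : R) : (x + x) / 2 = x by field.
rewrite /bdry /= /mid /= !h (addrC b a) (addrC d c) -/m -/n.
rewrite (trapN l (m, c) (m, n)) (trapN l (a, n) (m, n)).
rewrite (trapN l (m, n) (b, n)) (trapN l (m, n) (m, d)).
ring.
Qed.

(** The boundary sums are not known to converge, so the failure of smallness is asserted for
    arbitrarily fine subdivisions. *)
Definition bad e a b c d :=
  forall n, exists2 l, (n <= l)%N & e <= normc (bdry l a b c d).

Lemma bad_split e a b c d : bad e a b c d ->
  let m := (a + b) / 2 in let n := (c + d) / 2 in
  [\/ bad (e / 4) a m c n, bad (e / 4) m b c n, bad (e / 4) a m n d | bad (e / 4) m b n d].
Proof.
move=> be m n; apply: contrapT => nbad.
have ev a' b' c' d' : ~ bad (e / 4) a' b' c' d' ->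
    exists N, forall l, (N <= l)%N -> normc (bdry l a' b' c' d') < e / 4.
  move/existsNP => [N H]; exists N => l Nl; rewrite ltNge; apply/negP => H'.
  by apply: H; exists l.
have [N1 H1] : exists N, forall l, (N <= l)%N -> normc (bdry l a m c n) < e / 4.
  by apply: ev => ?; apply: nbad; constructor 1.
have [N2 H2] : exists N, forall l, (N <= l)%N -> normc (bdry l m b c n) < e / 4.
  by apply: ev => ?; apply: nbad; constructor 2.
have [N3 H3] : exists N, forall l, (N <= l)%N -> normc (bdry l a m n d) < e / 4.
  by apply: ev => ?; apply: nbad; constructor 3.
have [N4 H4] : exists N, forall l, (N <= l)%N -> normc (bdry l m b n d) < e / 4.
  by apply: ev => ?; apply: nbad; constructor 4.
(* The successor provides the level that [bdryS] consumes. *)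
have [[|l]] := be (N1 + N2 + N3 + N4).+1; first by [].
rewrite ltnS => Nl; rewrite bdryS -/m -/n.
have := H1 l; have := H2 l; have := H3 l; have := H4 l.
move=> /(_ ltac:(lia)) h4 /(_ ltac:(lia)) h3 /(_ ltac:(lia)) h2 /(_ ltac:(lia)) h1.
move=> h; have := le_trans h (le_normcD _ _).
have := le_normcD (bdry l a m c n + bdry l m b c n) (bdry l a m n d).
have := le_normcD (bdry l a m c n) (bdry l m b c n).
lra.
Qed.

Lemma nested_limit (a : nat -> R) (h : R) : 0 <= h ->
  (forall k, a k <= a k.+1 <= a k + h / 2 ^+ k.+1) ->
  exists s, forall k, a k <= s <= a k + h / 2 ^+ k.
Proof.
move=> h0 ak.
have halve k : h / 2 ^+ k = h / 2 ^+ k.+1 + h / 2 ^+ k.+1.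
  by rewrite exprS; field; rewrite expf_neq0.
have up j k : (j <= k)%N -> a j <= a k.
  elim: k => [|k IH]; first by rewrite leqn0 => /eqP ->.
  rewrite leq_eqVlt => /predU1P[->//|/IH /le_trans]; apply.
  by have /andP[] := ak k.
have dn j k : (j <= k)%N -> a k + h / 2 ^+ k <= a j + h / 2 ^+ j.
  elim: k => [|k IH]; first by rewrite leqn0 => /eqP ->.
  rewrite leq_eqVlt => /predU1P[->//|/IH]; apply: le_trans.
  by have /andP[_] := ak k; rewrite (halve k); lra.
have ub j k : a j <= a k + h / 2 ^+ k.
  have hp i : 0 <= h / 2 ^+ i by rewrite divr_ge0 // exprn_ge0.
  have [/up jk|/ltnW/dn kj] := leqP j k; first by rewrite (le_trans jk) // lerDl.
  by rewrite (le_trans _ kj) // lerDl.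
exists (sup (range a)) => k; apply/andP; split.
  apply: ub_le_sup; last by exists k.
  by exists (a 0%N + h / 2 ^+ 0) => _ [j _ <-].
by apply: ge_sup => [|_ [j _ <-]//]; exists (a 0%N), 0%N.
Qed.

Variables (a b c d L : R).
Hypotheses (ab : a <= b) (cd : c <= d) (L0 : 0 <= L).
Let K (p : R * R) := [/\ a <= p.1 <= b & c <= p.2 <= d].
Let dist (p q : R * R) := `|q.1 - p.1| + `|q.2 - p.2|.
Hypothesis gamL : forall p q, K p -> K q -> normc (gam q - gam p) <= L * dist p q.
Hypothesis Gdiff : forall p, K p -> exists B, forall eta, 0 < eta ->
  exists2 delta, 0 < delta & forall q, K q -> dist p q < delta ->
    normc (G q - (G p + B * (gam q - gam p))) <= eta * normc (gam q - gam p).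

(** The trapezoid rule is exact for integrands that are affine in [gam], with the primitive written
    here; hence only the deviation [s] from an affine function contributes. This is why trapezoids
    are used and not one-sided sums. *)
Lemma trap_affine (A B z0 : C) (s a' b' c' d' : R) :
  a <= a' -> b' <= b -> c <= c' -> d' <= d ->
  (forall q, a' <= q.1 <= b' -> c' <= q.2 <= d' ->
     normc (G q - (A + B * (gam q - z0))) <= s) ->
  forall l p q, a' <= p.1 <= b' -> c' <= p.2 <= d' ->
    a' <= q.1 <= b' -> c' <= q.2 <= d' ->
  normc (trap l p q - ((A * gam q + B / 2 * (gam q - z0) ^+ 2) -
                       (A * gam p + B / 2 * (gam p - z0) ^+ 2)))
  <= s * L * dist p q.
Proof.
move=> aa bb cc dd Hs; elim=> [|l IH] p q p1 p2 q1 q2 /=.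
  have -> : (G p + G q) / 2 * (gam q - gam p) -
      (A * gam q + B / 2 * (gam q - z0) ^+ 2 - (A * gam p + B / 2 * (gam p - z0) ^+ 2))
     = ((G p - (A + B * (gam p - z0))) + (G q - (A + B * (gam q - z0)))) / 2 *
       (gam q - gam p) by field.
  rewrite normcM normcM normcV (normc_nat _ 2) -mulrA.
  have hp : K p by split; apply/andP; move/andP: p1 => []; move/andP: p2 => []; split; lra.
  have hq : K q by split; apply/andP; move/andP: q1 => []; move/andP: q2 => []; split; lra.
  have hs : normc ((G p - (A + B * (gam p - z0))) + (G q - (A + B * (gam q - z0)))) / 2 <= s.
    have := le_normcD (G p - (A + B * (gam p - z0))) (G q - (A + B * (gam q - z0))).
    by have := Hs p p1 p2; have := Hs q q1 q2; lra.
  rewrite mulrA -(mulrA s); apply: ler_pM => //.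
  - by rewrite divr_ge0 // normc_ge0.
  - exact: normc_ge0.
  - exact: gamL.
set m := mid p q.
have m1 : a' <= m.1 <= b'.
  by apply/andP; move: p1 q1 => /andP[? ?] /andP[? ?]; rewrite /m /=; split; lra.
have m2 : c' <= m.2 <= d'.
  by apply/andP; move: p2 q2 => /andP[? ?] /andP[? ?]; rewrite /m /=; split; lra.
have e : dist p q = dist p m + dist m q.
  rewrite /dist /m /=.
  have h x y : (x + y) / 2 - x = (y - x) / 2 :> R by field.
  have h' x y : y - (x + y) / 2 = (y - x) / 2 :> R by field.
  by rewrite !h !h' !normrM (ger0_norm (_ : 0 <= 2^-1)) ?invr_ge0 //; field.
rewrite e mulrDr; apply: le_trans (lerD (IH p m p1 p2 m1 m2) (IH m q m1 m2 q1 q2)).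
apply: le_trans (le_normcD _ _); rewrite le_eqVlt; apply/orP; left; apply/eqP.
by congr normc; ring.
Qed.

Lemma goursat e : 0 < e ->
  exists n, forall l, (n <= l)%N -> normc (bdry l a b c d) < e.
Proof.
move=> e0; apply: contrapT => nbd.
pose h := b - a; pose w := d - c.
have h0 : 0 <= h by rewrite subr_ge0.
have w0 : 0 <= w by rewrite subr_ge0.
pose badk k (p : R * R) :=
  bad (e / 4 ^+ k) p.1 (p.1 + h / 2 ^+ k) p.2 (p.2 + w / 2 ^+ k).
pose near_ k (p q : R * R) := (p.1 <= q.1 <= p.1 + h / 2 ^+ k.+1) &&
   (p.2 <= q.2 <= p.2 + w / 2 ^+ k.+1).
(* A corner of a bad quarter, with default p; [nextP] shows that the default is never taken on a bad
   rectangle. *)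
pose next k p := xget p [set q | near_ k p q /\ badk k.+1 q].
have nextP k p : badk k p -> near_ k p (next k p) /\ badk k.+1 (next k p).
  move=> bp; rewrite /next; case: xgetP => [y -> //|none].
  exfalso; pose m := (p.1 + (p.1 + h / 2 ^+ k)) / 2.
  pose n := (p.2 + (p.2 + w / 2 ^+ k)) / 2.
  have /= := bad_split bp; rewrite -/m -/n.
  have hh (x : R) : x / 2 ^+ k = x / 2 ^+ k.+1 + x / 2 ^+ k.+1.
    by rewrite exprS; field; rewrite expf_neq0.
  have mE : m = p.1 + h / 2 ^+ k.+1 by rewrite /m hh; field; rewrite expf_neq0.
  have nE : n = p.2 + w / 2 ^+ k.+1 by rewrite /n hh; field; rewrite expf_neq0.
  have m2 : p.1 + h / 2 ^+ k = m + h / 2 ^+ k.+1 by rewrite mE hh addrA.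
  have n2 : p.2 + w / 2 ^+ k = n + w / 2 ^+ k.+1 by rewrite nE hh addrA.
  have e4 : e / 4 ^+ k / 4 = e / 4 ^+ k.+1 by rewrite exprSr invfM mulrA.
  have hp : 0 <= h / 2 ^+ k.+1 by rewrite divr_ge0 // exprn_ge0.
  have wp : 0 <= w / 2 ^+ k.+1 by rewrite divr_ge0 // exprn_ge0.
  rewrite e4 m2 n2; case=> H.
  - apply: (none p); split; first by rewrite /near_ !lexx !lerDl hp wp.
    by rewrite /badk -mE -nE.
  - apply: (none (m, p.2)); split.
      by rewrite /near_ /= mE !lexx !lerDl hp wp.
    by rewrite /badk /= -nE.
  - apply: (none (p.1, n)); split.
      by rewrite /near_ /= nE !lexx !lerDl hp wp.
    by rewrite /badk /= -mE.
  - apply: (none (m, n)); split; last by [].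
    by rewrite /near_ /= mE nE !lexx !lerDl hp wp.
pose u := fix u k := if k is k'.+1 then next k' (u k') else (a, c).
have ubad k : badk k (u k).
  elim: k => [|k IH]; last by have [] := nextP _ _ IH.
  rewrite /badk /= expr0 !divr1 /h /w !subrKC => n.
  move/forallNP: nbd => /(_ n) /existsNP[l /not_implyP[nl /negP]].
  by rewrite -leNgt => H; exists l => //; rewrite expr0 divr1.
have unear k : near_ k (u k) (u k.+1) by have [] := nextP _ _ (ubad k).
have [s1 Hs1] := @nested_limit (fun k => (u k).1) h h0 (fun k => proj1 (andP (unear k))).
have [s2 Hs2] := @nested_limit (fun k => (u k).2) w w0 (fun k => proj2 (andP (unear k))).

have uK k : [/\ a <= (u k).1, (u k).1 + h / 2 ^+ k <= b, c <= (u k).2 &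
    (u k).2 + w / 2 ^+ k <= d].
  elim: k => [|k [A1 A2 A3 A4]]; first by rewrite expr0 !divr1 /h /w !subrKC !lexx.
  have hh (x : R) : x / 2 ^+ k = x / 2 ^+ k.+1 + x / 2 ^+ k.+1.
    by rewrite exprS; field; rewrite expf_neq0.
  have := unear k; rewrite /near_ => /andP[/andP[B1 B2] /andP[B3 B4]].
  rewrite !hh in A2 A4.
  by split; lra.
have s1K := Hs1 0%N; have s2K := Hs2 0%N.
rewrite expr0 divr1 /= /h subrKC in s1K; rewrite expr0 divr1 /= /w subrKC in s2K.
have Kp : K (s1, s2) by [].
have [B HB] := Gdiff Kp.
pose S := (L + 1) * (h + w + 1).
have S0 : 0 < S by rewrite /S mulr_gt0 // ltr_wpDl // addr_ge0.
(* The sum over the k-th rectangle is at most 2 eta (L (h + w))^2 / 4^k, which this choice makes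
   smaller than e / 4^k. The summands 1 in [S] keep it positive for degenerate rectangles. *)
pose eta := e / (4 * S ^+ 2).
have eta0 : 0 < eta by rewrite /eta divr_gt0 // mulr_gt0 // exprn_gt0.
have [delta d0 Hd] := HB eta eta0.
have [k hk] := half_pow_small (h + w) d0.
have [A1 A2 A3 A4] := uK k.
pose X : R := (2 ^+ k)^-1.
have X0 : 0 < X by rewrite invr_gt0 exprn_gt0.
have sq q : (u k).1 <= q.1 <= (u k).1 + h / 2 ^+ k ->
    (u k).2 <= q.2 <= (u k).2 + w / 2 ^+ k ->
    normc (G q - (G (s1, s2) + B * (gam q - gam (s1, s2)))) <= eta * (L * ((h + w) * X)).
  move=> q1 q2.
  have Kq : K q by split; apply/andP; move/andP: q1 => []; move/andP: q2 => []; split; lra.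
  have dq : dist (s1, s2) q <= (h + w) * X.
    rewrite /dist mulrDl; apply: lerD; rewrite ler_norml /=.
      by have := Hs1 k; rewrite /X => /andP[? ?]; move/andP: q1 => [? ?]; apply/andP; split; lra.
    by have := Hs2 k; rewrite /X => /andP[? ?]; move/andP: q2 => [? ?]; apply/andP; split; lra.
  apply: le_trans (Hd q Kq (le_lt_trans dq hk)) _.
  rewrite ler_pM2l //; apply: le_trans (gamL Kp Kq) _.
  exact: ler_wpM2l.
have [l _] := ubad k 0%N; rewrite leNgt => /negP; apply.
have HT := trap_affine A1 A2 A3 A4 sq.
have hX : 0 <= h * X by rewrite mulr_ge0 // ltW.
have wX : 0 <= w * X by rewrite mulr_ge0 // ltW.
have i1 : (u k).1 <= (u k).1 <= (u k).1 + h / 2 ^+ k by rewrite lexx lerDl.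
have i2 : (u k).1 <= (u k).1 + h / 2 ^+ k <= (u k).1 + h / 2 ^+ k by rewrite lexx lerDl hX.
have j1 : (u k).2 <= (u k).2 <= (u k).2 + w / 2 ^+ k by rewrite lexx lerDl.
have j2 : (u k).2 <= (u k).2 + w / 2 ^+ k <= (u k).2 + w / 2 ^+ k by rewrite lexx lerDl wX.
set x1 := (u k).1; set x2 := x1 + h / 2 ^+ k; set y1 := (u k).2; set y2 := y1 + w / 2 ^+ k.
have E1 := HT l (x1, y1) (x2, y1) i1 j1 i2 j1.
have E2 := HT l (x2, y1) (x2, y2) i2 j1 i2 j2.
have E3 := HT l (x2, y2) (x1, y2) i2 j2 i1 j2.
have E4 := HT l (x1, y2) (x1, y1) i1 j2 i1 j1.
have D1 : dist (x1, y1) (x2, y1) = h * X.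
  by rewrite /dist /= subrr normr0 addr0 /x2 addrC addKr ger0_norm.
have D2 : dist (x2, y1) (x2, y2) = w * X.
  by rewrite /dist /= subrr normr0 add0r /y2 addrC addKr ger0_norm.
have D3 : dist (x2, y2) (x1, y2) = h * X.
  by rewrite /dist /= subrr normr0 addr0 distrC /x2 addrC addKr ger0_norm.
have D4 : dist (x1, y2) (x1, y1) = w * X.
  by rewrite /dist /= subrr normr0 add0r distrC /y2 addrC addKr ger0_norm.
rewrite D1 in E1; rewrite D2 in E2; rewrite D3 in E3; rewrite D4 in E4.
(* The values of the primitive at the four corners telescope, leaving the four errors. *)
have bE : normc (bdry l x1 x2 y1 y2) <= eta * (L * ((h + w) * X)) * L * (2 * ((h + w) * X)).
  rewrite (_ : _ * (2 * _) = eta * (L * ((h + w) * X)) * L * (h * X) +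
     eta * (L * ((h + w) * X)) * L * (w * X) + eta * (L * ((h + w) * X)) * L * (h * X) +
     eta * (L * ((h + w) * X)) * L * (w * X)); last by ring.
  apply: le_trans (lerD (lerD (lerD E1 E2) E3) E4).
  apply: le_trans (lerD (lerD (le_normcD _ _) (lexx _)) (lexx _)).
  apply: le_trans (lerD (le_normcD _ _) (lexx _)).
  apply: le_trans (le_normcD _ _).
  by rewrite le_eqVlt; apply/orP; left; apply/eqP; congr normc; rewrite /bdry; ring.
apply: le_lt_trans bE _.
have -> : e / 4 ^+ k = e * X ^+ 2.
  by rewrite /X (_ : 4 = 2 ^+ 2 :> R) ?exprVn 1?exprAC // -natrX.
have -> : eta * (L * ((h + w) * X)) * L * (2 * ((h + w) * X)) =
   2 * eta * (L * (h + w)) ^+ 2 * X ^+ 2 by ring.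
rewrite ltr_pM2r ?exprn_gt0 //.
have LS : (L * (h + w)) ^+ 2 <= S ^+ 2.
  have LS' : L * (h + w) <= S by rewrite /S; apply: ler_pM; [exact: L0|exact: addr_ge0|rewrite lerDl|rewrite lerDl].
  by apply: lerXn2r LS'; rewrite nnegrE ?(ltW S0) // mulr_ge0 // addr_ge0.
apply: (@le_lt_trans _ _ (2 * eta * S ^+ 2)).
  by rewrite ler_wpM2l // mulr_ge0 // ltW.
rewrite /eta (_ : 2 * _ * _ = e / 2); last by field; rewrite gt_eqF.
by rewrite ltr_pdivrMr // ltr_pMr // ltr1n.
Qed.

End Goursat.

(** * Cauchy's formula by contracting a circle *)

Section Cauchy.
Variable R : realType.
Local Notation C := R[i].

Lemma diff_estimate (f : C -> C) z : differentiable f z ->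
  exists B, forall eta : R, 0 < eta -> exists2 delta : R, 0 < delta &
    forall w, normc (w - z) < delta ->
      normc (f w - (f z + B * (w - z))) <= eta * normc (w - z).
Proof.
move=> df; exists ('d f z 1) => eta eta0.
have /eqaddoP/(_ eta%:C) := diff_locally df.
rewrite ltcR => /(_ eta0) /nbhs_C[d d0 H]; exists d => // w wz.
have := H (w - z); rewrite subr0 => /(_ wz) /=.
rewrite !normE -rmorphM lecR.
rewrite -[X in normc X <= _ -> _]/(f (w - z + z) - (f z + 'd f z (w - z))) subrK.
have -> : 'd f z (w - z) = 'd f z 1 * (w - z).
  by rewrite -{1}[w - z]mulr1 -[_ * 1]/((w - z) *: (1 : C)) linearZ mulrC.
by [].
Qed.

Lemma diff_quotient (f : C -> C) z w : differentiable f w -> w != z ->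
  differentiable (fun u : C => (f u - f z) / (u - z)) w.
Proof.
move=> df wz.
have dz : differentiable (fun u : C => u - z) w.
  by apply: differentiableB; [exact: ex_diff|exact: differentiable_cst].
apply: (@differentiableM _ _ (fun u : C => f u - f z) (fun u : C => (u - z)^-1)).
  by apply: differentiableB => //; exact: differentiable_cst.
by apply: differentiableV => //; rewrite subr_eq0.
Qed.

Section Homotopy.
Variables (f : C -> C) (z : C) (rho : R).
Hypotheses (rho0 : 0 < rho) (zrho : normc z < rho).
Hypothesis df : forall w, normc w <= rho -> differentiable f w.

(** The homotopy from the point z (first parameter 0) to the circle of radius [rho] (first parameter
    1); the second parameter is the angle. *)
Let gam (p : R * R) : C := z + p.1%:C * (rho%:C * turn p.2 - z).
Let G (p : R * R) : C := (f (gam p) - f z) / (gam p - z).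
(** A Lipschitz constant of [gam]: 2 [rho] bounds the radial speed, 4 pi [rho] the angular one. *)
Let L := rho * (2 + pi *+ 4).

Let L0 : 0 <= L.
Proof. by rewrite /L mulr_ge0 ?(ltW rho0) // addr_ge0 // mulrn_wge0 // pi_ge0. Qed.

Let circ_sub th : rho - normc z <= normc (rho%:C * turn th - z).
Proof.
apply: le_trans (normc_sub_ge _ _).
by rewrite normcM normc_turn mulr1 normc_real gtr0_norm.
Qed.

Let circ_sub2 th : normc (rho%:C * turn th - z) <= 2 * rho.
Proof.
apply: le_trans (le_normcB _ _) _.
by rewrite normcM normc_turn mulr1 normc_real gtr0_norm // mulr_natl mulr2n lerD2l ltW.
Qed.

Let gam_le p : 0 <= p.1 <= 1 -> normc (gam p) <= rho.
Proof.
move=> /andP[t0 t1]; rewrite /gam.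
have -> : z + p.1%:C * (rho%:C * turn p.2 - z) =
   (1 - p.1)%:C * z + p.1%:C * (rho%:C * turn p.2).
  by rewrite rmorphB rmorph1; ring.
apply: le_trans (le_normcD _ _) _.
rewrite !normcM normc_turn mulr1 !normc_real (gtr0_norm rho0) !ger0_norm ?subr_ge0 //.
apply: (@le_trans _ _ ((1 - p.1) * rho + p.1 * rho)).
  by rewrite lerD2r ler_wpM2l ?subr_ge0 // ltW.
by rewrite -mulrDl subrK mul1r.
Qed.

Let gamL p q : 0 <= p.1 <= 1 ->
  normc (gam q - gam p) <= L * (`|q.1 - p.1| + `|q.2 - p.2|).
Proof.
move=> /andP[p0 p1]; rewrite /gam.
have -> : z + q.1%:C * (rho%:C * turn q.2 - z) - (z + p.1%:C * (rho%:C * turn p.2 - z)) =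
  (q.1 - p.1)%:C * (rho%:C * turn q.2 - z) + p.1%:C * (rho%:C * (turn q.2 - turn p.2)).
  by rewrite rmorphB; ring.
apply: le_trans (le_normcD _ _) _.
rewrite !normcM !normc_real (gtr0_norm rho0) (ger0_norm p0) mulrDr lerD //.
  rewrite mulrC ler_wpM2r //; apply: le_trans (circ_sub2 _) _.
  by rewrite mulrC ler_pM2l // lerDl mulrn_wge0 // pi_ge0.
apply: (@le_trans _ _ (1 * (rho * normc (turn q.2 - turn p.2)))).
  by rewrite ler_wpM2r // mulr_ge0 ?normc_ge0 // ltW.
rewrite mul1r /L -mulrA ler_pM2l //; apply: le_trans (turn_lipschitz _ _) _.
by rewrite ler_wpM2r // lerDr.
Qed.

(** The bound [t0] keeps [gam] away from z, where the quotient [G] is singular. *)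
Let Gdiff t0 p : 0 < t0 -> t0 <= p.1 <= 1 -> exists B, forall eta, 0 < eta ->
  exists2 delta, 0 < delta & forall q,
    t0 <= q.1 <= 1 -> `|q.1 - p.1| + `|q.2 - p.2| < delta ->
    normc (G q - (G p + B * (gam q - gam p))) <= eta * normc (gam q - gam p).
Proof.
move=> t00 /andP[p0 p1].
have p01 : 0 <= p.1 <= 1 by rewrite p1 (le_trans (ltW t00)).
have gz : gam p != z.
  rewrite -subr_eq0 /gam addrC addKr -normc_gt0 normcM normc_real.
  apply: mulr_gt0; first by rewrite normr_gt0 gt_eqF // (lt_le_trans t00).
  by apply: lt_le_trans (circ_sub _); rewrite subr_gt0.
have [B HB] := diff_estimate (diff_quotient (df (gam_le p01)) gz).
exists B => eta eta0; have [d d0 Hd] := HB eta eta0.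
exists (d / (L + 1)); first by rewrite divr_gt0 // ltr_wpDl.
move=> q q1 pq; apply: Hd; apply: le_lt_trans (gamL _ p01) _.
apply: (@le_lt_trans _ _ ((L + 1) * (`|q.1 - p.1| + `|q.2 - p.2|))).
  by rewrite ler_wpM2r ?addr_ge0 // lerDl.
by rewrite mulrC -ltr_pdivlMr // ltr_wpDl.
Qed.

Lemma trap_circle l (t c d : R) : trap gam G l (t, c) (t, d) =
  \sum_(j < 2 ^ l)
    (G (t, c + (d - c) * (j%:R / 2 ^+ l)) + G (t, c + (d - c) * (j.+1%:R / 2 ^+ l))) / 2 *
    (gam (t, c + (d - c) * (j.+1%:R / 2 ^+ l)) - gam (t, c + (d - c) * (j%:R / 2 ^+ l))).
Proof.
elim: l c d => [|l IH] c d.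
  rewrite expn0 big_ord1 /= expr0 !divr1 mulr0 addr0 mulr1.
  by rewrite (addrC c) subrK.
rewrite expnS mul2n -addnn big_split_ord /=.
have -> : (t + t) / 2 = t by field.
have n2 : (2 : R) ^+ l != 0 by rewrite expf_neq0.
have e1 (j : nat) : c + ((c + d) / 2 - c) * (j%:R / 2 ^+ l) = c + (d - c) * (j%:R / 2 ^+ l.+1).
  by rewrite exprS; field.
have e2 (j : nat) : (c + d) / 2 + (d - (c + d) / 2) * (j%:R / 2 ^+ l) =
    c + (d - c) * ((2 ^ l + j)%:R / 2 ^+ l.+1).
  by rewrite exprS natrD natrX; field.
rewrite !IH; congr (_ + _); apply: eq_bigr => j _.
  by rewrite !e1.
by rewrite !e2 addnS.
Qed.

(** The angles 0 and 1 give the same ray, so the two radial edges of the rectangle will cancel in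
    [bdry]. *)
Lemma trap_ends l a b : trap gam G l (a, 0) (b, 0) = trap gam G l (a, 1) (b, 1).
Proof.
have eg t : gam (t, 0) = gam (t, 1) by rewrite /gam /= turn0 turn1.
have eG t : G (t, 0) = G (t, 1) by rewrite /G eg.
elim: l a b => [|l IH] a b /=; first by rewrite !eg !eG.
by rewrite addr0 mul0r (_ : (1 + 1) / 2 = 1 :> R) ?IH //; field.
Qed.

Lemma sum_shift (H : nat -> C) N : H N = H 0%N -> \sum_(j < N) H j.+1 = \sum_(j < N) H j.
Proof.
case: N => [|N] HN; first by rewrite !big_ord0.
by rewrite big_ord_recr /= HN [RHS]big_ord_recl addrC.
Qed.

(** Each node x receives x(w - 1) from the edge after it and x(1 - 1/w) from the edge before it, in
    total x(w - 1/w). Thus the trapezoid sum over the outer circle is a multiple of the discrete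
    Cauchy sum of [dpoly_horner]. *)
Lemma trap_outer l : trap gam G l (1, 0) (1, 1) =
  (root2 R l - (root2 R l)^-1) / 2 *
  \sum_(j < 2 ^ l) (f (rho%:C * root2 R l ^+ j) - f z) *
     (rho%:C * root2 R l ^+ j) / (rho%:C * root2 R l ^+ j - z).
Proof.
rewrite trap_circle; set w := root2 R l; pose x j := rho%:C * w ^+ j.
have w0 : w != 0 by exact: root2_neq0.
have gE (j : nat) : gam (1, 0 + (1 - 0) * (j%:R / 2 ^+ l)) = x j.
  by rewrite /gam /= subr0 mul1r add0r rmorph1 mul1r -root2X addrC subrK.
under eq_bigr => j _ do rewrite /G !gE.
pose g j := (f (x j) - f z) / (x j - z).
rewrite (eq_bigr (fun j : 'I_(2 ^ l) => 2^-1 * (g j * (x j * (w - 1)) + g j.+1 * (x j.+1 * (1 - w^-1))))); last first.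
  move=> j _; rewrite -/(g j) -/(g j.+1); move: (g j) (g j.+1) => u v.
  have -> : x j = x j.+1 * w^-1 by rewrite /x exprSr mulrA mulfK.
  by field.
rewrite -mulr_sumr big_split /= (@sum_shift (fun j => g j * (x j * (1 - w^-1)))); last first.
  by rewrite /g /x root2_expN expr0.
rewrite -big_split /= !mulr_sumr; apply: eq_bigr => j _; rewrite /g -/(x j).
by move: (x j - z)^-1 w^-1 => u v; ring.
Qed.

Lemma normc_expB1 (x : C) k : normc x = 1 -> normc (x ^+ k - 1) <= k%:R * normc (x - 1).
Proof.
move=> x1; rewrite subrX1 normcM mulrC ler_wpM2r ?normc_ge0 //.
apply: le_trans (normc_sum _ _ _) _.
under eq_bigr => i _ do rewrite normcX x1 expr1n.
by rewrite sumr_const card_ord.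
Qed.

(** Multiplying 2^(l-2) times by w^2 leads from 1 to -1, a distance 2, so each step has length at
    least 2/2^(l-2). *)
Lemma root2_gap l : (2 <= l)%N -> 8 <= (2 ^ l)%:R * normc (root2 R l - (root2 R l)^-1).
Proof.
case: l => [|[|l]] // _; set w := root2 R l.+2.
have w0 : w != 0 by exact: root2_neq0.
have -> : w - w^-1 = w^-1 * (w ^+ 2 - 1) by field.
rewrite normcM normcV (_ : normc w = 1) ?invr1 ?mul1r; last exact: normc_turn.
have := @normc_expB1 (w ^+ 2) (2 ^ l); rewrite normcX.
rewrite (_ : normc w = 1) ?expr1n; last exact: normc_turn.
move=> /(_ erefl); rewrite -exprM -expnS.
have -> : w ^+ (2 ^ l.+1) = -1.
  rewrite /w root2X -turn_half; congr turn.
  by rewrite natrX (exprS _ l.+1); field; rewrite expf_neq0.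
rewrite -opprD normcN (_ : 1 + 1 = 2%:R) // normc_nat => h.
by rewrite !expnS !natrM -mulrA -mulrA -[8]/(2 * 4)%:R; lra.
Qed.

(** By [goursat] the sums over the outer circle and over a small circle around z nearly agree; the
    small one is controlled by the continuity of f at z, and the outer one is, up to a factor
    bounded below by [root2_gap], the Cauchy sum for f - f(z). *)
Lemma dpoly_cvg e : 0 < e ->
  exists n, forall l, (n <= l)%N -> normc ((dpoly f rho l).[z] - f z) < e.
Proof.
move=> e0; have gap : 0 < rho - normc z by rewrite subr_gt0.
have [P P0 lip] : exists2 P : R, 0 < P &
    forall a b, normc (turn a - turn b) <= P * `|a - b|.
  exists (pi *+ 4); last exact: turn_lipschitz.
  by rewrite pmulrn_lgt0 // pi_gt0.
(* On the inner circle the quotient is at most e1 / (t0 (rho - |z|)) and the length at most t0 rho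
   P; the product is e, whatever t0 is. *)
pose e1 := e * (rho - normc z) / (rho * P).
have pi4 : 0 < rho * P by rewrite mulr_gt0.
have e10 : 0 < e1 by rewrite /e1 divr_gt0 // mulr_gt0.
have : {for z, continuous f} by apply: differentiable_continuous; apply: df; exact: ltW.
move=> /(_ [set y | normc (y - f z) < e1]).
have H0 : nbhs (f z) [set y | normc (y - f z) < e1] by apply/nbhs_C; exists e1.
move=> /(_ H0) /nbhs_C[d d0 Hd] {H0}.
(* The inner circle stays within 2 rho t0, hence within d/2, of z. *)
pose t0 := Num.min 1 (d / (4 * rho)).
have t00 : 0 < t0 by rewrite lt_min ltr01 divr_gt0 // mulr_gt0.
have t01 : t0 <= 1 by rewrite ge_min lexx.
have inner l : normc (trap gam G l (t0, 0) (t0, 1)) <= e.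
  rewrite trap_circle; apply: le_trans (normc_sum _ _ _) _.
  have Gle th : normc (G (t0, th)) <= e1 / (t0 * (rho - normc z)).
    rewrite /G normcM normcV; apply: ler_pM; rewrite ?invr_ge0 ?normc_ge0 //.
      apply/ltW/Hd; rewrite /gam /= addrC addKr normcM normc_real gtr0_norm //.
      apply: (@le_lt_trans _ _ (t0 * (2 * rho))).
        by rewrite ler_wpM2l ?(ltW t00).
      apply: (@le_lt_trans _ _ (d / (4 * rho) * (2 * rho))).
        by rewrite ler_wpM2r ?ge_min ?lexx ?orbT // mulr_ge0 // ltW.
      by rewrite (_ : _ * _ = d / 2); [lra|field; rewrite gt_eqF].
    have hp : t0 * (rho - normc z) <= normc (gam (t0, th) - z).
      have -> : gam (t0, th) - z = t0%:C * (rho%:C * turn th - z).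
        by rewrite /gam /= addrC addKr.
      by rewrite normcM normc_real gtr0_norm // ler_pM2l.
    have t0g : 0 < t0 * (rho - normc z) by rewrite mulr_gt0.
    by rewrite lef_pV2 // posrE // (lt_le_trans t0g).
  have term (j : 'I_(2 ^ l)) : normc ((G (t0, 0 + (1 - 0) * (j%:R / 2 ^+ l)) + G (t0, 0 + (1 - 0) * (j.+1%:R / 2 ^+ l))) / 2 *
    (gam (t0, 0 + (1 - 0) * (j.+1%:R / 2 ^+ l)) - gam (t0, 0 + (1 - 0) * (j%:R / 2 ^+ l)))) <= e / (2 ^ l)%:R.
    rewrite subr0 !mul1r !add0r normcM normcM normcV (normc_nat _ 2).
    set a := j%:R / _; set b := _ / 2 ^+ l.
    have h1 : normc (G (t0, a) + G (t0, b)) / 2 <= e1 / (t0 * (rho - normc z)).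
      by have := le_normcD (G (t0, a)) (G (t0, b)); have := Gle a; have := Gle b; lra.
    have h2 : normc (gam (t0, b) - gam (t0, a)) <= t0 * rho * P / (2 ^ l)%:R.
      have -> : gam (t0, b) - gam (t0, a) = t0%:C * (rho%:C * (turn b - turn a)).
        by rewrite /gam /=; ring.
      rewrite !normcM !normc_real !gtr0_norm // -!mulrA ler_pM2l // ler_pM2l //.
      apply: le_trans (lip _ _) _; rewrite ler_wpM2l ?(ltW P0) //.
      by rewrite /a /b -mulrBl -natr1 addrC addKr mul1r ger0_norm ?natrX // invr_ge0 exprn_ge0.
    apply: le_trans (ler_pM _ _ h1 h2) _; rewrite ?divr_ge0 ?normc_ge0 //.
    rewrite le_eqVlt; apply/orP; left; apply/eqP; rewrite /e1; field.
    by rewrite !gt_eqF // ltr0n expn_gt0.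
  apply: le_trans (ler_sum _ (fun j _ => term j)) _.
  by rewrite sumr_const card_ord -[_ *+ (2 ^ l)]mulr_natr divfK // pnatr_eq0 -lt0n expn_gt0.
have K1 (p : R * R) : t0 <= p.1 <= 1 /\ 0 <= p.2 <= 1 -> 0 <= p.1 <= 1.
  by move=> [/andP[p1 ->] _]; rewrite (le_trans (ltW t00)).
have [] := @goursat _ gam G t0 1 0 1 L t01 ler01 L0 _ _ e e0.
- by move=> p q /K1 p01 _; exact: gamL.
- move=> p [p1 p2]; have [B HB] := Gdiff t00 p1; exists B => eta /HB[dl dl0 Hdl].
  by exists dl => // q [q1 q2]; exact: Hdl.
move=> n Hn; exists (maxn 2 n) => l; rewrite geq_max => /andP[l2 /Hn].
rewrite /bdry trap_ends (trapN gam G l (t0, 1) (1, 1)) (trapN gam G l (t0, 0) (t0, 1)).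
rewrite (addrC (trap gam G l (t0, 1) (1, 1))) addrK => hb.
have := normc_sub_ge (trap gam G l (1, 0) (1, 1)) (trap gam G l (t0, 0) (t0, 1)).
move=> h; have {h hb} : normc (trap gam G l (1, 0) (1, 1)) < 2 * e.
  by have := inner l; lra.
rewrite trap_outer; set S := \sum_(j < _) _ => hS.
(* [dpoly] reproduces constants, so f may be replaced by f - f(z), the numerator of [G]. *)
have -> : (dpoly f rho l).[z] - f z = (dpoly (fun u => f u - f z) rho l).[z].
  rewrite dpolyB hornerD hornerN; congr (_ - _).
  have -> : (fun=> f z) = horner (f z)%:P by apply/funext => u; rewrite hornerC.
  by rewrite dpoly_poly ?hornerC // (leq_trans (size_polyC_leq1 _)) // expn_gt0.
rewrite dpoly_horner // normcM.
have h1 : normc (1 - (z / rho%:C) ^+ (2 ^ l)) <= 2.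
  apply: le_trans (le_normcB _ _) _; rewrite normc1 -[2]/(1 + 1)%:R natrD lerD2l.
  rewrite normcX normcM normcV normc_real gtr0_norm // exprn_ile1 ?divr_ge0 ?normc_ge0 ?(ltW rho0) //.
  by rewrite ler_pdivrMr // mul1r ltW.
have h2 : normc ((2 ^ l)%:R^-1 * S) < e / 2.
  rewrite normcM normcV normc_nat.
  have N0 : 0 < (2 ^ l)%:R :> R by rewrite ltr0n expn_gt0.
  rewrite ltr_pdivrMl //.
  move: hS; rewrite !normcM normcV (normc_nat _ 2).
  have := root2_gap l2; set q := normc (_ - _); set N : R := (2 ^ l)%:R => h8 hq.
  have q0 : 0 < q.
    by rewrite lt0r normc_ge0 andbT; apply: contraTneq h8 => ->; rewrite mulr0 -ltNge.
  have : q * normc S < 4 * e by lra.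
  rewrite mulrC -ltr_pdivlMr // => h; apply: lt_le_trans h _.
  rewrite ler_pdivrMr //; have := ler_wpM2r (ltW e0) h8; lra.
apply: (@le_lt_trans _ _ (2 * normc ((2 ^ l)%:R^-1 * S))).
  by rewrite ler_wpM2r ?normc_ge0.
by lra.
Qed.

End Homotopy.
End Cauchy.

(** * Uniform approximation in one variable *)

Section UniformApprox.
Variable R : realType.
Local Notation C := R[i].

Lemma geo_sum_le (x : R) k : 0 <= x < 1 -> \sum_(i < k) x ^+ i <= (1 - x)^-1.
Proof.
move=> /andP[x0 x1]; have y0 : 0 < 1 - x by rewrite subr_gt0.
rewrite -[X in _ <= X]mul1r ler_pdivlMr // mulrC -opprB mulNr -subrX1 opprB.
by rewrite gerBl exprn_ge0.
Qed.

Lemma normc_horner (p : {poly C}) (B x : R) z : 0 <= B -> 0 <= x < 1 ->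
  (forall k, normc (p`_k * z ^+ k) <= B * x ^+ k) -> normc p.[z] <= B / (1 - x).
Proof.
move=> B0 x01 pk; rewrite horner_coef; apply: le_trans (normc_sum _ _ _) _.
apply: le_trans (ler_sum _ (fun (k : 'I_(size p)) _ => pk k)) _.
by rewrite -mulr_sumr ler_wpM2l // geo_sum_le.
Qed.

Lemma normc_dpoly f (rho r B : R) l z : 0 < rho -> r < rho -> normc z <= r ->
  (forall j, (j < 2 ^ l)%N -> normc (f (rho%:C * root2 R l ^+ j)) <= B) ->
  normc (dpoly f rho l).[z] <= B / (1 - r / rho).
Proof.
move=> rho0 rr zr fB.
have r0 : 0 <= r by rewrite (le_trans _ zr) // normc_ge0.
have B0 : 0 <= B by apply: le_trans (fB 0%N _); rewrite ?normc_ge0 ?expn_gt0.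
apply: normc_horner => //.
  by rewrite divr_ge0 ?(ltW rho0) //= ltr_pdivrMr // mul1r.
move=> k; rewrite coef_poly; case: ltnP => _; last first.
  by rewrite mul0r normc0 mulr_ge0 // exprn_ge0 // divr_ge0 // ltW.
have ck : normc (dcoef f rho l k) <= B / rho ^+ k.
  apply: normc_avg => j; rewrite normcM normcV normcX normc_node //.
  by rewrite ler_wpM2r ?fB // invr_ge0 exprn_ge0 // ltW.
rewrite normcM normcX expr_div_n mulrA mulrAC; apply: ler_pM => //; rewrite ?normc_ge0 ?exprn_ge0 ?normc_ge0 //.
by rewrite lerXn2r // nnegrE normc_ge0.
Qed.

(** The error involves f at z and at the nodes of radius R1 only. At these finitely many points f is
    as close as desired to a polynomial p, by pointwise convergence on the circle of radius R2. The
    coefficients of p obey Cauchy estimates with the bound of f, so the part of p of order at least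
    2^l is small, and [dpoly] is exact on the rest. *)
Lemma dpoly_uniform f (r R1 R2 M : R) l z : 0 < r -> r < R1 -> R1 < R2 ->
  (forall w, normc w <= R2 -> differentiable f w) ->
  (forall w, normc w <= R2 -> normc (f w) <= M) ->
  normc z <= r ->
  normc ((dpoly f R1 l).[z] - f z) <=
    M / (1 - R1 / R2) * (1 + (1 - r / R1)^-1) * (R1 / R2) ^+ (2 ^ l).
Proof.
move=> r0 rR1 R12 df fM zr.
have R10 : 0 < R1 by exact: lt_trans rR1.
have R20 : 0 < R2 by exact: lt_trans R12.
set th := R1 / R2; set N := (2 ^ l)%N; set a := (1 - r / R1)^-1.
have th1 : 0 <= th < 1.
  by rewrite /th divr_ge0 ?(ltW R10) ?(ltW R20) //= ltr_pdivrMr // mul1r.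
have a0 : 0 < a by rewrite invr_gt0 subr_gt0 ltr_pdivrMr // mul1r.
have M0 : 0 <= M by apply: le_trans (fM 0 _); rewrite ?normc_ge0 ?normc0 // ltW.
apply/ler_addgt0Pr => e e0.
pose e' := e / (1 + a).
have e'0 : 0 < e' by rewrite divr_gt0 // addr_gt0.
have cvg w : normc w < R2 -> exists n, forall k, (n <= k)%N ->
    normc ((dpoly f R2 k).[w] - f w) < e'.
  by move=> wR2; exact: dpoly_cvg.
have zR2 : normc z < R2 by rewrite (le_lt_trans zr) // (lt_trans rR1).
have [n0 Hn0] := cvg z zR2.
have nodeR2 (j : 'I_N) : normc (R1%:C * root2 R l ^+ j) < R2 by rewrite normc_node.
have [n1 Hn1] := choice (fun j => cvg _ (nodeR2 j)).
pose k := maxn n0 (\max_j n1 j).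
pose p := dpoly f R2 k.
have pz : normc (p.[z] - f z) < e' by apply: Hn0; rewrite leq_maxl.
have pj j : (j < N)%N -> normc (p.[R1%:C * root2 R l ^+ j] - f (R1%:C * root2 R l ^+ j)) <= e'.
  move=> jN; apply/ltW/(Hn1 (Ordinal jN)); rewrite leq_max; apply/orP; right.
  exact: (leq_bigmax (Ordinal jN)).
have pc i : normc p`_i <= M / R2 ^+ i.
  rewrite coef_poly; case: ltnP => _; last by rewrite normc0 divr_ge0 // exprn_ge0 // ltW.
  by apply: normc_dcoef => // w wE; apply: fM; rewrite wE.
(* The tail of p, the only part on which [dpoly] with N nodes makes an error. *)
pose p2 := p - take_poly N p.
have p2le w : normc w <= R1 -> normc p2.[w] <= M / (1 - th) * th ^+ N.
  move=> wR1; have -> : p2 = drop_poly N p * 'X^N.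
    by rewrite /p2 -{1}(poly_take_drop N p) addrC addKr.
  rewrite hornerM hornerXn normcM normcX.
  have h : normc (drop_poly N p).[w] <= M / R2 ^+ N / (1 - th).
    apply: normc_horner => // [|i]; first by rewrite divr_ge0 // exprn_ge0 // ltW.
    rewrite coef_drop_poly normcM normcX.
    have -> : M / R2 ^+ N * th ^+ i = M / R2 ^+ (i + N) * R1 ^+ i.
      by rewrite /th exprD expr_div_n; field; rewrite !expf_neq0 // gt_eqF.
    apply: ler_pM; rewrite ?normc_ge0 ?exprn_ge0 ?normc_ge0 //.
    by rewrite lerXn2r // nnegrE ?normc_ge0 // ltW.
  have -> : M / (1 - th) * th ^+ N = M / R2 ^+ N / (1 - th) * R1 ^+ N.
    by rewrite {2}/th expr_div_n; ring.
  apply: ler_pM; rewrite ?normc_ge0 ?exprn_ge0 ?normc_ge0 //.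
  by rewrite lerXn2r // nnegrE ?normc_ge0 // ltW.
have -> : (dpoly f R1 l).[z] - f z =
   - (dpoly (fun w => p.[w] - f w) R1 l).[z] + (p.[z] - f z)
   + ((dpoly (horner p2) R1 l).[z] - p2.[z]).
  rewrite dpolyB.
  have -> : dpoly (horner p2) R1 l = dpoly (horner p) R1 l - take_poly N p.
    rewrite -[take_poly N p](@dpoly_poly _ _ R1 l) ?size_take_poly // -dpolyB.
    by congr dpoly; apply/funext => w; rewrite /p2 hornerD hornerN.
  by rewrite /p2 !hornerD !hornerN; ring.
apply: le_trans (le_normcD _ _) _; rewrite addrC; apply: lerD.
  apply: le_trans (le_normcB _ _) _.
  rewrite (_ : _ * _ = M / (1 - th) * th ^+ N * a + M / (1 - th) * th ^+ N); last by ring.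
  apply: lerD; last by apply: p2le; rewrite (le_trans zr) // ltW.
  apply: normc_dpoly => // j _; apply: p2le; by rewrite normc_node.
apply: le_trans (le_normcD _ _) _; rewrite normcN.
have -> : e = e' * a + e' by rewrite /e'; field; rewrite gt_eqF // addr_gt0.
by apply: lerD; [exact: normc_dpoly|exact: ltW].
Qed.

End UniformApprox.

(** * Polynomials in one more variable *)
Section SplitLast.
Variables (K : comNzRingType) (n : nat).
Local Notation var i := (mpolyX _ (mnm1 i)).
Local Notation widen := (widen_ord (leqnSn n)).

Definition join (T : Type) (x : 'I_n -> T) (t : T) (i : 'I_n.+1) : T :=
  if unlift ord_max i is Some j then x j else t.

Lemma widen_lift (j : 'I_n) : widen j = lift ord_max j.
Proof. by apply: val_inj; rewrite /= /bump leqNgt ltn_ord. Qed.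

Lemma join_widen (T : Type) (x : 'I_n -> T) t j : join x t (widen j) = x j.
Proof. by rewrite /join widen_lift liftK. Qed.

Lemma join_max (T : Type) (x : 'I_n -> T) t : join x t ord_max = t.
Proof. by rewrite /join unlift_none. Qed.

Lemma join_split (T : Type) (y : 'I_n.+1 -> T) :
  y = join (fun j => y (widen j)) (y ord_max).
Proof.
apply/funext => i; rewrite /join; case: unliftP => [j ->|-> //].
by rewrite widen_lift.
Qed.

Definition unsplit_poly (P : {poly (mpoly n K)}) : mpoly n.+1 K :=
  (map_poly (@mwiden n K) P).[var ord_max].

Fact unsplit_poly_additive : additive unsplit_poly.
Proof. by move=> P Q; rewrite /unsplit_poly rmorphB hornerD hornerN. Qed.

Fact unsplit_poly_multiplicative : multiplicative unsplit_poly.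
Proof.
split=> [P Q|]; first by rewrite /unsplit_poly rmorphM hornerM.
by rewrite /unsplit_poly rmorph1 hornerC.
Qed.

HB.instance Definition _ := GRing.isAdditive.Build _ _ unsplit_poly unsplit_poly_additive.
HB.instance Definition _ := GRing.isMultiplicative.Build _ _ unsplit_poly
  unsplit_poly_multiplicative.

Lemma unsplit_polyC p : unsplit_poly p%:P = mwiden p.
Proof. by rewrite /unsplit_poly map_polyC hornerC. Qed.

Lemma unsplit_polyX : unsplit_poly 'X = var ord_max.
Proof. by rewrite /unsplit_poly map_polyX hornerX. Qed.

Lemma meval_mwiden (v : 'I_n.+1 -> K) (p : mpoly n K) :
  meval v (mwiden p) = meval (fun j => v (widen j)) p.
Proof.
rewrite /mwiden /mmap !raddf_sum /= mevalE; apply: eq_bigr => m _.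
rewrite mevalM mevalC; congr (_ * _); rewrite /mmap1 rmorph_prod /=.
by apply: eq_bigr => i _; rewrite rmorphXn /= mevalXU.
Qed.

Lemma meval_unsplit (x : 'I_n -> K) t P :
  meval (join x t) (unsplit_poly P) = (map_poly (meval x) P).[t].
Proof.
rewrite /unsplit_poly -horner_map /= mevalXU join_max -map_poly_comp; congr horner.
apply: eq_map_poly => p /=; rewrite meval_mwiden; apply: meval_eq => j.
exact: join_widen.
Qed.

Definition split_poly (p : mpoly n.+1 K) : {poly (mpoly n K)} :=
  mmap (polyC \o @mpolyC n K) (join (fun j => (var j)%:P) 'X) p.

Lemma split_polyK : cancel split_poly unsplit_poly.
Proof.
move=> p; rewrite /split_poly /mmap raddf_sum [RHS]mpolyE; apply: eq_bigr => m _ /=.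
rewrite rmorphM /= unsplit_polyC mwidenC -mul_mpolyC; congr (_ * _).
rewrite /mmap1 rmorph_prod mpolyXE_id; apply: eq_bigr => i _.
rewrite rmorphXn /=; congr (_ ^+ _).
rewrite /join; case: unliftP => [j ->|->]; last exact: unsplit_polyX.
by rewrite unsplit_polyC /mwiden mmapX mmap1U widen_lift.
Qed.

End SplitLast.

(** * Uniform limits of polynomials on polydiscs *)

Section PolynomialLimits.
Variable R : realType.
Local Notation C := R[i].

Definition rjoin n (x : 'rV[C]_n) (t : C) : 'rV[C]_n.+1 := \row_i join (x 0) t i.

Lemma rjoinE n (x : 'rV[C]_n) t : rjoin x t 0 = join (x 0) t.
Proof. by apply/funext => i; rewrite mxE. Qed.

Definition rhead n (y : 'rV[C]_n.+1) : 'rV[C]_n := \row_j y 0 (widen_ord (leqnSn n) j).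

Lemma rjoin_split n (y : 'rV[C]_n.+1) : y = rjoin (rhead y) (y 0 ord_max).
Proof.
apply/rowP => i; rewrite rjoinE {1}[y 0]join_split; congr join.
by apply/funext => j; rewrite mxE.
Qed.

Definition polydisc n (r : R) : set 'rV[C]_n := [set x | forall i, normc (x 0 i) <= r].

(** The working substitute for holomorphy: stable under sums, products on bounded sets and uniform
    limits, and open to division by manipulating the approximating polynomials. *)
Definition polylim n (A : set 'rV[C]_n) (f : 'rV[C]_n -> C) :=
  forall e : R, 0 < e -> exists p : mpoly n C,
    forall x, A x -> normc (f x - meval (x 0) p) <= e.

Lemma rjoin_polydisc n r (x : 'rV[C]_n) t :
  polydisc r (rjoin x t) <-> polydisc r x /\ normc t <= r.
Proof.
split=> [H|[Hx Ht] i].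
  split=> [j|]; last by have := H ord_max; rewrite rjoinE join_max.
  by have := H (widen_ord (leqnSn n) j); rewrite rjoinE join_widen.
by rewrite rjoinE /join; case: unliftP => [j _|_].
Qed.

Definition upd n (x : 'rV[C]_n) (i : 'I_n) (t : C) : 'rV[C]_n :=
  \row_j if j == i then t else x 0 j.

Lemma upd_rjoin n (x : 'rV[C]_n) i t s :
  upd (rjoin x s) (widen_ord (leqnSn n) i) t = rjoin (upd x i t) s.
Proof.
apply/rowP => k; rewrite mxE !rjoinE /join; case: unliftP => [j ->|->].
  by rewrite widen_lift (inj_eq (lift_inj (h:=ord_max))) mxE.
by rewrite widen_lift (negPf (neq_lift _ _)).
Qed.

Lemma upd_rjoin_max n (x : 'rV[C]_n) t s :
  upd (rjoin x s) ord_max t = rjoin x t.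
Proof.
apply/rowP => k; rewrite mxE !rjoinE /join; case: unliftP => [j ->|->].
  by rewrite eq_sym (negPf (neq_lift _ _)).
by rewrite eqxx.
Qed.

Lemma geo_small (x e : R) : 0 <= x < 1 -> 0 < e -> exists l, x ^+ (2 ^ l) < e.
Proof.
move=> /andP[x0 x1] e0; have : (GRing.exp x) @ \oo --> (0 : R).
  by apply: cvg_expr; rewrite ger0_norm.
move=> /cvgr0_norm_lt/(_ _ e0)[n _ H]; exists n.
have := H (2 ^ n)%N (ltnW (ltn_expl n (isT : (1 < 2)%N))).
by rewrite ger0_norm // exprn_ge0.
Qed.

(** Osgood's lemma. In the last variable [dpoly] samples f at finitely many nodes, and the slices
    over these nodes are approximated by polynomials through the induction hypothesis. *)
Lemma separately_polylim n (f : 'rV[C]_n -> C) (r R3 M : R) :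
  0 < r -> r < R3 ->
  (forall x i, polydisc R3 x -> differentiable (fun t : C => f (upd x i t)) (x 0 i)) ->
  (forall x, polydisc R3 x -> normc (f x) <= M) ->
  polylim (polydisc r) f.
Proof.
elim: n => [|n IH] in f *; move=> r0 rR3 df fM e e0.
  exists (mpolyC 0 (f 0)) => x _; rewrite mevalC (_ : x = 0) ?subrr ?normc0 ?ltW //.
  by apply/rowP => -[].
pose R1 := (r + R3) / 2; pose R2 := (R1 + R3) / 2.
have rR1 : r < R1 by rewrite /R1; lra.
have R12 : R1 < R2 by rewrite /R2 /R1; lra.
have R23 : R2 < R3 by rewrite /R2 /R1; lra.
have R10 : 0 < R1 by exact: lt_trans rR1.
have R20 : 0 < R2 by exact: lt_trans R12.
pose K := M / (1 - R1 / R2) * (1 + (1 - r / R1)^-1).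
(* One number of nodes serves all values of the other variables, since the error bound depends only
   on M and the radii. *)
have [l Hl] : exists l, K * (R1 / R2) ^+ (2 ^ l) <= e / 2.
  have [K0|K0] := leP K 0.
    exists 0%N; apply: (@le_trans _ _ 0); last by rewrite divr_ge0 // ltW.
    by rewrite mulr_le0_ge0 // exprn_ge0 // divr_ge0 // ltW.
  have [||l Hl] := @geo_small (R1 / R2) (e / 2 / K).
  - by rewrite divr_ge0 ?(ltW R10) ?(ltW R20) //= ltr_pdivrMr // mul1r.
  - by rewrite !divr_gt0.
  by exists l; rewrite mulrC -ler_pdivlMr // ltW.
(* Compensates the factor by which [normc_dpoly] amplifies errors at the nodes. *)
pose e' := e / 2 * (1 - r / R1).
have gap : 0 < 1 - r / R1 by rewrite subr_gt0 ltr_pdivrMr // mul1r.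
have e'0 : 0 < e' by rewrite mulr_gt0 // divr_gt0.
have le_polydisc k s s' (x : 'rV[C]_k) : s <= s' -> polydisc s x -> polydisc s' x.
  by move=> ss' xs i; apply: le_trans (xs i) ss'.
have /choice[p Hp] : forall w, exists q : mpoly n C, normc w <= R3 ->
    forall x, polydisc r x -> normc (f (rjoin x w) - meval (x 0) q) <= e'.
  move=> w.
  have [wR|wR] := leP (normc w) R3; last by exists 0.
  have [||q Hq] := IH (fun x => f (rjoin x w)) r0 rR3 _ _ e' e'0.
  - move=> x i xR3; have /df : polydisc R3 (rjoin x w) by apply/rjoin_polydisc.
    move=> /(_ (widen_ord (leqnSn n) i)); rewrite rjoinE join_widen.
    by under eq_fun do rewrite upd_rjoin.
  - by move=> x xR3; apply: fM; apply/rjoin_polydisc.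
  by exists q.
pose N := (2 ^ l)%N; pose node j := R1%:C * root2 R l ^+ j.
(* The formula of [dcoef] with polynomials in the place of the sampled values; specializing the
   first n variables gives back a [dpoly]. *)
pose P : {poly (mpoly n C)} := \poly_(k < N)
  (mpolyC n ((N%:R)^-1) * \sum_(j < N) p (node j) * mpolyC n (node j ^+ k)^-1).
exists (unsplit_poly P) => y; rewrite [y]rjoin_split; set x := rhead y; set t := y 0 ord_max.
move=> /rjoin_polydisc[xr tr]; rewrite rjoinE meval_unsplit.
have -> : map_poly (meval (x 0)) P = dpoly (fun w => meval (x 0) (p w)) R1 l.
  apply/polyP => k; rewrite coef_map_id0 ?raddf0 // !coef_poly; case: ifP => _; last exact: raddf0.
  rewrite rmorphM /= mevalC raddf_sum; congr (_ * _); apply: eq_bigr => j _.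
  by rewrite [LHS]mevalM mevalC.
have xR3 : polydisc R3 x by apply: le_polydisc xr; exact: ltW.
have -> : f (rjoin x t) - (dpoly (fun w => meval (x 0) (p w)) R1 l).[t] =
    (dpoly (fun w => f (rjoin x w) - meval (x 0) (p w)) R1 l).[t] -
    ((dpoly (fun w => f (rjoin x w)) R1 l).[t] - f (rjoin x t)).
  by rewrite dpolyB hornerD hornerN; ring.
apply: le_trans (le_normcB _ _) _; rewrite [e in _ <= e]splitr; apply: lerD.
  rewrite (_ : e / 2 = e' / (1 - r / R1)); last by rewrite /e' mulfK // gt_eqF.
  apply: normc_dpoly => // j _; apply: Hp => //; rewrite normc_node //.
  by rewrite ltW // (lt_trans R12).
apply: le_trans Hl; apply: dpoly_uniform => // w wR2.
  have wR3 : normc w <= R3 by rewrite (le_trans wR2) // ltW.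
  have /df : polydisc R3 (rjoin x w) by apply/rjoin_polydisc.
  move=> /(_ ord_max); rewrite rjoinE join_max.
  by under eq_fun do rewrite upd_rjoin_max.
apply: fM; apply/rjoin_polydisc; split=> //.
by rewrite (le_trans wR2) // ltW.
Qed.
End PolynomialLimits.

(** * Local uniform limits of polynomials *)
Section PolylimAlgebra.
Variable R : realType.
Local Notation C := R[i].

Lemma big_closed (T I : Type) (s : seq I) (P : (T -> C) -> Prop) (F : I -> T -> C) :
  P (fun=> 0) -> (forall f g, P f -> P g -> P (fun x => f x + g x)) ->
  (forall i, P (F i)) -> P (fun x => \sum_(i <- s) F i x).
Proof.
move=> P0 Pa PF; elim: s => [|i s IH].
  by under eq_fun do rewrite big_nil.
by under eq_fun do rewrite big_cons; apply: Pa.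
Qed.

(** Stated for an arbitrary class [P], as it serves for bounded and continuous functions, analytic
    germs, algebraic germs and first-order expansions alike. *)
Lemma meval_closed (T : Type) m (P : (T -> C) -> Prop) (v : 'I_m -> T -> C) (p : mpoly m C) :
  (forall c, P (fun=> c)) -> (forall i, P (v i)) ->
  (forall f g, P f -> P g -> P (fun x => f x + g x)) ->
  (forall f g, P f -> P g -> P (fun x => f x * g x)) ->
  P (fun x => meval (fun i => v i x) p).
Proof.
move=> Pc Pv Pa Pm; under eq_fun do rewrite mevalE.
apply: big_closed => // mm; apply: (Pm (fun=> _)) => //.
have Px i k : P (fun x => v i x ^+ k).
  elim: k => [|k IH]; first by under eq_fun do rewrite expr0.
  by under eq_fun do rewrite exprS; apply: Pm.
elim: (index_enum _) => [|i s IH].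
  by under eq_fun do rewrite big_nil.
by under eq_fun do rewrite big_cons; apply: Pm.
Qed.

Variable n : nat.
Implicit Types (f g : 'rV[C]_n -> C) (A : set 'rV[C]_n).

Lemma polylimW A B f : A `<=` B -> polylim B f -> polylim A f.
Proof. by move=> AB Bf e /Bf[p Hp]; exists p => x /AB; exact: Hp. Qed.

Lemma eq_polylim A f g : (forall x, A x -> f x = g x) -> polylim A f -> polylim A g.
Proof. by move=> fg Af e /Af[p Hp]; exists p => x Ax; rewrite -fg //; exact: Hp. Qed.

Lemma polylim_lim A f : (forall e : R, 0 < e -> exists g, polylim A g /\
    forall x, A x -> normc (f x - g x) <= e) -> polylim A f.
Proof.
move=> H e e0; have e20 : 0 < e / 2 by rewrite divr_gt0.
have [g [/(_ _ e20)[p Hp] fg]] := H _ e20; exists p => x Ax.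
rewrite -(subrK (g x) (f x)) -addrA [e]splitr.
by apply: le_trans (le_normcD _ _) _; apply: lerD; [exact: fg|exact: Hp].
Qed.

Lemma polylim_meval A p : polylim A (fun x => meval (x 0) p).
Proof. by move=> e /ltW e0; exists p => x _; rewrite subrr normc0. Qed.

Lemma polylim_cst A c : polylim A (fun=> c).
Proof. by apply: eq_polylim (polylim_meval A (mpolyC n c)) => x _; rewrite mevalC. Qed.

Lemma polylim_coord A i : polylim A (fun x => x 0 i).
Proof.
by apply: eq_polylim (polylim_meval A (mpolyX _ (mnm1 i))) => x _; rewrite mevalXU.
Qed.

Lemma polylimD A f g : polylim A f -> polylim A g -> polylim A (fun x => f x + g x).
Proof.
move=> Af Ag e e0; have e20 : 0 < e / 2 by rewrite divr_gt0.
have [[p Hp] [q Hq]] := (Af _ e20, Ag _ e20); exists (p + q) => x Ax.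
rewrite mevalD opprD addrACA [e]splitr.
by apply: le_trans (le_normcD _ _) _; apply: lerD; [exact: Hp|exact: Hq].
Qed.

Lemma meval_bounded (p : mpoly n C) r : exists2 B : R, 0 < B &
  forall x : 'rV[C]_n, polydisc r x -> normc (meval (x 0) p) <= B.
Proof.
apply: (@meval_closed 'rV[C]_n n (fun f => exists2 B : R, 0 < B & forall x, polydisc r x ->
   normc (f x) <= B) (fun i x => x 0 i)).
- by move=> c; exists (normc c + 1) => [|x _]; rewrite ?ltr_wpDl ?normc_ge0 ?lerDl.
- by move=> i; exists (`|r| + 1) => [|x /(_ i) xr];
    rewrite ?ltr_wpDl // (le_trans xr) // (le_trans (ler_norm r)) // lerDl.
- move=> f g [B1 B10 H1] [B2 B20 H2]; exists (B1 + B2); first exact: addr_gt0.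
  by move=> x xr; apply: le_trans (le_normcD _ _) (lerD (H1 x xr) (H2 x xr)).
- move=> f g [B1 B10 H1] [B2 B20 H2]; exists (B1 * B2); first exact: mulr_gt0.
  by move=> x xr; rewrite normcM; apply: ler_pM; rewrite ?normc_ge0 ?H1 ?H2.
Qed.

Lemma polylim_bounded A r f : A `<=` polydisc r -> polylim A f -> exists2 B : R, 0 < B &
  forall x, A x -> normc (f x) <= B.
Proof.
move=> Ar /(_ 1 ltr01)[p Hp]; have [B B0 HB] := meval_bounded p r.
exists (B + 1); first by rewrite addr_gt0.
move=> x Ax; rewrite -(subrK (meval (x 0) p) (f x)) addrC.
by apply: le_trans (le_normcD _ _) (lerD (HB x (Ar x Ax)) (Hp x Ax)).
Qed.

Lemma polylimM A r f g : A `<=` polydisc r -> polylim A f -> polylim A g ->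
  polylim A (fun x => f x * g x).
Proof.
move=> Ar Af Ag; apply: polylim_lim => e e0.
have [B B0 HB] := polylim_bounded Ar Ag.
have [|p Hp] := Af (e / (2 * B)); first by rewrite divr_gt0 // mulr_gt0.
(* The precision required of the approximation of g depends on the bound for the polynomial already
   chosen for f. *)
have [B' B'0 HB'] := meval_bounded p r.
have [|q Hq] := Ag (e / (2 * B')); first by rewrite divr_gt0 // mulr_gt0.
exists (fun x => meval (x 0) (p * q)); split; first exact: polylim_meval.
move=> x Ax; rewrite mevalM.
rewrite (_ : _ - _ = (f x - meval (x 0) p) * g x + meval (x 0) p * (g x - meval (x 0) q)); last by ring.
apply: le_trans (le_normcD _ _) _; rewrite !normcM.
rewrite (_ : e = e / (2 * B) * B + B' * (e / (2 * B'))); last by field; rewrite !gt_eqF.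
apply: lerD; apply: ler_pM; rewrite ?normc_ge0 //.
- exact: Hp.
- exact: HB.
- exact/HB'/Ar.
- exact: Hq.
Qed.

End PolylimAlgebra.

(** * Geometrically convergent series *)

Section Series.
Variable R : realType.
Local Notation C := R[i].

Lemma real_series_lim (a : nat -> R) (K : R) : 0 <= K ->
  (forall k, `|a k| <= K / 2 ^+ k) ->
  exists s, forall N, `|s - \sum_(k < N) a k| <= 2 * K / 2 ^+ N.
Proof.
move=> K0 aK.
(* The sum lies within 2K/2^N of the N-th partial sum; these intervals are nested. *)
have [|N|s Hs] := @nested_limit R (fun N => \sum_(k < N) a k - 2 * K / 2 ^+ N) (4 * K).
- by rewrite mulr_ge0.
- have := aK N; rewrite ler_norml => /andP[a1 a2].
  rewrite big_ord_recr /=.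
  have -> : 2 * K / 2 ^+ N.+1 = K / 2 ^+ N by rewrite exprS; field; rewrite expf_neq0.
  have -> : 4 * K / 2 ^+ N.+1 = 2 * (K / 2 ^+ N) by rewrite exprS; field; rewrite expf_neq0.
  by rewrite -mulrA; apply/andP; split; lra.
exists s => N; have := Hs N => /andP[]; rewrite -!mulrA => h1 h2.
by rewrite ler_norml; apply/andP; split; lra.
Qed.

Lemma series_lim (T : Type) (A : set T) (q : nat -> T -> C) (K : R) : 0 <= K ->
  (forall k x, A x -> normc (q k x) <= K / 2 ^+ k) ->
  exists s : T -> C, forall N x, A x ->
    normc (s x - \sum_(k < N) q k x) <= 4 * K / 2 ^+ N.
Proof.
move=> K0 qK; suff H x : exists z : C, A x -> forall N,
    normc (z - \sum_(k < N) q k x) <= 4 * K / 2 ^+ N.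
  by have [s Hs] := choice H; exists s => N x /Hs.
have [Ax|nAx] := pselect (A x); last by exists 0.
have [|a Ha] := @real_series_lim (fun k => complex.Re (q k x)) K K0.
  by move=> k; apply: le_trans (ReM_normc _) (qK k x Ax).
have [|b Hb] := @real_series_lim (fun k => complex.Im (q k x)) K K0.
  by move=> k; apply: le_trans (ImM_normc _) (qK k x Ax).
exists (Complex a b) => _ N; apply: le_trans (normc_le_ReIm _) _.
have -> : 4 * K / 2 ^+ N = 2 * K / 2 ^+ N + 2 * K / 2 ^+ N by field; rewrite expf_neq0.
have sE : \sum_(k < N) q k x =
    Complex (\sum_(k < N) complex.Re (q k x)) (\sum_(k < N) complex.Im (q k x)).
  elim: N => [|N IH]; first by rewrite !big_ord0.
  by rewrite !big_ord_recr /= IH; case: (q N x).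
rewrite sE; set c := \sum_(k < N) _; set d := \sum_(k < N) _.
rewrite -[Complex a b - Complex c d]/(Complex (a - c) (b - d)) /=.
by apply: lerD; [exact: Ha|exact: Hb].
Qed.

End Series.

(** * Weierstrass division by a perturbation of a power of the last variable *)

Section WeierstrassDivision.
Variable R : realType.
Local Notation C := R[i].

Lemma rhead_rjoin n (x : 'rV[C]_n) t : rhead (rjoin x t) = x.
Proof. by apply/rowP => j; rewrite mxE rjoinE join_widen. Qed.

Definition bidisc n (sig rho : R) : set 'rV[C]_n.+1 :=
  [set y | polydisc sig (rhead y) /\ normc (y 0 ord_max) <= rho].

Lemma rjoin_bidisc n sig rho (x : 'rV[C]_n) t :
  bidisc sig rho (rjoin x t) <-> polydisc sig x /\ normc t <= rho.
Proof. by rewrite /bidisc /= rhead_rjoin rjoinE join_max. Qed.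

Lemma bidisc_polydisc n sig rho : @bidisc n sig rho `<=` polydisc (Num.max sig rho).
Proof.
move=> y; rewrite [y]rjoin_split => /rjoin_bidisc[xs tr].
apply/rjoin_polydisc; split; last by rewrite le_max tr orbT.
by move=> i; rewrite le_max xs.
Qed.

Lemma polydisc_bidisc n r : @polydisc R n.+1 r `<=` bidisc r r.
Proof. by move=> y; rewrite [y]rjoin_split => /rjoin_polydisc ?; apply/rjoin_bidisc. Qed.

Lemma polylim_head n (A : set 'rV[C]_n) (B : set 'rV[C]_n.+1) g :
  (forall y, B y -> A (rhead y)) -> polylim A g -> polylim B (fun y => g (rhead y)).
Proof.
move=> BA Ag e /Ag[p Hp]; exists (mwiden p) => y By.
rewrite meval_mwiden (_ : meval _ p = meval (rhead y 0) p); first exact/Hp/BA.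
by apply: meval_eq => j; rewrite mxE.
Qed.

Definition dropC s : R := (2 ^ s * s.+1 + 2)%:R.

Lemma dropC_gt0 s : 0 < dropC s.
Proof. by rewrite ltr0n addnS. Qed.

(** For |t| <= rho/2 Cauchy estimates and a geometric series bound the quotient by 2M/rho^s. For
    larger t the quotient times t^s is P minus its first s terms, at most (s+1)M, and dividing by
    t^s costs (2/rho)^s. [dropC] adds the two constants. *)
Lemma drop_poly_bound (P : {poly C}) (rho M : R) s : 0 < rho ->
  (forall t, normc t <= rho -> normc P.[t] <= M) ->
  forall t, normc t <= rho -> normc (drop_poly s P).[t] <= dropC s * M / rho ^+ s.
Proof.
move=> r0 PM t tr.
have M0 : 0 <= M by apply: le_trans (PM 0 _); rewrite ?normc_ge0 ?normc0 // ltW.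
have Pc k : normc P`_k <= M / rho ^+ k.
  by apply: cauchy_estimate => // z zr; apply: PM; rewrite zr.
have Mr : 0 <= M / rho ^+ s by rewrite divr_ge0 // exprn_ge0 // ltW.
have dE : dropC s * M / rho ^+ s = (2 ^ s * s.+1)%:R * (M / rho ^+ s) + 2 * (M / rho ^+ s).
  by rewrite /dropC natrD; ring.
rewrite dE; have [t2|t2] := leP (normc t) (rho / 2).
  apply: (@le_trans _ _ (2 * (M / rho ^+ s))); last by rewrite lerDr mulr_ge0.
  rewrite (_ : 2 * _ = M / rho ^+ s / (1 - 2^-1)); last by field; rewrite expf_neq0 ?gt_eqF.
  apply: normc_horner => // [|k]; first by apply/andP; split; lra.
  rewrite coef_drop_poly normcM normcX.
  have -> : M / rho ^+ s * 2^-1 ^+ k = M / rho ^+ (k + s) * (rho / 2) ^+ k.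
    by rewrite exprD expr_div_n exprVn; field; rewrite !expf_neq0 // gt_eqF.
  apply: ler_pM; rewrite ?normc_ge0 ?exprn_ge0 ?normc_ge0 //.
  by rewrite lerXn2r // nnegrE ?normc_ge0 // divr_ge0 // ltW.
have t0 : 0 < normc t by apply: lt_trans t2; rewrite divr_gt0.
apply: (@le_trans _ _ ((2 ^ s * s.+1)%:R * (M / rho ^+ s))); last by rewrite lerDl mulr_ge0.
have h : normc ((drop_poly s P).[t] * t ^+ s) <= s.+1%:R * M.
  have -> : (drop_poly s P).[t] * t ^+ s = P.[t] - (take_poly s P).[t].
    have := congr1 (horner^~ t) (poly_take_drop s P).
    by rewrite /= hornerD hornerM hornerXn => <-; ring.
  apply: le_trans (le_normcB _ _) _; rewrite -natr1 mulrDl mul1r addrC; apply: lerD; last exact: PM.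
  rewrite (horner_coef_wide _ (size_take_poly s P)).
  apply: le_trans (normc_sum _ _ _) _.
  rewrite mulr_natl -[X in _ *+ X]card_ord -sumr_const; apply: ler_sum => k _.
  rewrite coef_take_poly ltn_ord normcM normcX.
  apply: (@le_trans _ _ (M / rho ^+ k * rho ^+ k)).
    apply: ler_pM; rewrite ?normc_ge0 ?exprn_ge0 ?normc_ge0 //.
    by rewrite lerXn2r // nnegrE ?normc_ge0 // ltW.
  by rewrite divfK // expf_neq0 // gt_eqF.
rewrite normcM normcX -ler_pdivlMr ?exprn_gt0 // in h.
apply: le_trans h _; rewrite natrM natrX.
rewrite (_ : _ * _ * _ = s.+1%:R * M / (rho / 2) ^+ s); last first.
  by rewrite expr_div_n; field; rewrite !expf_neq0 // gt_eqF.
apply: ler_wpM2l; first by rewrite mulr_ge0.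
rewrite lef_pV2 ?posrE ?exprn_gt0 ?divr_gt0 // lerXn2r // ?nnegrE ?normc_ge0 ?divr_ge0 ?(ltW r0) //.
exact: ltW.
Qed.

Variables (n : nat) (sig rho : R) (s : nat) (err : 'rV[C]_n.+1 -> C).
Hypotheses (rho0 : 0 < rho) (sig0 : 0 < sig).
Hypothesis err_lim : polylim (bidisc sig rho) err.
Hypothesis err_small : forall y, bidisc sig rho y ->
  normc (err y) <= rho ^+ s / (8 * dropC s).

Let g (y : 'rV[C]_n.+1) : C := y 0 ord_max ^+ s + err y.
Let rem_fun (r : 'I_s -> 'rV[C]_n -> C) (y : 'rV[C]_n.+1) : C :=
  \sum_(j < s) r j (rhead y) * y 0 ord_max ^+ j.

Let bidiscP := @bidisc_polydisc n sig rho.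

(** Replace f by a polynomial up to M/8 and divide that by t^s, which is exact. The new remainder
    consists of the error M/8 and of [err] times the quotient, at most M/4 by the constant in
    [err_small]. *)
Lemma weierstrass_step (f : 'rV[C]_n.+1 -> C) M : 0 < M ->
  polylim (bidisc sig rho) f -> (forall y, bidisc sig rho y -> normc (f y) <= M) ->
  exists qr : ('rV[C]_n.+1 -> C) * ('I_s -> 'rV[C]_n -> C),
  [/\ polylim (bidisc sig rho) qr.1, forall j, polylim (polydisc sig) (qr.2 j),
    forall y, bidisc sig rho y -> normc (qr.1 y) <= 2 * dropC s / rho ^+ s * M,
    forall j x, polydisc sig x -> normc (qr.2 j x) <= 2 / rho ^+ j * M &
    forall y, bidisc sig rho y ->
      normc (f y - g y * qr.1 y - rem_fun qr.2 y) <= M / 2].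
Proof.
move=> M0 fl fM; have [|p Hp] := fl (M / 8); first by rewrite divr_gt0.
pose P x : {poly C} := map_poly (meval (x : 'I_n -> C)) (split_poly p).
have PE x t : meval (rjoin x t 0) p = (P (x 0)).[t].
  by rewrite -[in LHS](split_polyK p) rjoinE meval_unsplit.
have PM x t : polydisc sig x -> normc t <= rho -> normc (P (x 0)).[t] <= 2 * M.
  move=> xs tr; have yb : bidisc sig rho (rjoin x t) by apply/rjoin_bidisc.
  have := Hp _ yb; have := fM _ yb; rewrite PE => h1 h2.
  rewrite -(subKr (f (rjoin x t)) (P (x 0)).[t]).
  apply: le_trans (le_normcB _ _) _; lra.
pose q : 'rV[C]_n.+1 -> C := fun y => meval (y 0) (unsplit_poly (drop_poly s (split_poly p))).
pose r (j : 'I_s) : 'rV[C]_n -> C := fun x => meval (x 0) (split_poly p)`_j.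
have qE x t : q (rjoin x t) = (drop_poly s (P (x 0))).[t].
  rewrite /q rjoinE meval_unsplit; congr horner; apply/polyP => k.
  by rewrite coef_map !coef_drop_poly coef_map.
have rE x j : r j x = (P (x 0))`_j by rewrite coef_map.
have qb y : bidisc sig rho y -> normc (q y) <= 2 * dropC s / rho ^+ s * M.
  rewrite [y]rjoin_split => /rjoin_bidisc[xs tr]; rewrite qE.
  rewrite (_ : _ * M = dropC s * (2 * M) / rho ^+ s); last by ring.
  by apply: drop_poly_bound => // t; exact: PM.
exists (q, r); split=> //=.
- exact: polylim_meval.
- by move=> j; exact: polylim_meval.
- move=> j x xs; rewrite rE (_ : _ * M = 2 * M / rho ^+ j); last by ring.
  by apply: cauchy_estimate => // z zr; apply: PM; rewrite ?zr.
move=> y yb; have := qb y yb; have := err_small yb; have := Hp y yb.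
have -> : f y - g y * q y - rem_fun r y = (f y - meval (y 0) p) - err y * q y.
  rewrite /g /rem_fun [y]rjoin_split; set x := rhead y; set t := y 0 ord_max.
  rewrite PE qE rhead_rjoin rjoinE join_max.
  have := congr1 (horner^~ t) (poly_take_drop s (P (x 0))).
  rewrite /= hornerD hornerM hornerXn (horner_coef_wide _ (size_take_poly s _)) => <-.
  under [in RHS]eq_bigr => j _ do rewrite coef_take_poly ltn_ord -rE.
  by ring.
move=> h1 h2 h3; apply: le_trans (le_normcB _ _) _; rewrite normcM.
have := ler_pM (normc_ge0 _) (normc_ge0 _) h2 h3.
have -> : rho ^+ s / (8 * dropC s) * (2 * dropC s / rho ^+ s * M) = M / 4.
  by field; rewrite expf_neq0 ?gt_eqF ?dropC_gt0.
lra.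
Qed.

Lemma weierstrass_small (f : 'rV[C]_n.+1 -> C) : polylim (bidisc sig rho) f ->
  exists (q : 'rV[C]_n.+1 -> C) (r : 'I_s -> 'rV[C]_n -> C),
  [/\ polylim (bidisc sig rho) q, forall j, polylim (polydisc sig) (r j) &
    forall y, bidisc sig rho y -> f y = g y * q y + rem_fun r y].
Proof.
move=> fl; have [M M0 fM] := polylim_bounded bidiscP fl.
(* The steps are chosen for all functions at once, with zero where the hypotheses fail, so that the
   iteration below is a total recursion. *)
have /choice[st Hst] (h : 'rV[C]_n.+1 -> C) : exists S : nat ->
    ('rV[C]_n.+1 -> C) * ('I_s -> 'rV[C]_n -> C), forall k,
  polylim (bidisc sig rho) h -> (forall y, bidisc sig rho y -> normc (h y) <= M / 2 ^+ k) ->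
  [/\ polylim (bidisc sig rho) (S k).1, forall j, polylim (polydisc sig) ((S k).2 j),
    forall y, bidisc sig rho y -> normc ((S k).1 y) <= 2 * dropC s / rho ^+ s * (M / 2 ^+ k),
    forall j x, polydisc sig x -> normc ((S k).2 j x) <= 2 / rho ^+ j * (M / 2 ^+ k) &
    forall y, bidisc sig rho y ->
      normc (h y - g y * (S k).1 y - rem_fun (S k).2 y) <= M / 2 ^+ k / 2].
  suff /choice[S HS] : forall k, exists qr : ('rV[C]_n.+1 -> C) * ('I_s -> 'rV[C]_n -> C),
      polylim (bidisc sig rho) h -> (forall y, bidisc sig rho y -> normc (h y) <= M / 2 ^+ k) ->
    [/\ polylim (bidisc sig rho) qr.1, forall j, polylim (polydisc sig) (qr.2 j),
      forall y, bidisc sig rho y -> normc (qr.1 y) <= 2 * dropC s / rho ^+ s * (M / 2 ^+ k),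
      forall j x, polydisc sig x -> normc (qr.2 j x) <= 2 / rho ^+ j * (M / 2 ^+ k) &
      forall y, bidisc sig rho y ->
        normc (h y - g y * qr.1 y - rem_fun qr.2 y) <= M / 2 ^+ k / 2].
    by exists S.
  move=> k; have [[H1 H2]|nH] := pselect (polylim (bidisc sig rho) h /\
      forall y, bidisc sig rho y -> normc (h y) <= M / 2 ^+ k).
    have [|qr Hqr] := weierstrass_step _ H1 H2; last by exists qr.
    by rewrite divr_gt0 // exprn_gt0.
  by exists (fun=> 0, fun _ _ => 0) => H1 H2; exfalso; apply: nH.
pose next k (h : 'rV[C]_n.+1 -> C) y := h y - g y * (st h k).1 y - rem_fun (st h k).2 y.
pose F := fix F k := if k is k'.+1 then next k' (F k') else f.
have gl : polylim (bidisc sig rho) g.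
  apply: polylimD err_lim; apply: eq_polylim (polylim_meval _ (mpolyX _ (mnm1 ord_max) ^+ s)).
  by move=> y _; rewrite rmorphXn /= mevalXU.
have reml r : (forall j, polylim (polydisc sig) (r j)) -> polylim (bidisc sig rho) (rem_fun r).
  move=> rl; apply: big_closed; first exact: polylim_cst.
    by move=> *; exact: polylimD.
  move=> j; apply: (polylimM bidiscP); first by apply: polylim_head (rl j) => y [].
  apply: eq_polylim (polylim_meval _ (mpolyX _ (mnm1 ord_max) ^+ j)).
  by move=> y _; rewrite rmorphXn /= mevalXU.
have FP k : polylim (bidisc sig rho) (F k) /\
    forall y, bidisc sig rho y -> normc (F k y) <= M / 2 ^+ k.
  elim: k => [|k [IH1 IH2]]; first by rewrite expr0 divr1.
  have [s1 s2 s3 s4 s5] := Hst (F k) k IH1 IH2; split=> [/=|y yb].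
    apply: polylimD; last first.
      by apply: eq_polylim (polylimM bidiscP (polylim_cst _ (-1)) (reml _ s2)) => y _; rewrite mulN1r.
    apply: polylimD => //.
    apply: eq_polylim (polylimM bidiscP (polylim_cst _ (-1)) (polylimM bidiscP gl s1)) => y _.
    by rewrite mulN1r.
  by rewrite exprSr invfM mulrA; exact: s5.
pose Q k := (st (F k) k).1; pose Rm k := (st (F k) k).2.
have QP k := Hst (F k) k (FP k).1 (FP k).2.
pose K1 := 2 * dropC s / rho ^+ s * M.
have K10 : 0 <= K1 by rewrite /K1 !mulr_ge0 ?invr_ge0 ?exprn_ge0 ?(ltW rho0) ?(ltW M0) // ltW // dropC_gt0.
have [k y yb|q Hq] := @series_lim R _ (bidisc sig rho) Q K1 K10.
  by have [_ _ H _ _] := QP k; have := H y yb; rewrite /K1 /Q; rewrite mulrA.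
have /choice[r Hr] (j : 'I_s) : exists r : 'rV[C]_n -> C, forall N x, polydisc sig x ->
    normc (r x - \sum_(k < N) Rm k j x) <= 4 * (2 / rho ^+ j * M) / 2 ^+ N.
  apply: (@series_lim R _ (polydisc sig) (fun k x => Rm k j x)) => [|k x xs].
    by rewrite !mulr_ge0 ?invr_ge0 ?exprn_ge0 ?(ltW rho0) ?(ltW M0).
  by have [_ _ _ H _] := QP k; have := H j x xs; rewrite mulrA.
have FE N y : F N y = f y - g y * \sum_(k < N) Q k y - rem_fun (fun j x => \sum_(k < N) Rm k j x) y.
  elim: N => [|N IH].
    rewrite !big_ord0 mulr0 subr0 /rem_fun big1 ?subr0 // => j _.
    by rewrite big_ord0 mul0r.
  rewrite /= /next IH -/(Q N) -/(Rm N) big_ord_recr /=.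
  have -> : rem_fun (fun j x => \sum_(k < N.+1) Rm k j x) y =
      rem_fun (fun j x => \sum_(k < N) Rm k j x) y + rem_fun (Rm N) y.
    rewrite /rem_fun -big_split /=; apply: eq_bigr => j _.
    by rewrite big_ord_recr mulrDl.
  by ring.
exists q, r; split.
- apply: polylim_lim => e e0; have [N HN] := half_pow_small (4 * K1) e0.
  exists (fun y => \sum_(k < N) Q k y); split.
    apply: big_closed; [exact: polylim_cst|by move=> *; exact: polylimD|].
    by move=> k; have [] := QP k.
  by move=> y yb; apply: le_trans (Hq N y yb) (ltW HN).
- move=> j; apply: polylim_lim => e e0.
  have [N HN] := half_pow_small (4 * (2 / rho ^+ j * M)) e0.
  exists (fun x => \sum_(k < N) Rm k j x); split.
    apply: big_closed; [exact: polylim_cst|by move=> *; exact: polylimD|].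
    by move=> k; have [_ H _ _ _] := QP k; exact: H.
  by move=> x xs; apply: le_trans (Hr j N x xs) (ltW HN).
move=> y yb; have [B B0 HB] := polylim_bounded bidiscP gl.
(* Collects, at stage N and up to 1/2^N, the remainder [F N] and the tails of the series for q and
   for each r j. *)
pose K2 := M + B * (4 * K1) + \sum_(j < s) 4 * (2 / rho ^+ j * M) * rho ^+ j.
apply/eqP; rewrite -subr_eq0 -normc_eq0 eq_le normc_ge0 andbT.
apply/ler_addgt0Pr => e e0; rewrite add0r.
have [N HN] := half_pow_small K2 e0; apply: le_trans (ltW HN).
have -> : f y - (g y * q y + rem_fun r y) = F N y - g y * (q y - \sum_(k < N) Q k y)
   - \sum_(j < s) (r j (rhead y) - \sum_(k < N) Rm k j (rhead y)) * y 0 ord_max ^+ j.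
  rewrite FE.
  have -> : \sum_(j < s) (r j (rhead y) - \sum_(k < N) Rm k j (rhead y)) * y 0 ord_max ^+ j =
      rem_fun r y - rem_fun (fun j x => \sum_(k < N) Rm k j x) y.
    by rewrite /rem_fun -sumrB; apply: eq_bigr => j _; rewrite mulrBl.
  by ring.
have -> : K2 / 2 ^+ N = M / 2 ^+ N + B * (4 * K1 / 2 ^+ N) +
   \sum_(j < s) 4 * (2 / rho ^+ j * M) / 2 ^+ N * rho ^+ j.
  rewrite /K2 2!mulrDl (mulrA B (4 * K1)); congr (_ + _ + _); rewrite mulr_suml.
  by apply: eq_bigr => j _; ring.
apply: le_trans (le_normcB _ _) _; apply: lerD.
  apply: le_trans (le_normcB _ _) _; apply: lerD; first exact: (FP N).2.
  by rewrite normcM; apply: ler_pM; rewrite ?normc_ge0 ?HB ?Hq.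
apply: le_trans (normc_sum _ _ _) _; apply: ler_sum => j _.
case: yb => xs tr; rewrite normcM normcX; apply: ler_pM; rewrite ?normc_ge0 ?exprn_ge0 ?normc_ge0 ?Hr //.
by rewrite lerXn2r // nnegrE ?normc_ge0 // ltW.
Qed.

End WeierstrassDivision.

(** * Continuity and uniqueness of division *)

Section Preparation.
Variable R : realType.
Local Notation C := R[i].

Lemma C_continuousP (f : C -> C) a : {for a, continuous f} <->
  forall e : R, 0 < e -> exists2 d : R, 0 < d &
    forall x, normc (x - a) < d -> normc (f x - f a) < e.
Proof.
split=> [cf e e0|H P /nbhs_C[e e0 eP]].
  by apply/nbhs_C; apply: (cf [set y | normc (y - f a) < e]); apply/nbhs_C; exists e.
by have [d d0 Hd] := H e e0; apply/nbhs_C; exists d => // x /Hd/eP.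
Qed.

Lemma rV_continuousP n (f : 'rV[C]_n -> C) a : {for a, continuous f} <->
  forall e : R, 0 < e -> exists2 d : R, 0 < d &
    forall x : 'rV[C]_n, (forall i, normc (x 0 i - a 0 i) < d) -> normc (f x - f a) < e.
Proof.
split=> [/continuous_C cf e e0|H]; first exact/nbhs_rV/cf.
by apply/continuous_C => e e0; apply/nbhs_rV/H.
Qed.

Lemma continuous_meval n (p : mpoly n C) : continuous (fun x : 'rV[C]_n => meval (x 0) p).
Proof.
apply: (@meval_closed R 'rV[C]_n n (fun f => continuous f) (fun i x => x 0 i)).
- by move=> c x; exact: cst_continuous.
- by move=> i x; exact: coord_continuous.
- by move=> f g cf cg x; apply: continuousD; [exact: cf|exact: cg].
- by move=> f g cf cg x; apply: continuousM; [exact: cf|exact: cg].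
Qed.

Lemma polylim_continuous n (A : set 'rV[C]_n) f a : nbhs a A -> polylim A f ->
  {for a, continuous f}.
Proof.
move=> aA Af; apply/continuous_C => e e0.
have e30 : 0 < e / 3 by rewrite divr_gt0.
have [p Hp] := Af _ e30.
have /continuous_C/(_ _ e30) := @continuous_meval n p a.
have Aa := nbhs_singleton aA; apply: filterS2 aA => x Ax px.
rewrite (_ : f x - f a = (f x - meval (x 0) p) - (f a - meval (a 0) p) + (meval (x 0) p - meval (a 0) p)); last by ring.
have := le_normcD ((f x - meval (x 0) p) - (f a - meval (a 0) p)) (meval (x 0) p - meval (a 0) p).
have := le_normcB (f x - meval (x 0) p) (f a - meval (a 0) p).
have := Hp x Ax; have := Hp a Aa; lra.
Qed.

Lemma continuous_rjoin n (x : 'rV[C]_n) (f : 'rV[C]_n.+1 -> C) t :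
  {for rjoin x t, continuous f} -> {for t, continuous (fun u => f (rjoin x u))}.
Proof.
move=> /rV_continuousP H; apply/C_continuousP => e /H[d d0 Hd]; exists d => // u ut.
apply: Hd => i; rewrite !rjoinE /join; case: unliftP => // j _.
by rewrite subrr normc0.
Qed.

Lemma vanish_limit (f : C -> C) a (d : R) : 0 < d -> {for a, continuous f} ->
  (forall t, normc (t - a) < d -> t != a -> f t = 0) -> f a = 0.
Proof.
move=> d0 /C_continuousP cf f0; apply/eqP; rewrite -normc_eq0 eq_le normc_ge0 andbT.
rewrite leNgt; apply/negP => fa0; have [d' d'0 H] := cf _ fa0.
pose e := Num.min d d' / 2.
have e0 : 0 < e by rewrite divr_gt0 // lt_min d0.
have ed : e < d /\ e < d'.
  by rewrite /e; case: (leP d d') => h; split; lra.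
have ae : normc (a + e%:C - a) = e by rewrite addrC addKr normc_real gtr0_norm.
have := H (a + e%:C); rewrite ae f0 ?ae ?sub0r ?normcN ?ltxx; first by move=> /(_ ed.2).
  exact: ed.1.
by rewrite -subr_eq0 addrC addKr -normc_gt0 normc_real normr_gt0 gt_eqF.
Qed.

Lemma poly_continuous (p : {poly C}) : continuous (horner p).
Proof.
elim/poly_ind: p => [|p c IH] x.
  by rewrite (_ : horner 0 = fun=> 0); [exact: cst_continuous|apply/funext => t; rewrite horner0].
rewrite (_ : horner _ = fun t => p.[t] * t + c); last by apply/funext => t; rewrite hornerMXaddC.
apply: (@continuousD _ _ _ (fun t : C => p.[t] * t) (fun=> c)); last exact: cst_continuous.
by apply: (@continuousM _ _ (horner p) id); [exact: IH|exact: cvg_id].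
Qed.

(** Uniqueness in Weierstrass division. All roots of W lie in the disc, so p has at least as many
    roots as W, with multiplicity: one linear factor is split off p and W at a time, and continuity
    of [d] restores the identity at the root. *)
Lemma root_division (W p : {poly C}) (rho : R) (d : C -> C) :
  W \is monic -> (size p < size W)%N ->
  (forall t, root W t -> normc t < rho) ->
  (forall t, root W t -> {for t, continuous d}) ->
  (forall t, normc t < rho -> p.[t] = W.[t] * d t) -> p = 0.
Proof.
move=> Wm; have [s Ws] := closed_field_poly_normal W.
rewrite (monicP Wm) scale1r in Ws; rewrite {}Ws {Wm}.
elim: s p => [|a s IH] p; first by rewrite big_nil size_poly1 ltnS leqn0 size_poly_eq0 => /eqP.
rewrite big_cons => ps roots dc pd.
have ar : normc a < rho by apply: roots; rewrite rootM root_XsubC eqxx.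
have /factor_theorem[p1 pE] : root p a.
  by rewrite /root pd // hornerM hornerXsubC subrr !mul0r.
suff p10 : p1 = 0 by rewrite pE p10 mul0r.
have da : {for a, continuous d} by apply: dc; rewrite rootM root_XsubC eqxx.
have roots' t : root (\prod_(z <- s) ('X - z%:P)) t -> normc t < rho.
  by move=> rt; apply: roots; rewrite rootM rt orbT.
have dc' t : root (\prod_(z <- s) ('X - z%:P)) t -> {for t, continuous d}.
  by move=> rt; apply: dc; rewrite rootM rt orbT.
apply: (IH p1 _ roots' dc').
- have [->|p1n0] := eqVneq p1 0; first by rewrite size_poly0 lt0n size_poly_eq0 prodf_seq_neq0;
    apply/allP => b _; rewrite polyXsubC_eq0.
  have Pn0 : \prod_(z <- s) ('X - z%:P) != 0 :> {poly C}.
    by rewrite prodf_seq_neq0; apply/allP => b _; rewrite polyXsubC_eq0.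
  move: ps; rewrite pE (mulrC ('X - a%:P)) !size_Mmonic ?monicXsubC //.
  by rewrite !size_XsubC !addn2 ltnS.
move=> t tr; have pt u : normc u < rho -> u != a -> p1.[u] = (\prod_(z <- s) ('X - z%:P)).[u] * d u.
  move=> ur ua; have ua0 : u - a != 0 by rewrite subr_eq0.
  apply: (mulfI ua0); have := pd u ur; rewrite pE !hornerM hornerXsubC => H.
  by rewrite mulrC H mulrA.
have [->|] := eqVneq t a; last exact: pt.
apply/eqP; rewrite -subr_eq0; apply/eqP.
apply: (@vanish_limit (fun u => p1.[u] - (\prod_(z <- s) ('X - z%:P)).[u] * d u) a (rho - normc a)).
- by rewrite subr_gt0.
- apply: continuousB; first exact: poly_continuous.
  by apply: continuousM; [exact: poly_continuous|exact: da].
- move=> u ua una; rewrite pt ?subrr //.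
  by rewrite -(subrK a u); apply: le_lt_trans (le_normcD _ _) _; lra.
Qed.

End Preparation.

(** * Dense nonvanishing, orders of vanishing, division near the last axis *)

Section Preparation.
Variable R : realType.
Local Notation C := R[i].

Lemma nonroot_near (p : {poly C}) t0 (d : R) : p != 0 -> 0 < d ->
  exists2 t, normc (t - t0) < d & p.[t] != 0.
Proof.
move=> p0 d0; apply: contrapT => H.
(* These are [size p] distinct points in the disc, one more than p can have roots. *)
pose s := [seq t0 + (d / k.+2%:R)%:C | k <- iota 0 (size p)].
have us : uniq s.
  rewrite map_inj_uniq ?iota_uniq // => i j /addrI/complexI/(mulfI (lt0r_neq0 d0))/invr_inj.
  by move=> /eqP; rewrite eqr_nat => /eqP [].
have rs : all (root p) s.
  apply/allP => _ /mapP[k _ ->]; apply/negPn/negP => pk; apply: H.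
  exists (t0 + (d / k.+2%:R)%:C); last exact: pk.
  rewrite addrC addKr normc_real ger0_norm ?divr_ge0 ?(ltW d0) //.
  by rewrite ltr_pdivrMr // ltr_pMr // ltr1n.
by have := max_poly_roots p0 rs us; rewrite size_map size_iota ltnn.
Qed.

(** The form in which w may be cancelled from identities between continuous functions. *)
Definition dense_at n (w : 'rV[C]_n -> C) (a : 'rV[C]_n) :=
  forall B, nbhs a B -> exists2 y, B y & w y != 0.

Lemma dense_at_monic n (w : 'rV[C]_n -> C) i :
  (forall x, exists2 p : {poly C}, p \is monic & forall t, w (upd x i t) = p.[t]) ->
  forall a, dense_at w a.
Proof.
move=> H a B /nbhs_rV[d d0 Bd]; have [p pm wp] := H a.
have [t ta pt] := nonroot_near (a 0 i) (monic_neq0 pm) d0.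
exists (upd a i t); last by rewrite wp.
by apply: Bd => j; rewrite mxE; case: eqP => [-> //|_]; rewrite subrr normc0.
Qed.

Lemma dense_vanish n (w f : 'rV[C]_n -> C) a : dense_at w a -> {for a, continuous f} ->
  (\forall y \near a, w y != 0 -> f y = 0) -> f a = 0.
Proof.
move=> wa /continuous_C cf f0; apply/eqP; rewrite -normc_eq0 eq_le normc_ge0 andbT leNgt.
apply/negP => /cf; move: f0 => /filterI H /H{H} /wa[y [/[swap] fy /[swap] wy]].
by move=> /(_ wy) fy0; rewrite fy0 sub0r normcN ltxx in fy.
Qed.

Definition analytic0 n (f : 'rV[C]_n -> C) := exists2 r : R, 0 < r & polylim (polydisc r) f.

(** A weak maximum principle: Cauchy estimates on the circle, summed at half the radius, lose a
    factor 2. *)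
Lemma max_principle (q : 'rV[C]_1 -> C) (rho M : R) : 0 < rho ->
  polylim (polydisc rho) q ->
  (forall t, normc t = rho -> normc (q (rjoin 0 t)) <= M) ->
  forall t, normc t <= rho / 2 -> normc (q (rjoin 0 t)) <= 2 * M.
Proof.
move=> r0 ql qM t tr.
have d0 : polydisc rho (0 : 'rV[C]_0) by case.
have tr' : normc t <= rho by lra.
apply/ler_addgt0Pr => e e0; have [|p Hp] := ql (e / 3); first by rewrite divr_gt0.
have hp u : normc u <= rho -> normc (q (rjoin 0 u) - (map_poly (meval ((0 : 'rV[C]_0) 0)) (split_poly p)).[u]) <= e / 3.
  move=> ur; rewrite -meval_unsplit split_polyK -rjoinE; apply: Hp.
  by apply/rjoin_polydisc.
set P := map_poly _ _ in hp.
have PM u : normc u = rho -> normc P.[u] <= M + e / 3.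
  move=> ur; rewrite -(subKr (q (rjoin 0 u)) P.[u]); apply: le_trans (le_normcB _ _) _.
  by apply: lerD; [exact: qM|apply: hp; rewrite ur].
have M0 : 0 <= M + e / 3.
  by apply: le_trans (PM rho%:C _); rewrite ?normc_ge0 // normc_real gtr0_norm.
have h1 : normc P.[t] <= (M + e / 3) / (1 - 2^-1).
  apply: normc_horner => // [|k]; first by apply/andP; split; lra.
  rewrite normcM normcX; have -> : (M + e / 3) * 2^-1 ^+ k = (M + e / 3) / rho ^+ k * (rho / 2) ^+ k.
    by rewrite expr_div_n exprVn; field; rewrite !expf_neq0 // gt_eqF.
  apply: ler_pM; rewrite ?normc_ge0 ?exprn_ge0 ?normc_ge0 //.
    exact: cauchy_estimate.
  by rewrite lerXn2r // nnegrE ?normc_ge0 // divr_ge0 // ltW.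
have := hp t tr'; have := le_normcD (q (rjoin 0 t) - P.[t]) P.[t]; rewrite subrK.
have E : (M + e / 3) / (1 - 2^-1) = 2 * (M + e / 3) by field.
rewrite E in h1.
lra.
Qed.

(** If every t^s divided h, then [max_principle] for the quotients would give |h(t1)| <= 2M/2^s for
    all s, so h(t1) = 0. Hence a maximal s exists. *)
Lemma onevar_order (h : 'rV[C]_1 -> C) (rho : R) t1 : 0 < rho ->
  polylim (polydisc rho) h -> normc t1 <= rho / 2 -> h (rjoin 0 t1) != 0 ->
  exists s (q : 'rV[C]_1 -> C), [/\ polylim (polydisc rho) q, q (rjoin 0 0) != 0 &
    forall t, normc t <= rho -> h (rjoin 0 t) = t ^+ s * q (rjoin 0 t)].
Proof.
move=> r0 hl t1r ht1.
have rsub : @polydisc R 1 rho `<=` polydisc rho by [].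
have [M M0 hM] := polylim_bounded rsub hl.
have pd t : normc t <= rho -> polydisc rho (rjoin (0 : 'rV[C]_0) t).
  by move=> tr; apply/rjoin_polydisc; split=> // -[].
pose S s := exists2 q : 'rV[C]_1 -> C, polylim (polydisc rho) q &
    forall t, normc t <= rho -> h (rjoin 0 t) = t ^+ s * q (rjoin 0 t).
have [s [Ss nSs]] : exists s, S s /\ ~ S s.+1.
  apply: contrapT => H.
  have Sall s : S s.
    elim: s => [|s IH]; first by exists h => // t _; rewrite expr0 mul1r.
    by apply: contrapT => nS; apply: H; exists s.
  have [|l Hl] := @half_pow_small _ (2 * M) (normc (h (rjoin 0 t1))); first by rewrite normc_gt0.
  suff : normc (h (rjoin 0 t1)) <= 2 * M / 2 ^+ l.
    by lra.
  have [q ql qh] := Sall l.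
  rewrite qh; last by lra.
  have := @max_principle q rho (M / rho ^+ l) r0 ql _ t1 t1r.
  have hq t : normc t = rho -> normc (q (rjoin 0 t)) <= M / rho ^+ l.
    move=> tr; rewrite ler_pdivlMr ?exprn_gt0 // -tr -normcX -normcM mulrC -qh ?tr //.
    by apply/hM/pd; rewrite tr.
  move=> /(_ hq) H2; rewrite normcM normcX.
  have -> : 2 * M / 2 ^+ l = (rho / 2) ^+ l * (2 * (M / rho ^+ l)).
    by rewrite expr_div_n; field; rewrite !expf_neq0 // gt_eqF.
  apply: ler_pM; rewrite ?exprn_ge0 ?normc_ge0 //.
  by rewrite lerXn2r // nnegrE ?normc_ge0 // divr_ge0 // ltW.
have [q ql qh] := Ss; exists s, q; split=> //; apply/negP => /eqP q0; apply: nSs.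
have bp : @bidisc R 0 rho rho `<=` polydisc rho.
  by move=> y; rewrite [y]rjoin_split => /rjoin_bidisc ?; apply/rjoin_polydisc.
(* Division by t itself, with exponent 1 and no perturbation; the remainder is q(0) = 0, so one more
   t could be split off. *)
have [y _|q' [r [q'l _ qE]]] := @weierstrass_small R 0 rho rho 1 (fun=> 0) r0 (polylim_cst _ 0) _ q (polylimW bp ql).
  by rewrite normc0 divr_ge0 ?exprn_ge0 ?(ltW r0) // mulr_ge0 // ltW // dropC_gt0.
have qr t : normc t <= rho -> q (rjoin 0 t) = t * q' (rjoin 0 t) + r ord0 0.
  move=> tr; rewrite qE; last by apply/rjoin_bidisc; split=> // -[].
  by rewrite big_ord1 !rjoinE !join_max addr0 expr0 mulr1 rhead_rjoin.
have rr : r ord0 0 = 0.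
  by have := qr 0; rewrite normc0 q0 mul0r add0r => /(_ (ltW r0)).
exists q' => [|t tr]; first exact: polylimW (@polydisc_bidisc _ _ _) q'l.
by rewrite qh // qr // rr addr0 exprSr mulrA.
Qed.

(** Closeness to the restriction to the last axis, uniform over |t| <= rho. The class [U] also
    records boundedness, which the product rule requires. *)
Lemma meval_uniform n (p : mpoly n.+1 C) (rho : R) : 0 < rho -> forall e, 0 < e ->
  exists2 sig, 0 < sig & forall y, bidisc sig rho y ->
    normc (meval (y 0) p - meval (rjoin (0 : 'rV[C]_n) (y 0 ord_max) 0) p) <= e.
Proof.
move=> r0; pose z (y : 'rV[C]_n.+1) := rjoin (0 : 'rV[C]_n) (y 0 ord_max).
have zb y : bidisc 1 rho y -> bidisc 1 rho (z y).
  by case=> _ yr; apply/rjoin_bidisc; split=> // i; rewrite mxE normc0.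
pose U (F : 'rV[C]_n.+1 -> C) := (exists2 B : R, 0 < B & forall y, bidisc 1 rho y -> normc (F y) <= B) /\
  forall e : R, 0 < e -> exists2 sig, 0 < sig <= 1 & forall y, bidisc sig rho y ->
    normc (F y - F (z y)) <= e.
have bW (s s' : R) : s <= s' -> @bidisc R n s rho `<=` bidisc s' rho.
  by move=> ss y [ys yr]; split=> // i; apply: le_trans (ys i) ss.
suff [_ H] : U (fun y => meval (fun i => y 0 i) p).
  by move=> e /H[sig /andP[sig0 _] Hs]; exists sig.
apply: meval_closed.
- move=> c; split; first by exists (normc c + 1) => [|y _]; rewrite ?ltr_wpDl ?normc_ge0 ?lerDl.
  by move=> e e0; exists 1; rewrite ?lexx ?ltr01 // => y _; rewrite subrr normc0 ltW.
- move=> i; split.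
    exists (Num.max 1 rho); first by rewrite lt_max ltr01.
    by move=> y /bidisc_polydisc; apply.
  move=> e e0; exists (Num.min 1 e) => [|y [ys yr]]; first by rewrite lt_min ltr01 e0 ge_min lexx.
  rewrite rjoinE /join; case: unliftP => [j ->|->]; last by rewrite subrr normc0 ltW.
  rewrite mxE subr0 -widen_lift; have := ys j; rewrite mxE => H; apply: le_trans H _.
  by rewrite ge_min lexx orbT.
- move=> F G [[B1 B10 HB1] H1] [[B2 B20 HB2] H2]; split.
    exists (B1 + B2) => [|y yb]; first exact: addr_gt0.
    by apply: le_trans (le_normcD _ _) (lerD (HB1 y yb) (HB2 y yb)).
  move=> e e0; have e20 : 0 < e / 2 by rewrite divr_gt0.
  have [s1 /andP[s10 s11] Hs1] := H1 _ e20; have [s2 /andP[s20 s21] Hs2] := H2 _ e20.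
  exists (Num.min s1 s2) => [|y yb]; first by rewrite lt_min s10 s20 ge_min s11.
  have y1 : bidisc s1 rho y by apply: bW yb; rewrite ge_min lexx.
  have y2 : bidisc s2 rho y by apply: bW yb; rewrite ge_min lexx orbT.
  rewrite opprD addrACA [e]splitr; apply: le_trans (le_normcD _ _) _.
  by apply: lerD; [exact: Hs1|exact: Hs2].
- move=> F G [[B1 B10 HB1] H1] [[B2 B20 HB2] H2]; split.
    exists (B1 * B2) => [|y yb]; first exact: mulr_gt0.
    by rewrite normcM; apply: ler_pM; rewrite ?normc_ge0 ?HB1 ?HB2.
  move=> e e0.
  have [|s1 /andP[s10 s11] Hs1] := H1 (e / (2 * B2)); first by rewrite divr_gt0 // mulr_gt0.
  have [|s2 /andP[s20 s21] Hs2] := H2 (e / (2 * B1)); first by rewrite divr_gt0 // mulr_gt0.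
  exists (Num.min s1 s2) => [|y yb]; first by rewrite lt_min s10 s20 ge_min s11.
  have y1 : bidisc s1 rho y by apply: bW yb; rewrite ge_min lexx.
  have y2 : bidisc s2 rho y by apply: bW yb; rewrite ge_min lexx orbT.
  have yb1 : bidisc 1 rho y by apply: bW y1.
  rewrite (_ : _ - _ = (F y - F (z y)) * G y + F (z y) * (G y - G (z y))); last by ring.
  apply: le_trans (le_normcD _ _) _; rewrite !normcM.
  rewrite (_ : e = e / (2 * B2) * B2 + B1 * (e / (2 * B1))); last by field; rewrite !gt_eqF.
  apply: lerD; apply: ler_pM; rewrite ?normc_ge0 //.
  + exact: Hs1.
  + exact: HB2.
  + exact/HB1/zb.
  + exact: Hs2.
Qed.

Lemma polylim_uniform n (h : 'rV[C]_n.+1 -> C) (sig0 rho : R) : 0 < rho -> 0 < sig0 ->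
  polylim (bidisc sig0 rho) h -> forall e, 0 < e ->
  exists2 sig, 0 < sig <= sig0 & forall y, bidisc sig rho y ->
    normc (h y - h (rjoin 0 (y 0 ord_max))) <= e.
Proof.
move=> r0 s0 hl e e0; have e30 : 0 < e / 3 by rewrite divr_gt0.
have [p Hp] := hl _ e30; have [sig s1 Hs] := meval_uniform p r0 e30.
exists (Num.min sig sig0) => [|y [ys yr]]; first by rewrite lt_min s1 s0 ge_min lexx orbT.
have y1 : bidisc sig rho y by split=> // i; apply: le_trans (ys i) _; rewrite ge_min lexx.
have y2 : bidisc sig0 rho y by split=> // i; apply: le_trans (ys i) _; rewrite ge_min lexx orbT.
have z2 : bidisc sig0 rho (rjoin (0 : 'rV[C]_n) (y 0 ord_max)).
  by apply/(rjoin_bidisc sig0 rho); split=> // i; rewrite mxE normc0 ltW.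
set z := rjoin _ _ in z2 *.
rewrite (_ : h y - h z = (h y - meval (y 0) p) - (h z - meval (z 0) p) + (meval (y 0) p - meval (z 0) p)); last by ring.
have := le_normcD ((h y - meval (y 0) p) - (h z - meval (z 0) p)) (meval (y 0) p - meval (z 0) p).
have := le_normcB (h y - meval (y 0) p) (h z - meval (z 0) p).
have := Hp y y2; have := Hp z z2; have := Hs y y1; rewrite -/z; lra.
Qed.

(** The constant 16 on the axis is half of what [weierstrass_small] tolerates; the other half is
    spent on leaving the axis, by shrinking [sig1]. *)
Lemma weierstrass_division n (g : 'rV[C]_n.+1 -> C) (sig0 rho : R) s (b : C) :
  0 < rho -> 0 < sig0 -> b != 0 -> polylim (bidisc sig0 rho) g ->
  (forall t, normc t <= rho ->
     normc (g (rjoin 0 t) / b - t ^+ s) <= rho ^+ s / (16 * dropC R s)) ->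
  exists2 sig1, 0 < sig1 <= sig0 & forall sig, 0 < sig <= sig1 ->
  forall f, polylim (bidisc sig rho) f ->
  exists (q : 'rV[C]_n.+1 -> C) (r : 'I_s -> 'rV[C]_n -> C),
  [/\ polylim (bidisc sig rho) q, forall j, polylim (polydisc sig) (r j) &
    forall y, bidisc sig rho y ->
     f y = g y * q y + \sum_(j < s) r j (rhead y) * y 0 ord_max ^+ j].
Proof.
move=> r0 s0 b0 gl gb; have D0 := dropC_gt0 R s.
have gbl : polylim (bidisc sig0 rho) (fun y => b^-1 * g y).
  exact: (polylimM (@bidisc_polydisc R n sig0 rho) (polylim_cst _ _) gl).
pose e0 := rho ^+ s / (16 * dropC R s).
have e00 : 0 < e0 by rewrite divr_gt0 ?exprn_gt0 // mulr_gt0.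
have [sig1 /andP[s10 s11] Hs] := polylim_uniform r0 s0 gbl e00.
exists sig1 => [|sig /andP[sp sp1] f fl]; first by rewrite s10.
have bW (u u' : R) : u <= u' -> @bidisc R n u rho `<=` bidisc u' rho.
  by move=> ss y [ys yr]; split=> // i; apply: le_trans (ys i) ss.
pose err (y : 'rV[C]_n.+1) := b^-1 * g y - y 0 ord_max ^+ s.
have errl : polylim (bidisc sig rho) err.
  apply: polylimD; first by apply: polylimW gbl; apply: bW; exact: le_trans s11.
  apply: eq_polylim (polylim_meval _ (- mpolyX _ (mnm1 ord_max) ^+ s)).
  by move=> y _; rewrite mevalN rmorphXn /= mevalXU.
have [y yb|q [r [ql rl H]]] := @weierstrass_small R n sig rho s err r0 errl _ f fl.
  have yb1 : bidisc sig1 rho y by exact: bW yb.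
  have := gb (y 0 ord_max) yb.2; have := Hs y yb1; rewrite mulrC.
  have -> : err y = (g y / b - b^-1 * g (rjoin 0 (y 0 ord_max))) +
     (g (rjoin 0 (y 0 ord_max)) / b - y 0 ord_max ^+ s) by rewrite /err; ring.
  have -> : rho ^+ s / (8 * dropC R s) = e0 + e0.
    by rewrite /e0; field; rewrite gt_eqF.
  by move=> h1 h2; apply: le_trans (le_normcD _ _) _; apply: lerD.
exists (fun y => b^-1 * q y), r; split=> //.
  exact: (polylimM (@bidisc_polydisc R n sig rho) (polylim_cst _ _) ql).
by move=> y yb; rewrite H // /err; congr (_ + _); ring.
Qed.

End Preparation.

(** * Weierstrass polynomials and preparation *)

Section Coordinates.
Variable R : realType.
Local Notation C := R[i].

Definition wpoly n s (c : 'I_s -> 'rV[C]_n -> C) (x : 'rV[C]_n) : {poly C} :=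
  'X^s + \sum_(j < s) c j x *: 'X^j.

Lemma size_sum_Xn s (c : 'I_s -> C) : (size (\sum_(j < s) c j *: 'X^j)%R <= s)%N.
Proof.
apply: (leq_trans (size_sum _ _ _)); apply/bigmax_leqP => j _.
by apply: (leq_trans (size_scale_leq _ _)); rewrite size_polyXn.
Qed.

Lemma wpoly_monic n s (c : 'I_s -> 'rV[C]_n -> C) x : wpoly c x \is monic.
Proof.
rewrite monicE lead_coefDl ?lead_coefXn // size_polyXn ltnS.
exact: (size_sum_Xn (fun j => c j x)).
Qed.

Lemma horner_wpoly n s (c : 'I_s -> 'rV[C]_n -> C) x t :
  (wpoly c x).[t] = t ^+ s + \sum_(j < s) c j x * t ^+ j.
Proof.
rewrite hornerD hornerXn horner_sum; congr (_ + _).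
by apply: eq_bigr => j _; rewrite hornerZ hornerXn.
Qed.

Lemma rhead_upd_max n (y : 'rV[C]_n.+1) t : rhead (upd y ord_max t) = rhead y.
Proof. by rewrite [y]rjoin_split upd_rjoin_max !rhead_rjoin. Qed.

Lemma dense_wpoly n s (c : 'I_s -> 'rV[C]_n -> C) (a : 'rV[C]_n.+1) :
  dense_at (fun y => (wpoly c (rhead y)).[y 0 ord_max]) a.
Proof.
apply: (@dense_at_monic R n.+1 _ ord_max) => y.
exists (wpoly c (rhead y)); first exact: wpoly_monic.
by move=> t; rewrite rhead_upd_max mxE eqxx.
Qed.

(** Order s along the last axis. Continuity of the cofactor at 0 is what [root_division] by t^s asks
    for. *)
Definition regular_axis n (g : 'rV[C]_n.+1 -> C) s := exists b : C -> C,
  [/\ {for 0, continuous b}, b 0 != 0 & exists2 d : R, 0 < d &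
     forall t, normc t < d -> g (rjoin 0 t) = t ^+ s * b t].

(** Divide t^s by g: t^s = g q + r, so g q = t^s - r is a Weierstrass polynomial. On the axis r(0,
    t) = t^s (1 - b q) has degree below s, hence vanishes; therefore the coefficients are 0 at the
    origin and b(0) q(0) = 1. *)
Lemma weierstrass_preparation n (g : 'rV[C]_n.+1 -> C) s (r rmax : R) :
  0 < r -> 0 < rmax -> polylim (bidisc r r) g -> regular_axis g s ->
  exists (rho sig : R) (q : 'rV[C]_n.+1 -> C) (c : 'I_s -> 'rV[C]_n -> C),
  [/\ 0 < rho <= rmax /\ 0 < sig <= rmax,
    polylim (bidisc sig rho) q /\ q 0 != 0,
    forall j, polylim (polydisc sig) (c j) /\ c j 0 = 0 &
    forall y, bidisc sig rho y -> g y * q y = (wpoly c (rhead y)).[y 0 ord_max]].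
Proof.
move=> r0 rm0 gl [b [/C_continuousP cb b0 [d d0 gb]]].
have D0 := dropC_gt0 R s; have nb0 : 0 < normc (b 0) by rewrite normc_gt0.
have [|d1 d10 Hd1] := cb (normc (b 0) / (16 * dropC R s)).
  by rewrite divr_gt0 // mulr_gt0.
pose rho := Num.min (Num.min r rmax) (Num.min (d / 2) (d1 / 2)).
have rho0 : 0 < rho by rewrite !lt_min r0 rm0 !divr_gt0.
have rhor : rho <= r by rewrite !ge_min lexx.
have rhorm : rho <= rmax by rewrite !ge_min lexx !orbT.
have rhod : rho < d.
  by apply: (@le_lt_trans _ _ (d / 2)); [rewrite !ge_min lexx !orbT|lra].
have rhod1 : rho < d1.
  by apply: (@le_lt_trans _ _ (d1 / 2)); [rewrite !ge_min lexx !orbT|lra].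
have gl' : polylim (bidisc (Num.min r rmax) rho) g.
  apply: polylimW gl => y [ys yr]; split; last exact: le_trans rhor.
  by move=> i; apply: le_trans (ys i) _; rewrite ge_min lexx.
have [|t tr|sig1 /andP[s10 s11] H] :=
    @weierstrass_division R n g (Num.min r rmax) rho s (b 0) rho0 _ b0 gl'.
- by rewrite lt_min r0.
- rewrite gb ?(le_lt_trans tr) // (_ : _ - _ = t ^+ s * ((b t - b 0) / b 0)); last by field.
  rewrite normcM normcX; apply: ler_pM; rewrite ?exprn_ge0 ?normc_ge0 //.
    by rewrite lerXn2r // nnegrE ?normc_ge0 // ltW.
  rewrite normcM normcV ler_pdivrMr // mulrC; apply/ltW/Hd1.
  by rewrite subr0 (le_lt_trans tr).
have s1m : sig1 <= rmax by rewrite (le_trans s11) // ge_min lexx orbT.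
have [||q [c [ql cl wE]]] := H sig1 _ (fun y => y 0 ord_max ^+ s).
- by rewrite s10 lexx.
- apply: eq_polylim (polylim_meval _ (mpolyX _ (mnm1 ord_max) ^+ s)).
  by move=> y _; rewrite rmorphXn /= mevalXU.
have d0sig k (u : R) : 0 < u -> polydisc u (0 : 'rV[C]_k) by move=> u0 i; rewrite mxE normc0 ltW.
have yb t : normc t < rho -> bidisc sig1 rho (rjoin (0 : 'rV[C]_n) t).
  by move=> tr; apply/rjoin_bidisc; split; [exact: d0sig|exact: ltW].
have qc t : normc t < rho -> {for t, continuous (fun u => q (rjoin (0 : 'rV[C]_n) u))}.
  move=> tr; apply: continuous_rjoin; apply: polylim_continuous ql.
  pose e := Num.min sig1 (rho - normc t).
  have e0 : 0 < e by rewrite lt_min s10 subr_gt0.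
  apply/nbhs_rV; exists e => // y Hy; split.
    move=> j; have := Hy (widen_ord (leqnSn n) j); rewrite rjoinE join_widen mxE subr0.
    by move=> /ltW H'; rewrite mxE; apply: le_trans H' _; rewrite ge_min lexx.
  have := Hy ord_max; rewrite rjoinE join_max => H'.
  rewrite -(subrK t (y 0 ord_max)); apply: le_trans (le_normcD _ _) _.
  by rewrite -lerBrDr; apply: (le_trans (ltW H')); rewrite ge_min lexx orbT.
pose dq t := 1 - b t * q (rjoin 0 t).
have dqc : {for 0, continuous (fun t : C => 1 - b t * q (rjoin 0 t))}.
  apply: continuousB; first exact: cst_continuous.
  apply: (@continuousM _ _ b (fun t => q (rjoin 0 t))); first exact/C_continuousP.
  by apply: qc; rewrite normc0.
have dqE t : normc t < rho -> (\sum_(j < s) c j 0 *: 'X^j : {poly C}).[t] = t ^+ s * dq t.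
  move=> tr; have := wE _ (yb t tr); rewrite rhead_rjoin rjoinE join_max.
  rewrite gb ?(lt_trans tr) // horner_sum => E.
  under eq_bigr => j _ do rewrite hornerZ hornerXn.
  apply: (addrI (t ^+ s * b t * q (rjoin 0 t))); rewrite -E /dq; ring.
have c00 : \sum_(j < s) c j 0 *: 'X^j = 0 :> {poly C}.
  apply: (@root_division R 'X^s _ rho dq (monicXn _ _)).
  - by rewrite size_polyXn ltnS; exact: (size_sum_Xn (fun j => c j 0)).
  - by move=> t; rewrite rootE hornerXn expf_eq0 => /andP[_ /eqP ->]; rewrite normc0.
  - by move=> t; rewrite rootE hornerXn expf_eq0 => /andP[_ /eqP ->].
  - by move=> t tr; rewrite hornerXn dqE.
exists rho, sig1, q, (fun j x => - c j x); split.
- by rewrite rho0 s10.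
- split=> //; apply/negP => /eqP q0.
  have z0 : rjoin (0 : 'rV[C]_n) 0 = 0.
    by apply/rowP => i; rewrite rjoinE mxE /join; case: unlift => // j; rewrite mxE.
  have : dq 0 = 0.
    apply: (@vanish_limit R dq 0 rho rho0 dqc) => t; rewrite subr0 => tr t0.
    have := dqE t tr; rewrite c00 horner0 => /esym/eqP.
    by rewrite mulf_eq0 expf_eq0 (negPf t0) andbF => /eqP.
  by rewrite /dq z0 q0 mulr0 subr0 => /eqP; rewrite oner_eq0.
- move=> j; split.
    apply: eq_polylim (polylimM (fun x H => H) (polylim_cst (polydisc sig1) (-1)) (cl j)) => x _.
    by rewrite mulN1r.
  have := congr1 (fun p : {poly C} => p`_j) c00; rewrite coef0 coef_sum (bigD1 j) //=.
  rewrite big1 ?addr0 ?coefZ ?coefXn ?eqxx ?mulr1 => [->|i ij]; first by rewrite oppr0.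
  by rewrite coefZ coefXn eq_sym (_ : (i == j :> nat) = false) ?mulr0 //; exact: negbTE.
move=> y yb'; rewrite horner_wpoly wE //.
under [X in _ + X]eq_bigr => j _ do rewrite mulNr.
by rewrite sumrN addrK.
Qed.

End Coordinates.

(** * Linear changes of coordinates *)

Section LinearChange.
Variable R : realType.
Local Notation C := R[i].

Lemma meval_mulmx n k (L : 'M[C]_(n, k)) (p : mpoly k C) : exists q : mpoly n C,
  forall x : 'rV[C]_n, meval ((x *m L) 0) p = meval (x 0) q.
Proof.
apply: (@meval_closed R 'rV[C]_n k (fun F => exists q : mpoly n C,
   forall x : 'rV[C]_n, F x = meval (x 0) q) (fun i x => (x *m L) 0 i)).
- by move=> c; exists (mpolyC n c) => x; rewrite mevalC.
- move=> i; exists (\sum_j mpolyC n (L j i) * mpolyX _ (mnm1 j)) => x.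
  rewrite raddf_sum mxE; apply: eq_bigr => j _.
  by rewrite [RHS]mevalM mevalC mevalXU mulrC.
- by move=> f g [p1 H1] [p2 H2]; exists (p1 + p2) => x; rewrite mevalD H1 H2.
- by move=> f g [p1 H1] [p2 H2]; exists (p1 * p2) => x; rewrite mevalM H1 H2.
Qed.

Lemma mulmx_small n k (L : 'M[C]_(n, k)) (r : R) : 0 < r -> exists2 d : R, 0 < d &
  forall x : 'rV[C]_n, (forall i, normc (x 0 i) <= d) -> forall i, normc ((x *m L) 0 i) < r.
Proof.
move=> r0; pose B := 1 + \sum_i \sum_j normc (L i j).
have B0 : 0 < B.
  by rewrite ltr_wpDr // sumr_ge0 // => i _; rewrite sumr_ge0 // => j _; exact: normc_ge0.
exists (r / (2 * B)) => [|x xd i]; first by rewrite divr_gt0 // mulr_gt0.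
rewrite mxE; apply: le_lt_trans (normc_sum _ _ _) _.
apply: (@le_lt_trans _ _ (r / (2 * B) * B)); last first.
  by rewrite invfM mulrA divfK ?gt_eqF // ltr_pdivrMr // ltr_pMr // ltr1n.
rewrite /B mulrDr mulr1 mulr_sumr -[X in X <= _]add0r; apply: lerD.
  by rewrite divr_ge0 ?(ltW r0) // mulr_ge0 // ltW.
apply: ler_sum => j _; rewrite normcM; apply: ler_pM; rewrite ?normc_ge0 //.
by rewrite (bigD1 i) //= lerDl sumr_ge0 // => ? _; exact: normc_ge0.
Qed.

Lemma analytic0_mulmx n k (L : 'M[C]_(n, k)) (f : 'rV[C]_k -> C) : analytic0 f ->
  analytic0 (fun x => f (x *m L)).
Proof.
move=> [r r0 fl]; have [d d0 Hd] := mulmx_small L r0; exists d => // e /fl[p Hp].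
have [q Hq] := meval_mulmx L p; exists q => x xd; rewrite -Hq; apply: Hp => i.
by apply/ltW/Hd.
Qed.

Lemma near0_mulmx n k (L : 'M[C]_(n, k)) (P : 'rV[C]_k -> Prop) :
  (\forall y \near (0 : 'rV[C]_k), P y) -> \forall x \near (0 : 'rV[C]_n), P (x *m L).
Proof.
move=> /nbhs_rV[r r0 Hr]; have [d d0 Hd] := mulmx_small L r0.
apply/nbhs_rV; exists d => // x xd; apply: Hr => i; rewrite [X in _ - X]mxE subr0; apply: Hd => j.
by have := xd j; rewrite mxE subr0 => /ltW.
Qed.

Lemma row_complete n (v : 'rV[C]_n.+1) : v != 0 -> exists2 L : 'M[C]_n.+1,
  L \in unitmx & forall t, rjoin 0 t *m L = t *: v.
Proof.
move=> v0; pose E := row_ebase v; pose c := (col_ebase v) 0 0.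
have rk : \rank v = 1%N by rewrite rank_rV v0.
have vE : v = c *: row 0 E.
  rewrite -{1}(mulmx_ebase v) rk; apply/rowP => i.
  rewrite -mulmxA mxE big_ord1 -/c !mxE (bigD1 0) //= big1 => [|j j0]; last first.
    by rewrite mxE eq_sym (_ : (j == 0 :> nat) = false) ?mul0r //; exact: negbTE.
  by rewrite mxE /= mul1r addr0.
have c0 : c != 0 by apply: contra_neq v0; rewrite vE => ->; rewrite scale0r.
exists (c *: (tperm_mx ord_max 0 *m E)).
  by rewrite unitmxZ ?unitfE // unitmx_mul unitmx_perm row_ebase_unit.
move=> t; rewrite [in RHS]vE -scalemxAr mulmxA scalerA mulrC -scalerA; congr (c *: _).
have -> : rjoin (0 : 'rV[C]_n) t = t *: delta_mx 0 ord_max.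
  apply/rowP => i; rewrite rjoinE !mxE /join; case: unliftP => [j ->|->].
    by rewrite mxE eqxx /= eq_sym (negPf (neq_lift _ _)) mulr0.
  by rewrite !eqxx mulr1.
rewrite -!scalemxAl; congr (t *: _).
by rewrite -mulmxA -xrowE -rowE; apply/rowP => i; rewrite !mxE perm.tpermL.
Qed.

Lemma rjoin00 n : rjoin (0 : 'rV[C]_n) 0 = 0.
Proof.
by apply/rowP => i; rewrite rjoinE mxE /join; case: unlift => // j; rewrite mxE.
Qed.

Lemma polydisc_nbhs n (r : R) : 0 < r -> nbhs (0 : 'rV[C]_n) (polydisc r).
Proof.
move=> r0; apply/nbhs_rV; exists r => // x xr i.
by have := xr i; rewrite mxE subr0 => /ltW.
Qed.

Lemma analytic0_continuous n (f : 'rV[C]_n -> C) : analytic0 f ->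
  \forall x \near (0 : 'rV[C]_n), {for x, continuous f}.
Proof.
move=> [r r0 fl]; have := nbhs_interior (polydisc_nbhs n r0).
by apply: filterS => x xr; exact: polylim_continuous fl.
Qed.

(** Take a point v near 0 with g(v) nonzero and move the last axis onto the line through v;
    [onevar_order] then applies on that line. *)
Lemma regular_direction n (g : 'rV[C]_n.+1 -> C) : analytic0 g ->
  ~ (\forall y \near (0 : 'rV[C]_n.+1), g y = 0) ->
  exists2 L : 'M[C]_n.+1, L \in unitmx & exists s, regular_axis (fun y => g (y *m L)) s.
Proof.
move=> [r r0 gl] gn0.
(* With radius r/4 the disc |t| <= 2 of the line stays in the polydisc, and v, at t = 1, is in its
   half as [onevar_order] demands. *)
have [v vr gv] : exists2 v : 'rV[C]_n.+1, polydisc (r / 4) v & g v != 0.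
  apply: contrapT => H; apply: gn0; apply/nbhs_rV; exists (r / 4); first by rewrite divr_gt0.
  move=> x xr; apply/eqP/negPn/negP => gx; apply: H; exists x => // i.
  by have := xr i; rewrite mxE subr0 => /ltW.
have [v0|v0] := eqVneq v 0.
  exists 1%:M; first exact: unitmx1.
  exists 0%N, (fun t => g (rjoin 0 t)); split; last first.
  - by exists 1 => // t _; rewrite expr0 mul1r mulmx1.
  - by rewrite rjoin00 -v0.
  apply: continuous_rjoin; rewrite rjoin00; apply: polylim_continuous gl.
  exact: polydisc_nbhs.
have [L Lu Lv] := row_complete v0; exists L => //.
pose h (z : 'rV[C]_1) := g (z *m v).
have hl : polylim (polydisc 2) h.
  move=> e /gl[p Hp]; have [q Hq] := meval_mulmx v p; exists q => z z2.
  rewrite -Hq; apply: Hp => i; rewrite mxE big_ord1 normcM.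
  apply: (@le_trans _ _ (2 * (r / 4))); last by lra.
  by apply: ler_pM; rewrite ?normc_ge0.
have zv t : rjoin (0 : 'rV[C]_0) t *m v = t *: v.
  apply/rowP => i; rewrite mxE big_ord1 [RHS]mxE mxE /join.
  by case: unliftP => // -[].
have two0 : 0 < 2 :> R by [].
have [||s [q [ql q0 hq]]] := @onevar_order R h 2 1 two0 hl.
- by rewrite normc1; lra.
- by rewrite /h zv scale1r.
exists s, (fun t => q (rjoin 0 t)); split=> //.
  apply: continuous_rjoin; rewrite rjoin00; apply: polylim_continuous ql.
  exact: polydisc_nbhs.
by exists 2 => // t t2; rewrite Lv -hq ?ltW // /h zv.
Qed.

Lemma polydiscW n (r r' : R) : r <= r' -> @polydisc R n r `<=` polydisc r'.
Proof. by move=> rr x xr i; apply: le_trans (xr i) rr. Qed.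

Lemma bidisc_nbhs n (sig rho : R) : 0 < sig -> 0 < rho -> nbhs (0 : 'rV[C]_n.+1) (bidisc sig rho).
Proof.
move=> s0 r0; have m0 : 0 < Num.min sig rho by rewrite lt_min s0.
apply: filterS (polydisc_nbhs _ m0) => y; rewrite [y]rjoin_split => /rjoin_polydisc[xr tr].
apply/rjoin_bidisc; split.
  by apply: polydiscW xr; rewrite ge_min lexx.
by apply: le_trans tr _; rewrite ge_min lexx orbT.
Qed.

(** If f is not 0, it is in suitable coordinates a divisor of a Weierstrass polynomial w. Then g
    vanishes wherever w does not, a dense set, and hence everywhere nearby. *)
Lemma analytic0_prime n (f g : 'rV[C]_n -> C) : analytic0 f -> analytic0 g ->
  (\forall x \near (0 : 'rV[C]_n), f x * g x = 0) ->
  (\forall x \near (0 : 'rV[C]_n), f x = 0) \/ (\forall x \near (0 : 'rV[C]_n), g x = 0).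
Proof.
case: n => [|n] in f g *; move=> fa ga fg.
  have : f 0 * g 0 = 0 by exact: nbhs_singleton fg.
  have H (h : 'rV[C]_0 -> C) : h 0 = 0 -> \forall x \near (0 : 'rV[C]_0), h x = 0.
    by move=> h0; apply/nbhs_rV; exists 1 => // x _; rewrite (_ : x = 0) //; apply/rowP => -[].
  by move/eqP; rewrite mulf_eq0 => /orP[]/eqP/H; [left|right].
have [f0|fn0] := pselect (\forall x \near (0 : 'rV[C]_n.+1), f x = 0); [by left|right].
have [L Lu [s Ls]] := regular_direction fa fn0.
have [r r0 fl] := analytic0_mulmx L fa.
have fl' : polylim (bidisc (r / 2) (r / 2)) (fun y => f (y *m L)).
  apply: polylimW fl => y yb; have := bidisc_polydisc yb.
  by rewrite maxxx; apply: polydiscW; lra.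
have r20 : 0 < r / 2 by rewrite divr_gt0.
have [rho [sig [q [c [[/andP[rho0 _] /andP[sig0 _]] _ _ wE]]]]] :=
  weierstrass_preparation r20 r20 fl' Ls.
have gL0 : \forall y \near (0 : 'rV[C]_n.+1), g (y *m L) = 0.
  have gc := analytic0_continuous (analytic0_mulmx L ga).
  have := near0_mulmx L fg; move=> /filterI /(_ (bidisc_nbhs n sig0 rho0)).
  move=> /nbhs_interior fgb; apply: filterS2 fgb gc => y Hy cy.
  apply: (dense_vanish (@dense_wpoly R n s c y) cy).
  apply: filterS Hy => z [fgz zb] wz; apply/eqP; move/eqP: fgz; rewrite mulf_eq0.
  case/orP => // /eqP fz; have := wE z zb.
  by rewrite fz mul0r => wz0; rewrite -wz0 eqxx in wz.
have := near0_mulmx (invmx L) gL0; apply: filterS => x.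
by rewrite mulmxKV.
Qed.

End LinearChange.

(** * Gradients and Lipschitz bounds at a point *)

Section Gradient.
Variable R : realType.
Local Notation C := R[i].

Lemma filter_forall_fin (T : Type) (F : set_system T) {FF : Filter F} (I : finType) (P : I -> T -> Prop) :
  (forall i, F (P i)) -> F (fun x => forall i, P i x).
Proof.
move=> FP; have H (s : seq I) : F (fun x => forall i, i \in s -> P i x).
  elim: s => [|i s IH]; first by apply: filterE.
  apply: filterS2 (FP i) IH => x Pi Ps j; rewrite in_cons => /predU1P[->//|]; exact: Ps.
by apply: filterS (H (enum I)) => x Px i; apply: Px; rewrite mem_enum.
Qed.

Variable n : nat.
Implicit Types (f g : 'rV[C]_n -> C) (a x y : 'rV[C]_n).

Definition l1 x : R := \sum_i normc (x 0 i).

Lemma l1_ge0 x : 0 <= l1 x.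
Proof. by apply: sumr_ge0 => i _; exact: normc_ge0. Qed.

Lemma near_l1 a (P : set 'rV[C]_n) : (\forall x \near a, P x) <->
  exists2 d : R, 0 < d & forall x, l1 (x - a) < d -> P x.
Proof.
split=> [/nbhs_rV[d d0 Hd]|[d d0 Hd]].
  exists d => // x xa; apply: Hd => i; apply: le_lt_trans xa.
  rewrite /l1 (bigD1 i) //= !mxE lerDl.
  by apply: sumr_ge0 => j _; exact: normc_ge0.
apply/nbhs_rV; exists (d / n.+1%:R); first by rewrite divr_gt0.
move=> x xa; apply: Hd; apply: (@le_lt_trans _ _ (\sum_(i < n) d / n.+1%:R)).
  by apply: ler_sum => i _; rewrite !mxE ltW.
rewrite sumr_const card_ord -[_ *+ n]mulr_natr mulrAC ltr_pdivrMr // ltr_pM2l //.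
by rewrite ltr_nat.
Qed.

Definition lipschitz_near f a := exists (K d : R), [/\ 0 < K, 0 < d &
  forall x y, l1 (x - a) < d -> l1 (y - a) < d -> normc (f x - f y) <= K * l1 (x - y)].

Definition has_grad f a := exists B : 'cV[C]_n, forall eta : R, 0 < eta ->
  \forall x \near a, normc (f x - (f a + ((x - a) *m B) 0 0)) <= eta * l1 (x - a).

Lemma mulmx_l1 (B : 'cV[C]_n) : exists2 K : R, 0 < K &
  forall x, normc ((x *m B) 0 0) <= K * l1 x.
Proof.
exists (1 + \sum_i normc (B i 0)).
  by rewrite ltr_wpDr // sumr_ge0 // => i _; exact: normc_ge0.
move=> x; rewrite mxE /l1 mulr_sumr; apply: le_trans (normc_sum _ _ _) _.
apply: ler_sum => i _; rewrite normcM mulrC; apply: ler_pM; rewrite ?normc_ge0 //.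
rewrite (bigD1 i) //= addrCA lerDl addr_ge0 // sumr_ge0 // => j _; exact: normc_ge0.
Qed.

Lemma has_grad_cst (c : C) a : has_grad (fun=> c) a.
Proof.
exists 0 => eta eta0; apply: filterE => x.
by rewrite mulmx0 mxE addr0 subrr normc0 mulr_ge0 ?l1_ge0 // ltW.
Qed.

Lemma has_grad_coord i a : has_grad (fun x => x 0 i) a.
Proof.
exists (delta_mx i 0) => eta eta0; apply: filterE => x.
rewrite -colE !mxE (_ : _ - _ = 0); last by ring.
by rewrite normc0 mulr_ge0 ?l1_ge0 // ltW.
Qed.

Lemma has_gradD f g a : has_grad f a -> has_grad g a -> has_grad (fun x => f x + g x) a.
Proof.
move=> [B HB] [D HD]; exists (B + D) => eta eta0.
have e20 : 0 < eta / 2 by rewrite divr_gt0.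
apply: filterS2 (HB _ e20) (HD _ e20) => x hx hx'.
rewrite mulmxDr mxE.
rewrite (_ : _ - _ = (f x - (f a + ((x - a) *m B) 0 0)) + (g x - (g a + ((x - a) *m D) 0 0))); last by ring.
by rewrite [eta]splitr mulrDl; apply: le_trans (le_normcD _ _) (lerD hx hx').
Qed.

(** Where f vanishes, continuity of g suffices. This matters for [nashg_grad], whose cofactor
    contains the root that is to be differentiated. *)
Lemma has_grad_mul0 f g a : has_grad f a -> f a = 0 -> {for a, continuous g} ->
  has_grad (fun x => f x * g x) a.
Proof.
move=> [B HB] fa cg; exists (g a *: B) => eta eta0.
have [K K0 HK] := mulmx_l1 B.
pose M := normc (g a) + 1.
have M0 : 0 < M by rewrite ltr_wpDl ?normc_ge0.
have e1 : 0 < eta / (2 * M) by rewrite divr_gt0 // mulr_gt0.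
have e2 : 0 < eta / (2 * K) by rewrite divr_gt0 // mulr_gt0.
move/continuous_C: cg => cg.
near=> x.
have h1 : normc (f x - (f a + ((x - a) *m B) 0 0)) <= eta / (2 * M) * l1 (x - a).
  by near: x; exact: HB.
have h2 : normc (g x - g a) <= eta / (2 * K) by apply/ltW; near: x; exact: cg.
have h3 : normc (g x) <= M.
  rewrite -(subrK (g a) (g x)) addrC; apply: le_trans (le_normcD _ _) _.
  by rewrite lerD2l ltW //; near: x; exact: cg.
rewrite fa mul0r add0r -scalemxAr mxE.
rewrite fa add0r in h1; set F := ((x - a) *m B) 0 0 in h1 *.
rewrite (_ : _ - _ = (f x - F) * g x + F * (g x - g a)); last by ring.
apply: le_trans (le_normcD _ _) _; rewrite !normcM.
rewrite (_ : eta * l1 (x - a) = eta / (2 * M) * l1 (x - a) * M + K * l1 (x - a) * (eta / (2 * K))).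
  apply: lerD; apply: ler_pM; rewrite ?normc_ge0 //; exact: HK.
by field; rewrite !gt_eqF.
Unshelve. all: by end_near. Qed.

Lemma has_grad_near f g a : (\forall x \near a, f x = g x) -> has_grad f a -> has_grad g a.
Proof.
move=> fg [B HB]; have fga := nbhs_singleton fg.
exists B => eta /HB; apply: filterS2 fg => x fx; by rewrite fx fga.
Qed.

Lemma has_gradM f g a : {for a, continuous g} -> has_grad f a -> has_grad g a ->
  has_grad (fun x => f x * g x) a.
Proof.
move=> cg hf hg.
have h0 (h : 'rV[C]_n -> C) : has_grad h a -> has_grad (fun x => h x - h a) a.
  by move=> hh; apply: has_gradD => //; exact: has_grad_cst.
have h1 := has_grad_mul0 (h0 f hf) (subrr _) cg.
have cfa : {for a, continuous (fun _ : 'rV[C]_n => f a)} by exact: cst_continuous.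
have h2 := has_grad_mul0 (h0 g hg) (subrr _) cfa.
apply: has_grad_near (has_gradD (has_gradD h1 h2) (has_grad_cst (f a * g a) a)).
by apply: filterE => x; ring.
Qed.

Lemma lipschitz_bounded f a : lipschitz_near f a -> exists (M d : R), [/\ 0 < M, 0 < d &
  forall x, l1 (x - a) < d -> normc (f x) <= M].
Proof.
move=> [K [d [K0 d0 H]]]; exists (normc (f a) + K * d), d; split=> //.
  by rewrite ltr_wpDl ?normc_ge0 // mulr_gt0.
move=> x xa; rewrite -(subrK (f a) (f x)) addrC; apply: le_trans (le_normcD _ _) _.
rewrite lerD2l; apply: le_trans (H x a xa _) _; last by rewrite ler_wpM2l ?ltW.
by rewrite subrr /l1 big1 // => i _; rewrite mxE normc0.
Qed.

End Gradient.

(** * From gradients to complex differentiability *)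

Section Differentiable.
Variable R : realType.
Local Notation C := R[i].

Lemma mx_norm_leP m (M : 'rV[C]_m) (e : R) : 0 <= e ->
  (forall i, normc (M 0 i) <= e) -> `|M| <= e%:C.
Proof.
move=> e0 Me; rewrite -[`|M|]/(mx_norm M).
have [->|/mx_norm_neq0[[j i] /= ->]] := eqVneq (mx_norm M) 0; first by rewrite lecR.
by rewrite (ord1 j) normE lecR.
Qed.

Lemma mx_norm_entry m (M : 'rV[C]_m) : exists2 e : R, `|M| = e%:C & 0 <= e /\ forall i, normc (M 0 i) <= e.
Proof.
have N0 : 0 <= `|M| by exact: normr_ge0.
exists (complex.Re `|M|); first by rewrite RRe_real // realE N0.
split=> [|i]; first by rewrite -ler0c RRe_real // realE N0.
apply/ler_addgt0Pr => e e0.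
have : ball_ (fun x : 'rV[C]_m => `|x|) 0 (`|M| + e%:C) M.
  by rewrite /ball_ /= sub0r normrN ltrDl ltcR.
rewrite -mx_norm_ball => -[_ /(_ 0 i)]; rewrite mxE -ball_normE /= sub0r normrN normE.
rewrite -{1}[`|M|]RRe_real ?realE ?N0 // -rmorphD ltcR; exact: ltW.
Qed.

Lemma has_grad_differentiable n m (F : 'rV[C]_n -> 'rV[C]_m) a :
  (forall i, has_grad (fun x => F x 0 i) a) -> differentiable F a.
Proof.
move=> /choice[B HB]; pose D : 'M[C]_(n, m) := \matrix_(j, i) B i j 0.
have DE (x : 'rV[C]_n) i : (x *m D) 0 i = (x *m B i) 0 0.
  by rewrite !mxE; apply: eq_bigr => j _; rewrite mxE.
have Dc : continuous (mulmxr D : 'rV_n -> 'rV_m).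
  move=> x P /nbhs_rV[e e0 He]; have [d d0 Hd] := mulmx_small D e0.
  apply/nbhs_rV; exists d => // y yx; apply: He => i.
  have -> : mulmxr D y 0 i - mulmxr D x 0 i = ((y - x) *m D) 0 i.
    by rewrite mulmxBl [RHS]mxE [X in _ = _ + X]mxE.
  by apply: Hd => j; rewrite !mxE; exact/ltW/yx.
have key (e : R) : 0 < e -> \forall h \near (0 : 'rV[C]_n),
    `|F (h + a) - (F a + h *m D)| <= e%:C * `|h|.
  (* The sum norm is at most n times the maximum norm; n + 1 avoids division by 0. *)
  move=> e0; have e1 : 0 < e / n.+1%:R by rewrite divr_gt0.
  have : \forall x \near a, forall i, normc (F x 0 i - (F a 0 i + ((x - a) *m B i) 0 0)) <=
      e / n.+1%:R * l1 (x - a).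
    by apply: filter_forall_fin => i; exact: HB.
  move=> /near_l1[d d0 Hd]; apply/near_l1; exists d => // h; rewrite subr0 => hd.
  have := Hd (h + a); rewrite addrK => /(_ hd) {Hd} H.
  have [N -> [N0 HN]] := mx_norm_entry h.
  rewrite -rmorphM; apply: mx_norm_leP => [|i]; first by rewrite mulr_ge0 // ltW.
  have Hi := H i; rewrite -DE in Hi.
  have -> : (F (h + a) - (F a + h *m D)) 0 i = F (h + a) 0 i - (F a 0 i + (h *m D) 0 i).
    by rewrite mxE [X in _ + X]mxE [X in - X]mxE.
  apply: le_trans Hi _; rewrite -mulrA ler_pM2l // mulrC ler_pdivrMr //.
  apply: (@le_trans _ _ (\sum_(j < n) N)); first exact: ler_sum.
  by rewrite sumr_const card_ord -[_ *+ n]mulr_natr ler_wpM2l // ler_nat.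
have dE : 'd F a = mulmxr D :> ('rV_n -> 'rV_m).
  apply: diff_unique; first exact: Dc.
  apply/eqaddoP => _ /gt0_complex[e e0 ->]; exact: key.
apply/diff_locallyP; rewrite dE; split; first exact: Dc.
by apply/eqaddoP => _ /gt0_complex[e e0 ->]; exact: key.
Qed.

End Differentiable.

(** * Algebraic germs and the implicit function theorem *)
Section NashGerms.
Variable R : realType.
Local Notation C := R[i].

Definition cpoly (T : Type) k (c : 'I_k -> T -> C) (x : T) : {poly C} :=
  \sum_(i < k) c i x *: 'X^i.

Lemma horner_cpoly (T : Type) k (c : 'I_k -> T -> C) x t :
  (cpoly c x).[t] = \sum_(i < k) c i x * t ^+ i.
Proof.
by rewrite horner_sum; apply: eq_bigr => i _; rewrite hornerZ hornerXn.
Qed.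

Lemma horner_deriv_cpoly (T : Type) k (c : 'I_k -> T -> C) x t :
  (cpoly c x)^`().[t] = \sum_(i < k) c i x * (t ^+ i.-1 *+ i).
Proof.
rewrite raddf_sum horner_sum; apply: eq_bigr => i _.
by rewrite /= derivZ derivXn hornerZ hornerMn hornerXn.
Qed.

(** Functions built from polynomials by adjoining continuous simple roots. With this inductive form
    differentiability, Lipschitz bounds, stability under composition and algebraicity are all proved
    by induction, and the case of a root always uses the nonvanishing derivative. *)
Inductive nashg n (a : 'rV[C]_n) : ('rV[C]_n -> C) -> Prop :=
| nashg_cst c : nashg a (fun=> c)
| nashg_coord i : nashg a (fun x => x 0 i)
| nashg_add f g : nashg a f -> nashg a g -> nashg a (fun x => f x + g x)
| nashg_mul f g : nashg a f -> nashg a g -> nashg a (fun x => f x * g x)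
| nashg_root k (c : 'I_k -> 'rV[C]_n -> C) u : (forall i, nashg a (c i)) ->
    (\forall x \near a, {for x, continuous u}) ->
    (\forall x \near a, (cpoly c x).[u x] = 0) ->
    (cpoly c a)^`().[u a] != 0 -> nashg a u.

Section Local.
Variable n : nat.
Implicit Types (f g u : 'rV[C]_n -> C) (a x : 'rV[C]_n).

Definition contin_near f a := \forall x \near a, {for x, continuous f}.

Lemma contin_nearD f g a : contin_near f a -> contin_near g a -> contin_near (fun x => f x + g x) a.
Proof.
move=> hf hg; apply: filterS2 hf hg => x cf cg.
by apply: continuousD; [exact: cf|exact: cg].
Qed.

Lemma contin_nearM f g a : contin_near f a -> contin_near g a -> contin_near (fun x => f x * g x) a.
Proof.
move=> hf hg; apply: filterS2 hf hg => x cf cg.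
by apply: continuousM; [exact: cf|exact: cg].
Qed.

Lemma contin_near_cst (c : C) a : contin_near (fun=> c) a.
Proof. by apply: filterE => x; exact: cst_continuous. Qed.

Lemma nashg_contin f a : nashg a f -> contin_near f a.
Proof.
elim=> {f}[c|i|f g _ IHf _ IHg|f g _ IHf _ IHg|k c u _ _ cu _ _ //].
- exact: contin_near_cst.
- by apply: filterE => x; exact: coord_continuous.
- exact: contin_nearD.
- exact: contin_nearM.
Qed.

Lemma continX (T : topologicalType) (u : T -> C) (x : T) k :
  {for x, continuous u} -> {for x, continuous (fun y => u y ^+ k)}.
Proof.
move=> cu; elim: k => [|k IH].
  by rewrite (_ : (fun y => u y ^+ 0) = (fun=> 1)); [exact: cst_continuous|apply/funext => y].
rewrite (_ : (fun y => u y ^+ k.+1) = (fun y => u y * u y ^+ k)); last first.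
  by apply/funext => y; rewrite exprS.
by apply: continuousM; [exact: cu|exact: IH].
Qed.

Lemma contin_sum (T : topologicalType) (I : Type) (s : seq I) (F : I -> T -> C) (x : T) :
  (forall i, {for x, continuous (F i)}) -> {for x, continuous (fun y => \sum_(i <- s) F i y)}.
Proof.
move=> cF; elim: s => [|i s IH].
  rewrite (_ : (fun y => _) = (fun=> 0)); first exact: cst_continuous.
  by apply/funext => y; rewrite big_nil.
rewrite (_ : (fun y => _) = (fun y => F i y + \sum_(j <- s) F j y)); last first.
  by apply/funext => y; rewrite big_cons.
by apply: continuousD; [exact: cF|exact: IH].
Qed.

Lemma contin_neq0 f a : {for a, continuous f} -> f a != 0 -> \forall x \near a, f x != 0.
Proof.
move=> /continuous_C cf fa; have := cf (normc (f a)); rewrite normc_gt0 => /(_ fa).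
apply: filterS => x; apply: contraTneq => ->.
by rewrite sub0r normcN ltxx.
Qed.

Lemma contin_deriv_cpoly (T : topologicalType) k (c : 'I_k -> T -> C) (u : T -> C) (x : T) :
  (forall i, {for x, continuous (c i)}) -> {for x, continuous u} ->
  {for x, continuous (fun y => (cpoly c y)^`().[u y])}.
Proof.
move=> cc cu.
rewrite (_ : (fun y => _) = (fun y => \sum_(i < k) c i y * (i%:R * u y ^+ i.-1))); last first.
  by apply/funext => y; rewrite horner_deriv_cpoly; apply: eq_bigr => i _; rewrite mulr_natl.
apply: contin_sum => i; apply: continuousM; first exact: cc.
by apply: continuousM; [exact: cst_continuous|exact: continX].
Qed.

Lemma nashg_open f a : nashg a f -> \forall b \near a, nashg b f.
Proof.
elim=> {f}[c|i|f g _ IHf _ IHg|f g _ IHf _ IHg|k c u nc IH cu cu0 d0].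
- by apply: filterE => b; exact: nashg_cst.
- by apply: filterE => b; exact: nashg_coord.
- by apply: filterS2 IHf IHg => b; exact: nashg_add.
- by apply: filterS2 IHf IHg => b; exact: nashg_mul.
have h1 : \forall b \near a, forall i, nashg b (c i) by exact: filter_forall_fin.
have h2 : \forall b \near a, (cpoly c b)^`().[u b] != 0.
  apply: contin_neq0 d0; apply: contin_deriv_cpoly; last exact: nbhs_singleton cu.
  by move=> i; have /nashg_contin/nbhs_singleton := nc i.
have h3 := nbhs_interior cu; have h4 := nbhs_interior cu0.
near=> b; apply: (@nashg_root _ b k c u).
- by near: b.
- by near: b; exact: h3.
- by near: b; exact: h4.
- by near: b.
Unshelve. all: by end_near. Qed.

(** The divided difference of the polynomial at s and t, written without division so that it is
    continuous across s = t. *)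
Definition ddiff (T : Type) k (c : 'I_k -> T -> C) y (s t : C) : C :=
  \sum_(i < k) c i y * \sum_(j < i) s ^+ (i.-1 - j) * t ^+ j.

Lemma ddiffE (T : Type) k (c : 'I_k -> T -> C) y s t :
  (cpoly c y).[s] - (cpoly c y).[t] = (s - t) * ddiff c y s t.
Proof.
rewrite !horner_cpoly -sumrB /ddiff mulr_sumr; apply: eq_bigr => i _.
by rewrite -mulrBr subrXX mulrCA.
Qed.

Lemma ddiff_diag (T : Type) k (c : 'I_k -> T -> C) y s :
  ddiff c y s s = (cpoly c y)^`().[s].
Proof.
rewrite horner_deriv_cpoly; apply: eq_bigr => i _; congr (_ * _).
rewrite (eq_bigr (fun=> s ^+ i.-1)); first by rewrite sumr_const card_ord.
by move=> j _; rewrite -exprD subnK // -ltnS prednK // (leq_trans _ (ltn_ord j)).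
Qed.

Lemma ddiff_near (T : topologicalType) k (c : 'I_k -> T -> C) (u v : T -> C) (x : T) :
  (forall i, {for x, continuous (c i)}) -> {for x, continuous u} -> {for x, continuous v} ->
  {for x, continuous (fun y => ddiff c y (u y) (v y))}.
Proof.
move=> cc cu cv; apply: contin_sum => i; apply: continuousM; first exact: cc.
apply: (@contin_sum T _ _ (fun (j : 'I_i) y => u y ^+ (i.-1 - j) * v y ^+ j)) => j.
by apply: continuousM; exact: continX.
Qed.

(** Writes the increment of a root as a combination of the increments of the coefficients; the
    gradient and the Lipschitz bound of [u] are inherited from the [c i] through this formula. *)
Lemma root_difference k (c : 'I_k -> 'rV[C]_n -> C) u x y :
  (cpoly c x).[u x] = 0 -> (cpoly c y).[u y] = 0 -> ddiff c y (u y) (u x) != 0 ->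
  u y - u x = \sum_(i < k) (c i y - c i x) * (- u x ^+ i / ddiff c y (u y) (u x)).
Proof.
move=> ux uy d0; apply: (mulIf d0); rewrite -ddiffE uy sub0r mulr_suml.
have -> : - (cpoly c y).[u x] = (cpoly c x).[u x] - (cpoly c y).[u x] by rewrite ux sub0r.
rewrite !horner_cpoly -sumrB.
by apply: eq_bigr => i _; field.
Qed.

Lemma nashg_grad f a : nashg a f -> has_grad f a.
Proof.
elim=> {f}[c|i|f g nf IHf ng IHg|f g nf IHf ng IHg|k c u nc IH cu cu0 d0].
- exact: has_grad_cst.
- exact: has_grad_coord.
- exact: has_gradD.
- by apply: has_gradM => //; exact: nbhs_singleton (nashg_contin ng).
have cca i : {for a, continuous (c i)} by exact: nbhs_singleton (nashg_contin (nc i)).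
have cua := nbhs_singleton cu.
have dc : {for a, continuous (fun y => ddiff c y (u y) (u a))}.
  by apply: ddiff_near; [exact: cca|exact: cua|exact: cst_continuous].
have d0' : ddiff c a (u a) (u a) != 0 by rewrite ddiff_diag.
have dn := contin_neq0 dc d0'; have cu0a := nbhs_singleton cu0.
apply: (@has_grad_near _ _ (fun y => u a + \sum_(i < k) (c i y - c i a) *
    (- u a ^+ i / ddiff c y (u y) (u a)))).
  apply: filterS2 cu0 dn => y uy dy; rewrite -root_difference //.
  by rewrite addrC subrK.
apply: has_gradD; first exact: has_grad_cst.
apply: (@big_closed R _ _ _ (fun h => has_grad h a)
  (fun i y => (c i y - c i a) * (- u a ^+ i / ddiff c y (u y) (u a)))).
- exact: has_grad_cst.
- by move=> ? ?; exact: has_gradD.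
move=> i; apply: has_grad_mul0.
- by apply: has_gradD; [exact: IH|exact: has_grad_cst].
- exact: subrr.
apply: continuousM; first exact: cst_continuous.
exact: continuousV.
Qed.

Lemma lipschitzW f a d' : 0 < d' -> lipschitz_near f a -> exists (K d : R), [/\ 0 < K, 0 < d <= d' &
  forall x y, l1 (x - a) < d -> l1 (y - a) < d -> normc (f x - f y) <= K * l1 (x - y)].
Proof.
move=> d'0 [K [d [K0 d0 H]]]; exists K, (Num.min d d'); split=> //.
  by rewrite lt_min d0 d'0 ge_min lexx orbT.
by move=> x y; rewrite !lt_min => /andP[xd _] /andP[yd _]; exact: H.
Qed.

Lemma lipschitz_cst (c : C) a : lipschitz_near (fun=> c) a.
Proof. by exists 1, 1; split=> // x y _ _; rewrite subrr normc0 mul1r l1_ge0. Qed.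

Lemma lipschitzD f g a : lipschitz_near f a -> lipschitz_near g a ->
  lipschitz_near (fun x => f x + g x) a.
Proof.
move=> [K1 [d1 [K10 d10 H1]]] /(lipschitzW d10)[K2 [d2 [K20 /andP[d20 d21] H2]]].
exists (K1 + K2), d2; split=> //; first exact: addr_gt0.
move=> x y xd yd; rewrite opprD addrACA mulrDl.
apply: le_trans (le_normcD _ _) _; apply: lerD; last exact: H2.
by apply: H1; apply: lt_le_trans d21.
Qed.

Lemma lipschitzM f g a : lipschitz_near f a -> lipschitz_near g a ->
  lipschitz_near (fun x => f x * g x) a.
Proof.
move=> lf lg; have [M1 [e1 [M10 e10 HM1]]] := lipschitz_bounded lf.
have [M2 [e2 [M20 e20 HM2]]] := lipschitz_bounded lg.
have [K1 [d1 [K10 /andP[d10 d1e] H1]]] := lipschitzW e10 lf.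
have m0 : 0 < Num.min d1 e2 by rewrite lt_min d10.
have [K2 [d2 [K20 /andP[d20]]]] := lipschitzW m0 lg.
rewrite le_min => /andP[d21 d22] H2.
exists (K1 * M2 + M1 * K2), d2; split=> //; first by rewrite addr_gt0 // mulr_gt0.
move=> x y xd yd.
have -> : f x * g x - f y * g y = (f x - f y) * g x + f y * (g x - g y) by ring.
apply: le_trans (le_normcD _ _) _; rewrite !normcM mulrDl.
have xd1 := lt_le_trans xd d21; have yd1 := lt_le_trans yd d21.
apply: lerD.
  rewrite mulrAC; apply: ler_pM; rewrite ?normc_ge0 //; first exact: H1.
  by apply: HM2; exact: lt_le_trans xd d22.
rewrite -mulrA; apply: ler_pM; rewrite ?normc_ge0 //; last exact: H2.
by apply: HM1; exact: lt_le_trans yd1 d1e.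
Qed.

(** For a root both points vary, so continuity of the divided difference is used at (a, a) in the
    product space, which bounds it below by half the derivative. *)
Lemma nashg_lipschitz f a : nashg a f -> lipschitz_near f a.
Proof.
elim=> {f}[c|i|f g nf IHf ng IHg|f g nf IHf ng IHg|k c u nc IH cu cu0 d0].
- exact: lipschitz_cst.
- exists 1, 1; split=> // x y _ _; rewrite mul1r /l1 (bigD1 i) //= !mxE lerDl.
  by apply: sumr_ge0 => j _; exact: normc_ge0.
- exact: lipschitzD.
- exact: lipschitzM.
have cca i : {for a, continuous (c i)} by exact: nbhs_singleton (nashg_contin (nc i)).
have cua := nbhs_singleton cu.
pose m := normc ((cpoly c a)^`().[u a]) / 2.
have m0 : 0 < m by rewrite divr_gt0 // normc_gt0.
pose V := 'rV[C]_n.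
have cfst (h : V -> C) : {for a, continuous h} ->
    {for (a, a), continuous (fun z : V * V => h z.1)}.
  by move=> ch; apply: (@continuous_comp _ _ _ fst h); [exact: cvg_fst|exact: ch].
have csnd (h : V -> C) : {for a, continuous h} ->
    {for (a, a), continuous (fun z : V * V => h z.2)}.
  by move=> ch; apply: (@continuous_comp _ _ _ snd h); [exact: cvg_snd|exact: ch].
have pair (P : V -> Prop) : (\forall x \near a, P x) -> \forall z \near (a, a), P z.1 /\ P z.2.
  by move=> aP; exists (P, P).
pose D (z : V * V) := ddiff (fun i (z : V * V) => c i z.1) z (u z.1) (u z.2).
have cD : {for (a, a), continuous D}.
  apply: (@ddiff_near _ k (fun i (z : V * V) => c i z.1) (fun z => u z.1) (fun z => u z.2)).
  - by move=> i; apply: cfst; exact: cca.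
  - by apply: cfst; exact: cua.
  - by apply: csnd; exact: cua.
have Dm : \forall z \near (a, a), m <= normc (D z).
  have : nbhs (D (a, a)) [set y | m <= normc y].
    apply/nbhs_C; exists m => // y; rewrite normc_distC => ym /=.
    have Da : normc (D (a, a)) = 2 * m.
      by rewrite /D -[ddiff _ _ _ _]/(ddiff c a (u a) (u a)) ddiff_diag /m mulrC divfK.
    by have := normc_sub_ge (D (a, a)) (D (a, a) - y); rewrite subKr Da; lra.
  by move=> /cD.
pose M := normc (u a) + 1.
have uM : \forall z \near (a, a), normc (u z.1) <= M /\ normc (u z.2) <= M.
  apply: (pair (fun x => normc (u x) <= M)).
  have /continuous_C/(_ 1 ltr01) := cua; apply: filterS => x ux.
  rewrite -(subrK (u a) (u x)) addrC; apply: le_trans (le_normcD _ _) _.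
  by rewrite lerD2l ltW.
have u0 := pair _ cu0.
have /choice[K HK] i : exists K : R, 0 < K /\
    \forall z \near (a, a), normc (c i z.1 - c i z.2) <= K * l1 (z.1 - z.2).
  have [K [d [K0 dp H]]] := IH i; exists K; split=> //.
  have /pair : \forall x \near a, l1 (x - a) < d by apply/near_l1; exists d.
  by apply: filterS => z [z1 z2]; exact: H.
have cK : \forall z \near (a, a), forall i, normc (c i z.1 - c i z.2) <= K i * l1 (z.1 - z.2).
  by apply: filter_forall_fin => i; exact: (HK i).2.
have M0 : 0 <= M by rewrite addr_ge0 ?normc_ge0.
have S0 : 0 <= \sum_i K i * (M ^+ i / m).
  apply: sumr_ge0 => i _; rewrite mulr_ge0 ?(ltW (HK i).1) //.
  by rewrite divr_ge0 ?exprn_ge0 // ltW.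
have : \forall z \near (a, a), normc (u z.1 - u z.2) <=
    (1 + \sum_i K i * (M ^+ i / m)) * l1 (z.1 - z.2).
  near=> z.
  have [u1 u2] : (cpoly c z.1).[u z.1] = 0 /\ (cpoly c z.2).[u z.2] = 0 by near: z.
  have [_ M2] : normc (u z.1) <= M /\ normc (u z.2) <= M by near: z.
  have Dz : m <= normc (D z) by near: z.
  have cz : forall i, normc (c i z.1 - c i z.2) <= K i * l1 (z.1 - z.2) by near: z.
  have D0 : ddiff c z.1 (u z.1) (u z.2) != 0 by rewrite -normc_gt0; exact: lt_le_trans Dz.
  rewrite (root_difference u2 u1 D0).
  apply: (@le_trans _ _ ((\sum_i K i * (M ^+ i / m)) * l1 (z.1 - z.2))); last first.
    by rewrite ler_wpM2r ?l1_ge0 // lerDr.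
  apply: le_trans (normc_sum _ _ _) _; rewrite mulr_suml; apply: ler_sum => i _.
  rewrite normcM (mulrAC (K i)); apply: ler_pM; rewrite ?normc_ge0 //.
  rewrite normcM normcN normcX normcV; apply: ler_pM; rewrite ?exprn_ge0 ?invr_ge0 ?normc_ge0 //.
    by rewrite lerXn2r // nnegrE ?normc_ge0.
  by rewrite lef_pV2 // posrE // (lt_le_trans m0).
move=> [[A B] [/= /near_l1[d1 d10 H1] /near_l1[d2 d20 H2]] AB].
exists (1 + \sum_i K i * (M ^+ i / m)), (Num.min d1 d2); split.
- by rewrite ltr_wpDr.
- by rewrite lt_min d10.
move=> x y; rewrite !lt_min => /andP[x1 _] /andP[_ y2].
by apply: (AB (x, y)); split; [exact: H1|exact: H2].
Unshelve. all: by end_near. Qed.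

End Local.

Lemma nashg_comp n N (g : 'rV[C]_N -> C) (Phi : 'rV[C]_n -> 'rV[C]_N) (a : 'rV[C]_n) :
  (forall i, nashg a (fun x => Phi x 0 i)) -> nashg (Phi a) g ->
  nashg a (fun x => g (Phi x)).
Proof.
move=> nP; have cP : \forall x \near a, {for x, continuous Phi}.
  have : \forall x \near a, forall i, {for x, continuous (fun y => Phi y 0 i)}.
    by apply: filter_forall_fin => i; exact: nashg_contin.
  apply: filterS => x cx P /nbhs_rV[d d0 Hd].
  have : \forall y \near x, forall i, normc (Phi y 0 i - Phi x 0 i) < d.
    by apply: filter_forall_fin => i; have /continuous_C := cx i; apply.
  by apply: filterS => y; exact: Hd.
have near_comp (P : 'rV[C]_N -> Prop) : (\forall y \near Phi a, P y) -> \forall x \near a, P (Phi x).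
  exact: (nbhs_singleton cP).
elim=> {g}[c|i|f g _ IHf _ IHg|f g _ IHf _ IHg|k c u _ IH cu cu0 d0].
- exact: nashg_cst.
- exact: nP.
- exact: nashg_add.
- exact: nashg_mul.
apply: (@nashg_root _ a k (fun i x => c i (Phi x)) (fun x => u (Phi x))) => //.
- apply: filterS2 cP (near_comp _ cu) => x cPx cux.
  by apply: continuous_comp; [exact: cPx|exact: cux].
- exact: near_comp cu0.
Qed.

End NashGerms.

(** * The implicit function theorem in one unknown *)

Section ImplicitFunction.
Variable R : realType.
Local Notation C := R[i].

(** The logarithmic derivative is the sum of the 1/(z - al), each of modulus at most 1/d. *)
Lemma deriv_prod_bound (s : seq C) (z : C) (d : R) : 0 <= d ->
  (forall al, al \in s -> d <= normc (z - al)) ->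
  normc (\prod_(al <- s) ('X - al%:P))^`().[z] * d <=
    (size s)%:R * normc (\prod_(al <- s) ('X - al%:P)).[z].
Proof.
move=> d0; elim: s => [|b s IH] ds.
  by rewrite big_nil derivC horner0 normc0 !mul0r.
rewrite big_cons derivM derivXsubC mul1r hornerD !hornerM hornerXsubC.
set q := \prod_(j <- s) _.
have h1 : d <= normc (z - b) by apply: ds; rewrite mem_head.
have h2 : normc q^`().[z] * d <= (size s)%:R * normc q.[z].
  by apply: IH => al als; apply: ds; rewrite in_cons als orbT.
apply: (@le_trans _ _ (normc q.[z] * d + normc (z - b) * (normc q^`().[z] * d))).
  rewrite mulrA -mulrDl ler_wpM2r //; apply: le_trans (le_normcD _ _) _.
  by rewrite normcM.
rewrite /= -natr1 mulrDl mul1r normcM addrC; apply: lerD.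
  by rewrite [X in _ <= X]mulrCA ler_wpM2l ?normc_ge0.
by rewrite mulrC ler_wpM2r ?normc_ge0.
Qed.

(** Otherwise all roots would be farther than (size p) |p(z)| / |p'(z)|, against [deriv_prod_bound]:
    the degree is strictly less than [size p]. *)
Lemma root_close (p : {poly C}) z : p^`().[z] != 0 -> exists2 al, root p al &
  normc (z - al) * normc p^`().[z] <= (size p)%:R * normc p.[z].
Proof.
move=> pz0; have [pz|pz] := eqVneq p.[z] 0.
  by exists z; [exact/eqP|rewrite subrr normc0 mul0r pz normc0 mulr0].
apply: contrapT => H.
have p0 : p != 0 by apply: contra_neq pz0 => ->; rewrite derivC horner0.
have [s ps] := closed_field_poly_normal p.
have l0 : lead_coef p != 0 by rewrite lead_coef_eq0.
have dp : 0 < normc p^`().[z] by rewrite normc_gt0.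
pose d := (size p)%:R * normc p.[z] / normc p^`().[z].
have d0 : 0 <= d by rewrite divr_ge0 ?mulr_ge0 ?normc_ge0.
have ds al : al \in s -> d <= normc (z - al).
  move=> als; rewrite leNgt; apply/negP => h; apply: H; exists al.
    by rewrite ps rootZ // root_prod_XsubC.
  by rewrite -ler_pdivlMr // ltW.
have := deriv_prod_bound d0 ds; set q := \prod_(al <- s) _ in ps *.
have sz : size p = (size s).+1 by rewrite ps size_scale // size_prod_XsubC.
rewrite -(ler_pM2l (_ : 0 < normc (lead_coef p))) ?normc_gt0 //.
have e1 : normc (lead_coef p) * normc q^`().[z] = normc p^`().[z].
  by rewrite -normcM -hornerZ -derivZ -ps.
have e2 : normc (lead_coef p) * normc q.[z] = normc p.[z].
  by rewrite -normcM -hornerZ -ps.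
rewrite [X in X <= _]mulrA e1 [X in _ <= X]mulrCA e2 /d mulrC divfK ?gt_eqF // ler_pM2r ?normc_gt0 // ler_nat sz.
by rewrite ltnn.
Qed.

Lemma size_cpoly (T : Type) k (c : 'I_k -> T -> C) x : (size (cpoly c x) <= k)%N.
Proof. exact: (size_sum_Xn (fun i => c i x)). Qed.

Lemma contin_cpoly (T : topologicalType) k (c : 'I_k -> T -> C) (s : C) (x : T) :
  (forall i, {for x, continuous (c i)}) ->
  {for x, continuous (fun y => (cpoly c y).[s])}.
Proof.
move=> cc; rewrite (_ : (fun y => _) = (fun y => \sum_(i < k) c i y * s ^+ i)); last first.
  by apply/funext => y; rewrite horner_cpoly.
by apply: contin_sum => i; apply: continuousM; [exact: cc|exact: cst_continuous].
Qed.

Lemma nashg_implicit n (a : 'rV[C]_n) k (c : 'I_k -> 'rV[C]_n -> C) (u0 : C) :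
  (forall i, nashg a (c i)) -> (cpoly c a).[u0] = 0 -> (cpoly c a)^`().[u0] != 0 ->
  exists u, [/\ nashg a u, u a = u0 & exists2 eta : R, 0 < eta &
    \forall x \near a, (cpoly c x).[u x] = 0 /\
      forall s, normc (s - u0) < eta -> (cpoly c x).[s] = 0 -> s = u x].
Proof.
move=> nc pu0 du0.
have cca i : {for a, continuous (c i)} by exact: nbhs_singleton (nashg_contin (nc i)).
pose m := normc ((cpoly c a)^`().[u0]) / 2.
have m0 : 0 < m by rewrite divr_gt0 // normc_gt0.
pose D (z : 'rV[C]_n * (C * C)) := ddiff (fun i (z : 'rV[C]_n * (C * C)) => c i z.1) z z.2.1 z.2.2.
have cD : {for (a, (u0, u0)), continuous D}.
  apply: (@ddiff_near R _ k (fun i (z : 'rV[C]_n * (C * C)) => c i z.1)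
    (fun z => z.2.1) (fun z => z.2.2)).
  - by move=> i; apply: (@continuous_comp _ _ _ fst (c i)); [exact: cvg_fst|exact: cca].
  - by apply: (@continuous_comp _ _ _ snd fst); [exact: cvg_snd|exact: cvg_fst].
  - by apply: (@continuous_comp _ _ _ snd snd); [exact: cvg_snd|exact: cvg_snd].
have : nbhs (D (a, (u0, u0))) [set y | m <= normc y].
  apply/nbhs_C; exists m => // y; rewrite normc_distC => ym /=.
  have Da : normc (D (a, (u0, u0))) = 2 * m.
    by rewrite /D -[ddiff _ _ _ _]/(ddiff c a u0 u0) ddiff_diag /m mulrC divfK.
  by have := normc_sub_ge (D (a, (u0, u0))) (D (a, (u0, u0)) - y); rewrite subKr Da; lra.
move=> /cD[[A B] [/= aA [[B1 B2] [/= /nbhs_C[e1 e10 H1] /nbhs_C[e2 e20 H2]] B12]] AB].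
pose eta := Num.min e1 e2.
have eta0 : 0 < eta by rewrite lt_min e10.
have Dm x s t : A x -> normc (s - u0) < eta -> normc (t - u0) < eta -> m <= normc (ddiff c x s t).
  rewrite !lt_min => Ax /andP[s1 _] /andP[_ t2].
  apply: (AB (x, (s, t))); split=> //=; apply: (B12 (s, t)); split; [exact: H1|exact: H2].
have pm x s : A x -> normc (s - u0) < eta -> m <= normc ((cpoly c x)^`().[s]).
  by move=> Ax su; rewrite -ddiff_diag; exact: Dm.
have uniq x s t : A x -> normc (s - u0) < eta -> normc (t - u0) < eta ->
    (cpoly c x).[s] = 0 -> (cpoly c x).[t] = 0 -> s = t.
  move=> Ax su tu ps pt; have := ddiffE c x s t; rewrite ps pt subrr => /esym/eqP.
  rewrite mulf_eq0 subr_eq0 => /orP[/eqP //|/eqP d0].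
  by have := Dm x s t Ax su tu; rewrite d0 normc0 leNgt m0.
have close x s (e : R) : A x -> normc (s - u0) < eta -> k%:R * normc (cpoly c x).[s] < m * e ->
    exists2 t, (cpoly c x).[t] = 0 & normc (s - t) < e.
  move=> Ax su ps; have ms := pm x s Ax su.
  have [|t rt ht] := @root_close (cpoly c x) s.
    by rewrite -normc_gt0; exact: lt_le_trans ms.
  exists t; first exact/eqP.
  rewrite -(ltr_pM2l m0); apply: le_lt_trans ps; rewrite mulrC.
  apply: le_trans (_ : normc (s - t) * normc (cpoly c x)^`().[s] <= _).
    by rewrite ler_wpM2l ?normc_ge0.
  apply: le_trans ht _; rewrite ler_wpM2r ?normc_ge0 // ler_nat; exact: size_cpoly.
have small x s (e : R) : (forall i, {for x, continuous (c i)}) -> (cpoly c x).[s] = 0 -> 0 < e ->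
    \forall y \near x, k%:R * normc (cpoly c y).[s] < m * e.
  move=> cc ps e0; have /continuous_C := @contin_cpoly _ _ c s x cc.
  have h0 : 0 < m * e / k.+1%:R by apply: divr_gt0; [exact: mulr_gt0|rewrite ltr0n].
  move=> /(_ _ h0); rewrite ps.
  apply: filterS => y; rewrite subr0 ltr_pdivlMr // mulrC; apply: le_lt_trans.
  by rewrite ler_wpM2r ?normc_ge0 // ler_nat.
pose u x := xget u0 [set s | normc (s - u0) < eta /\ (cpoly c x).[s] = 0].
have exu : \forall x \near a, normc (u x - u0) < eta /\ (cpoly c x).[u x] = 0.
  have := small a u0 eta cca pu0 eta0; apply: filterS2 aA => x Ax sx.
  have [|t pt tu] := close x u0 eta Ax _ sx; first by rewrite subrr normc0.
  rewrite /u; case: xgetP => [s -> //|/(_ t)]; case; split=> //.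
  by rewrite normc_distC.
have ua : u a = u0.
  have [h1 h2] := nbhs_singleton exu.
  by apply: (uniq a) => //; [exact: nbhs_singleton aA|rewrite subrr normc0].
have cn : \forall x \near a, forall i, {for x, continuous (c i)}.
  by apply: filter_forall_fin => i; exact: nashg_contin.
have exu' := nbhs_interior exu; have A' := nbhs_interior aA.
have cu : \forall x \near a, {for x, continuous u}.
  near=> x.
  have ex : nbhs x [set y | normc (u y - u0) < eta /\ (cpoly c y).[u y] = 0].
    by near: x; exact: exu'.
  have Ax : nbhs x A by near: x; exact: A'.
  have cx : forall i, {for x, continuous (c i)} by near: x.
  apply/continuous_C => e e0.
  have [ux px] := nbhs_singleton ex.
  (* The second bound keeps the root found near [u x] in the region of uniqueness, so that it is
     [u y]. *)
  pose e' := Num.min e (eta - normc (u x - u0)).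
  have e'0 : 0 < e' by rewrite lt_min e0 subr_gt0.
  have := small x (u x) e' cx px e'0; apply: filterS2 (filterI ex Ax) => y [[uy py] Ay] sy.
  have [t pt] := close y (u x) e' Ay ux sy; rewrite lt_min => /andP[te teta].
  have tu : normc (t - u0) < eta.
    rewrite -(subrK (u x) t) -addrA; apply: le_lt_trans (le_normcD _ _) _.
    by rewrite normc_distC -ltrBrDr.
  by rewrite (uniq y (u y) t) // normc_distC.
exists u; split=> //.
  apply: nashg_root nc cu _ _; last by rewrite ua.
  by apply: filterS exu => x [].
exists eta => //; apply: filterS2 aA exu => x Ax [ux px]; split=> // s su ps.
exact: (uniq x).
Unshelve. all: by end_near. Qed.

End ImplicitFunction.

(** * Algebraic germs satisfy a polynomial equation *)
Section SplitInjective.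
Variables (K : comNzRingType) (n : nat).
Local Notation widen := (widen_ord (leqnSn n)).

Fact split_poly_additive : additive (@split_poly K n).
Proof. exact: mmap_is_additive. Qed.

Fact split_poly_multiplicative : multiplicative (@split_poly K n).
Proof. exact: mmap_is_multiplicative. Qed.

HB.instance Definition _ := GRing.isAdditive.Build _ _ (@split_poly K n) split_poly_additive.
HB.instance Definition _ := GRing.isMultiplicative.Build _ _ (@split_poly K n)
  split_poly_multiplicative.

Lemma split_poly_widen (p : mpoly n K) : split_poly (mwiden p) = p%:P.
Proof.
rewrite /mwiden /mmap rmorph_sum [in RHS](mpolyE p) rmorph_sum; apply: eq_bigr => m _ /=.
rewrite rmorphM /= -mul_mpolyC polyCM; congr (_ * _).
  by rewrite /split_poly mmapC.
rewrite /mmap1 rmorph_prod [in RHS]mpolyXE_id rmorph_prod; apply: eq_bigr => i _ /=.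
by rewrite !rmorphXn /= /split_poly mmapX mmap1U join_widen.
Qed.

Lemma unsplit_polyK : cancel (@unsplit_poly K n) (@split_poly K n).
Proof.
move=> P; rewrite /unsplit_poly -horner_map /= -map_poly_comp.
rewrite [X in _.[X]](_ : _ = 'X); last first.
  by rewrite /split_poly mmapX mmap1U join_max.
rewrite (eq_map_poly (g := polyC)); last by move=> p /=; exact: split_poly_widen.
exact: comp_polyXr.
Qed.

End SplitInjective.

Section Algebraicity.
Variable R : realType.
Local Notation C := R[i].
Variable n : nat.
Local Notation Fn := ('rV[C]_n -> C).
Implicit Types (a : 'rV[C]_n) (f g u : Fn).

Definition polyfun (p : mpoly n C) : Fn := fun x => meval (x 0) p.

Fact polyfun_additive : additive polyfun.
Proof. by move=> p q; apply/funext => x; rewrite /polyfun mevalB. Qed.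

Fact polyfun_multiplicative : multiplicative polyfun.
Proof.
by split=> [p q|]; apply/funext => x; rewrite /polyfun ?mevalM ?meval1.
Qed.

HB.instance Definition _ := GRing.isAdditive.Build _ _ polyfun polyfun_additive.
HB.instance Definition _ := GRing.isMultiplicative.Build _ _ polyfun polyfun_multiplicative.

(* [g] is a representative of the germ of [f] that makes the integral equation
   hold everywhere: the closure properties of integral elements need a ring. *)
Definition alg a f := exists2 b : mpoly n C, b != 0 &
  exists2 g : Fn, (\forall x \near a, g x = f x) &
    integralOver polyfun (polyfun b * g).

Lemma alg_eq a f g : (\forall x \near a, f x = g x) -> alg a f -> alg a g.
Proof.
move=> fg [b b0 [h hf ih]]; exists b => //; exists h => //.
by apply: filterS2 fg hf => x -> ->.
Qed.

Lemma alg_poly a p : alg a (polyfun p).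
Proof.
exists 1; first exact: oner_neq0.
by exists (polyfun p); [exact: filterE|rewrite rmorph1 mul1r; exact: integral_id].
Qed.

Lemma alg_cst a c : alg a (fun=> c).
Proof.
by apply: alg_eq (alg_poly a (mpolyC n c)); apply: filterE => x; rewrite /polyfun mevalC.
Qed.

Lemma alg_common a k (c : 'I_k -> Fn) : (forall i, alg a (c i)) ->
  exists2 b : mpoly n C, b != 0 & exists2 g : 'I_k -> Fn,
    (\forall x \near a, forall i, g i x = c i x) &
    forall i, integralOver polyfun (polyfun b * g i).
Proof.
move=> ac; have /choice[b Hb] : forall i, exists b : mpoly n C, b != 0 /\
    exists2 g : Fn, (\forall x \near a, g x = c i x) & integralOver polyfun (polyfun b * g).
  by move=> i; have [b b0 H] := ac i; exists b.
have /choice[g Hg] : forall i, exists g : Fn, (\forall x \near a, g x = c i x) /\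
    integralOver polyfun (polyfun (b i) * g).
  by move=> i; have [_ [g g1 g2]] := Hb i; exists g.
exists (\prod_i b i); first by apply/prodf_neq0 => i _; have [] := Hb i.
exists g; first by apply: filter_forall_fin => i; have [] := Hg i.
move=> i; rewrite (bigD1 i) //= rmorphM [_ * polyfun _]mulrC -mulrA.
by apply: integral_mul; [exact: integral_id|have [] := Hg i].
Qed.

Lemma alg_add a f g : alg a f -> alg a g -> alg a (fun x => f x + g x).
Proof.
move=> [b b0 [f' ff' If]] [d d0 [g' gg' Ig]]; exists (b * d); first by rewrite mulf_neq0.
exists (f' + g'); first by apply: filterS2 ff' gg' => x; rewrite /GRing.add /= => -> ->.
rewrite rmorphM mulrDr; apply: integral_add.
  by rewrite [_ * polyfun d]mulrC -mulrA; apply: integral_mul => //; exact: integral_id.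
by rewrite -mulrA; apply: integral_mul => //; exact: integral_id.
Qed.

Lemma alg_mul a f g : alg a f -> alg a g -> alg a (fun x => f x * g x).
Proof.
move=> [b b0 [f' ff' If]] [d d0 [g' gg' Ig]]; exists (b * d); first by rewrite mulf_neq0.
exists (f' * g'); first by apply: filterS2 ff' gg' => x; rewrite /GRing.mul /= => -> ->.
by rewrite rmorphM mulrACA; exact: integral_mul.
Qed.

Lemma alg_exp a f k : alg a f -> alg a (fun x => f x ^+ k).
Proof.
move=> af; elim: k => [|k IH].
  by apply: alg_eq (alg_cst a 1); apply: filterE => x; rewrite expr0.
by apply: alg_eq (alg_mul af IH); apply: filterE => x; rewrite exprS.
Qed.

Lemma alg_sum a k (c : 'I_k -> Fn) : (forall i, alg a (c i)) -> alg a (fun x => \sum_i c i x).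
Proof.
move=> ac; suff H (s : seq 'I_k) : alg a (fun x => \sum_(i <- s) c i x) by exact: H.
elim: s => [|i s IH].
  by apply: alg_eq (alg_cst a 0); apply: filterE => x; rewrite big_nil.
by apply: alg_eq (alg_add (ac i) IH); apply: filterE => x; rewrite big_cons.
Qed.

Lemma fctE_sum k (F : 'I_k -> Fn) x : (\sum_i F i) x = \sum_i F i x.
Proof. by elim/big_ind2: _ => // f1 v1 f2 v2 <- <-. Qed.

Lemma fctE_exp f k x : (f ^+ k) x = f x ^+ k.
Proof. by elim: k => // k IH; rewrite !exprS -IH. Qed.

(* Off a neighbourhood of [a] the representative of [u] is [0], which is a root
   thanks to the additional factor ['X]. *)
Lemma alg_monic a k (c : 'I_k -> Fn) u : (forall i, alg a (c i)) ->
  (\forall x \near a, u x * (u x ^+ k + \sum_(i < k) c i x * u x ^+ i) = 0) -> alg a u.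
Proof.
move=> /alg_common[b b0 [g gc Ig]] cu.
pose A x : bool := u x * (u x ^+ k + \sum_(i < k) g i x * u x ^+ i) == 0.
pose v : Fn := fun x => if A x then u x else 0.
exists b => //; exists v.
  apply: filterS2 gc cu => x gx cx; rewrite /v ifT // /A -[X in _ == X]cx; apply/eqP.
  by congr (_ * (_ + _)); apply: eq_bigr => i _; rewrite gx.
pose co (i : 'I_k) : Fn := polyfun b ^+ (k - i) * g i.
pose p : {poly Fn} := 'X^k + \sum_(i < k) co i *: 'X^i.
have sp : (size (\sum_(i < k) co i *: 'X^i)%R <= k)%N.
  apply: leq_trans (size_sum _ _ _) _; apply/bigmax_leqP => i _.
  by apply: leq_trans (size_scale_leq _ _) _; rewrite size_polyXn.
have mp : p \is monic.
  by rewrite monicE /p lead_coefDl ?lead_coefXn // size_polyXn ltnS.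
apply: (@integral_root_monic _ _ _ _ (p * 'X)).
- by rewrite monicMr ?monicX.
- apply/rootP; apply/funext => x; rewrite hornerM hornerX.
  pose w := polyfun b x * v x.
  have pw : p.[polyfun b * v] x = w ^+ k + \sum_(i < k) polyfun b x ^+ (k - i) * g i x * w ^+ i.
    rewrite /p hornerD hornerXn horner_sum.
    rewrite [LHS](_ : _ = ((polyfun b * v) ^+ k) x + (\sum_(i < k) (co i *: 'X^i).[polyfun b * v]) x) //.
    rewrite fctE_exp fctE_sum; congr (_ + _); apply: eq_bigr => i _; rewrite hornerZ hornerXn.
    rewrite [LHS](_ : _ = (polyfun b ^+ (k - i)) x * g i x * ((polyfun b * v) ^+ i) x) //.
    by rewrite !fctE_exp.
  rewrite [LHS](_ : _ = p.[polyfun b * v] x * w) // pw /w /v.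
  case: ifP => [/eqP Ax|_]; last by rewrite !mulr0.
  rewrite -[RHS](mulr0 (polyfun b x ^+ k.+1)) -[in RHS]Ax exprS mulrC -!mulrA; congr (_ * _).
  rewrite [RHS]mulrCA; congr (_ * _); rewrite mulrDr exprMn mulr_sumr; congr (_ + _).
  apply: eq_bigr => i _; rewrite exprMn.
  have -> : polyfun b x ^+ k = polyfun b x ^+ (k - i) * polyfun b x ^+ i.
    by rewrite -exprD subnK // ltnW.
  ring.
apply/integral_poly => j; rewrite coefMX; case: ifP => _; first exact: mxpoly.integral0.
rewrite /p coefD coefXn coef_sum; apply: integral_add; first exact: integral_nat.
elim/big_ind: _ => [|y z|i _]; [exact: mxpoly.integral0|exact: integral_add|].
rewrite coefZ coefXn; apply: integral_mul; last exact: integral_nat.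
rewrite /co -(subnSK (ltn_ord i)) exprSr -mulrA -rmorphXn.
by apply: integral_mul; [exact: integral_id|exact: Ig].
Qed.

(** After multiplication by e^k the product e u satisfies a monic equation. Its integral
    representative need not be divisible by e away from a, so it is cut off by the indicator [one],
    an idempotent and hence integral. *)
Lemma alg_lead a k (e : mpoly n C) (c : 'I_k -> Fn) u : e != 0 -> (forall i, alg a (c i)) ->
  (\forall x \near a, u x * (polyfun e x * u x ^+ k + \sum_(i < k) c i x * u x ^+ i) = 0) ->
  alg a u.
Proof.
move=> e0 ac cu; have [b b0 [g gu Ig]] : alg a (fun x => polyfun e x * u x).
  apply: (@alg_monic a k (fun i x => polyfun e x ^+ (k - i.+1) * c i x)).
    by move=> i; apply: alg_mul (ac i); apply: alg_exp; exact: alg_poly.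
  apply: filterS cu => x /(congr1 ( *%R (polyfun e x ^+ k))); rewrite mulr0 => E; rewrite -[RHS]E {E}.
  rewrite [X in X * _]mulrC -mulrA [RHS]mulrCA; congr (_ * _).
  rewrite !mulrDr !mulr_sumr exprMn; congr (_ + _); first by ring.
  apply: eq_bigr => i _; rewrite exprMn.
  have -> : polyfun e x ^+ k = polyfun e x ^+ (k - i.+1) * polyfun e x ^+ i.+1.
    by rewrite -exprD subnK.
  rewrite exprS; ring.
exists (b * e); first by rewrite mulf_neq0.
pose A x : bool := g x == polyfun e x * u x.
pose one : Fn := fun x => (A x)%:R.
have Ione : integralOver polyfun one.
  apply: (@integral_root_monic _ _ _ _ ('X * ('X - 1%:P))).
  - by rewrite monicMr ?monicXsubC // monicX.
  - apply/rootP; apply/funext => x; rewrite hornerM hornerX hornerXsubC.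
    rewrite [LHS](_ : _ = one x * (one x - 1)) // /one.
    by case: (A x); rewrite ?subrr ?mulr0 // mul0r.
  - apply/integral_poly => j; rewrite coefXM; case: ifP => _; first exact: mxpoly.integral0.
    rewrite coefB coefX coefC; case: (j.-1 == 0)%N; last first.
      by rewrite subr0; exact: integral_nat.
    by apply: integral_sub; [exact: integral_nat|exact: mxpoly.integral1].
exists (fun x => if A x then u x else 0).
  by apply: filterS gu => x gx; rewrite ifT // /A gx.
rewrite [X in integralOver _ X](_ : _ = polyfun b * g * one); first exact: integral_mul.
apply/funext => x; rewrite rmorphM.
rewrite [RHS](_ : _ = polyfun b x * g x * (A x)%:R) //.
rewrite [LHS](_ : _ = polyfun b x * polyfun e x * (if A x then u x else 0)) //.
case: ifP => [/eqP ->|_]; last by rewrite !mulr0.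
by rewrite mulr1 mulrA.
Qed.

Lemma alg_relation a f : alg a f -> exists2 P : {poly (mpoly n C)}, P != 0 &
  \forall x \near a, (map_poly (meval ((x : 'rV[C]_n) 0)) P).[f x] = 0.
Proof.
move=> [b b0 [g gf [p mp pr]]]; exists (\poly_(i < size p) (p`_i * b ^+ i)).
  apply/eqP => /(congr1 (fun q : {poly _} => q`_(size p).-1)); rewrite coef0 coef_poly.
  have sp : (0 < size p)%N by rewrite size_poly_gt0 monic_neq0.
  rewrite prednK // leqnn -lead_coefE (monicP mp) mul1r => /eqP.
  by rewrite expf_eq0 (negbTE b0) andbF.
apply: filterS gf => x <-.
have /rootP/(congr1 (fun h : Fn => h x)) := pr.
rewrite [RHS](_ : _ = 0) // => <-.
rewrite poly_def rmorph_sum horner_sum /= (@horner_coef_wide _ (size p)) ?size_poly //.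
rewrite fctE_sum; apply: eq_bigr => i _.
rewrite coef_map.
rewrite [RHS](_ : _ = polyfun p`_i x * ((polyfun b * g) ^+ i) x) // fctE_exp.
rewrite [in RHS](_ : (polyfun b * g) x = polyfun b x * g x) //.
rewrite -mul_polyC rmorphM /= map_polyC map_polyXn hornerM hornerC hornerXn /=.
by rewrite mevalM rmorphXn /= exprMn mulrA.
Qed.

(** The equation of f, cleared of factors X, is reversed: its nonzero constant term becomes the
    leading coefficient for 1/f. *)
Lemma alg_inv a f : alg a f -> (\forall x \near a, f x != 0) -> alg a (fun x => (f x)^-1).
Proof.
move=> /alg_relation[P P0 Pf] f0; elim/poly_ind: P P0 Pf => [|P c IH]; first by rewrite eqxx.
have [->|c0] := eqVneq c 0.
  rewrite addr0 mulf_eq0 polyX_eq0 orbF => P0 Pf; apply: IH => //.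
  apply: filterS2 f0 Pf => x fx; rewrite rmorphM /= map_polyX hornerM hornerX => /eqP.
  by rewrite mulf_eq0 (negbTE fx) orbF => /eqP.
move=> _ Pf; apply: (@alg_lead a (size P) c (fun i => polyfun P`_(rev_ord i))) => //.
  by move=> i; exact: alg_poly.
apply: filterS2 f0 Pf => x fx; rewrite rmorphD rmorphM /= map_polyX map_polyC hornerD hornerM.
rewrite hornerX hornerC /= => Pf.
suff -> : polyfun c x * (f x)^-1 ^+ size P + \sum_(i < size P) polyfun P`_(rev_ord i) x * (f x)^-1 ^+ i =
  (f x)^-1 ^+ size P * ((map_poly (meval (x 0)) P).[f x] * f x + meval (x 0) c).
  by rewrite Pf !mulr0.
rewrite mulrDr addrC [polyfun c x * _]mulrC; congr (_ + _).
rewrite (@horner_coef_wide _ (size P)) ?size_poly // mulr_suml mulr_sumr.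
rewrite (reindex_inj rev_ord_inj); apply: eq_bigr => i _.
rewrite rev_ordK /= coef_map /= -/(polyfun _ x).
have -> : (f x)^-1 ^+ size P = (f x)^-1 ^+ (size P - i.+1) * (f x)^-1 ^+ i.+1.
  by rewrite -exprD subnK.
have : f x ^+ i.+1 != 0 by rewrite expf_neq0.
rewrite [in X in _ = _ * X * _]exprVn exprSr => fi.
by rewrite -[X in _ = _ * X]mulrA [RHS]mulrCA divfK.
Qed.

(** The leading coefficient of the equation of u may vanish at a. Expanding around a value [tau]
    that is not a root at a, one gets for 1/(u - tau) an equation led by the invertible value at
    [tau]. *)
Lemma nashg_alg a f : nashg a f -> alg a f.
Proof.
elim=> {f}[c|i|f g _ IHf _ IHg|f g _ IHf _ IHg|k c u nc ac cu cu0 d0].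
- exact: alg_cst.
- apply: alg_eq (alg_poly a (mpolyX _ (mnm1 i))); apply: filterE => x.
  by rewrite /polyfun mevalXU.
- exact: alg_add.
- exact: alg_mul.
have [tau _ tau0] : exists2 tau, normc (tau - 0) < 1 & (cpoly c a).[tau] != 0.
  by apply: nonroot_near => //; apply: contra_neq d0 => ->; rewrite deriv0 horner0.
have aD j : alg a (fun x => (cpoly c x)^`N(j).[tau]).
  apply: alg_eq (alg_sum (fun i => alg_mul (ac i) (alg_cst a ('X^i : {poly C})^`N(j).[tau]))).
  by apply: filterE => x; rewrite linear_sum horner_sum; apply: eq_bigr => i _; rewrite linearZ hornerZ.
have D0 : \forall x \near a, (cpoly c x).[tau] != 0.
  apply: contin_neq0 tau0; apply: contin_cpoly => i.
  by have /nashg_contin/nbhs_singleton := nc i.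
have h0 : \forall x \near a, u x - tau != 0.
  by apply: filterS2 cu0 D0 => x ux; apply: contra_neq => /subr0_eq <-.
have : alg a (fun x => (u x - tau)^-1).
  have aD0 : alg a (fun x => (cpoly c x).[tau]^-1).
    by apply: alg_inv D0; apply: alg_eq (aD 0%N); apply: filterE => x; rewrite nderivn0.
  case: k c {nc ac cu d0} cu0 tau0 aD D0 aD0 => [|k] c cu0 tau0 aD D0 aD0.
    by move: tau0; rewrite horner_cpoly big_ord0 eqxx.
  apply: (@alg_monic a k (fun i x => (cpoly c x)^`N((rev_ord i).+1).[tau] * (cpoly c x).[tau]^-1)).
    by move=> i; exact: alg_mul.
  near=> x.
  have Dx : (cpoly c x).[tau] != 0 by near: x.
  have hx : u x - tau != 0 by near: x.
  have : (cpoly c x).[tau + (u x - tau)] = 0 by rewrite addrC subrK; near: x.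
  rewrite (nderiv_taylor_wide (mulrC _ _) (size_cpoly c x)) big_ord_recl nderivn0 expr0 mulr1 => px.
  set s := (u x - tau)^-1.
  suff -> : s ^+ k + \sum_(i < k) (cpoly c x)^`N((rev_ord i).+1).[tau] / (cpoly c x).[tau] * s ^+ i =
    s ^+ k / (cpoly c x).[tau] * ((cpoly c x).[tau] + \sum_(i < k) (cpoly c x)^`N(lift ord0 i).[tau] * (u x - tau) ^+ lift ord0 i).
    by rewrite px !mulr0.
  rewrite mulrDr divfK //; congr (_ + _); rewrite mulr_sumr.
  rewrite (reindex_inj rev_ord_inj); apply: eq_bigr => i _; rewrite rev_ordK /= /bump /= add1n.
  have -> : s ^+ k = s ^+ (k - i.+1) * (u x - tau) ^- i.+1.
    by rewrite /s -exprVn -exprD subnK.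
  have : (u x - tau) ^+ i.+1 != 0 by rewrite expf_neq0.
  by move=> ?; field; rewrite Dx.
move=> /alg_inv H; apply: alg_eq (alg_add (H _) (alg_cst a tau)).
  by apply: filterE => x; rewrite invrK subrK.
by apply: filterS h0 => x; rewrite invr_eq0.
Unshelve. all: by end_near. Qed.

(** Bridges [n.+1] of [unsplit_poly] and [n + 1] of [nash_at]. *)
Lemma recast_mpoly N M (e : N = M) (P : mpoly M C) : P != 0 ->
  exists2 P' : mpoly N C, P' != 0 &
    forall v : 'I_M -> C, meval (fun i => v (cast_ord e i)) P' = meval v P.
Proof.
case: M / e P => P P0; exists P => // v; apply: meval_eq => i; congr v; exact: val_inj.
Qed.

Lemma nashg_algebraic a f : nashg a f -> exists2 P : mpoly (n + 1) C, P != 0 &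
  \forall x \near a, meval (row_mx x (f x)%:M 0) P = 0.
Proof.
move=> /nashg_alg/alg_relation[P P0 Pf].
have [|P' P'0 HP'] := recast_mpoly (addn1 n) (_ : unsplit_poly P != 0).
  by rewrite (can2_eq (@unsplit_polyK _ _) (@split_polyK _ _)) rmorph0.
exists P' => //; apply: filterS Pf => x Px.
rewrite -Px -meval_unsplit -HP'; apply: meval_eq => i.
rewrite mxE; case: splitP => j ij.
  rewrite (_ : cast_ord _ i = widen_ord (leqnSn n) j) ?join_widen //; exact: val_inj.
rewrite (_ : cast_ord _ i = ord_max) ?join_max; first by rewrite ord1 mxE eqxx.
by apply: val_inj; rewrite /= ij ord1 addn0.
Qed.

End Algebraicity.

(** * Tougeron's correction argument *)
Section PrimeIdeals.

Record prime_ideal (A : comNzRingType) (I : A -> Prop) : Prop := PrimeIdeal {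
  prime_ideal0 : I 0;
  prime_idealD : forall x y, I x -> I y -> I (x + y);
  prime_idealM : forall a x, I x -> I (a * x);
  prime_ideal1 : ~ I 1;
  prime_idealP : forall x y, I (x * y) -> I x \/ I y }.

Lemma prime_ideal_comp (A B : comNzRingType) (f : {rmorphism A -> B}) (I : B -> Prop) :
  prime_ideal I -> prime_ideal (fun x => I (f x)).
Proof.
move=> [I0 ID IM I1 IP]; split.
- by rewrite rmorph0.
- by move=> x y; rewrite rmorphD; exact: ID.
- by move=> a x; rewrite rmorphM; exact: IM.
- by rewrite rmorph1.
- by move=> x y; rewrite rmorphM; exact: IP.
Qed.

Lemma prime_idealN (A : comNzRingType) (I : A -> Prop) x : prime_ideal I -> I x -> I (- x).
Proof. by move=> pI; rewrite -mulN1r; exact: (prime_idealM pI). Qed.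

(* The generic fibre of a prime of A[X] over its trace on A is either everything
   or a single conjugacy class, the roots of [E]. *)
Lemma prime_ideal_generator (K : numFieldType) m (J : {poly (mpoly m K)} -> Prop) :
  prime_ideal J -> (forall Q, J Q -> forall j, J (Q`_j)%:P) \/
  exists (E : {poly (mpoly m K)}) k, [/\ size E = k.+2, J E, ~ J (lead_coef E)%:P, ~ J (deriv E) &
    forall Q, J Q -> exists a (S T : {poly (mpoly m K)}),
      [/\ lead_coef E ^+ a *: Q = S * E + T & forall j, J (T`_j)%:P]].
Proof.
move=> pJ; have [|nJ] := pselect (forall Q, J Q -> forall j, J (Q`_j)%:P); [by left|right].
(* E is taken of least degree here: every element of J of smaller degree has all its coefficients in
   J. *)
pose good (E : {poly (mpoly m K)}) := J E /\ exists j, ~ J (E`_j)%:P.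
have [s [E [sE gE]] smin] : exists2 s, (exists E : {poly (mpoly m K)}, size E = s /\ good E) &
    forall E, good E -> (s <= size E)%N.
  have ex : exists s, `[< exists E : {poly (mpoly m K)}, size E = s /\ good E >].
    have [Q /not_implyP[JQ /existsNP[j nj]]] : exists Q, ~ (J Q -> forall j, J (Q`_j)%:P) by exact/existsNP.
    by exists (size Q); apply/asboolP; exists Q; split=> //; split=> //; exists j.
  case: (ex_minnP ex) => s /asboolP sE smin; exists s => // E gE.
  by apply: smin; apply/asboolP; exists E.
have small Q : J Q -> (size Q < s)%N -> forall j, J (Q`_j)%:P.
  move=> JQ sQ j; apply: contrapT => nj; have : good Q by split=> //; exists j.
  by move=> /smin; rewrite leqNgt sQ.
have [JE [j0 j0E]] := gE.
have E0 : E != 0.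
  by apply/eqP => E0; apply: j0E; rewrite E0 coef0 polyC0; exact: (prime_ideal0 pJ).
have nlc : ~ J (lead_coef E)%:P.
  move=> Jlc; pose E1 := E - (lead_coef E)%:P * 'X^((size E).-1).
  have JE1 : J E1.
    apply: (prime_idealD pJ) => //; apply: prime_idealN => //.
    by rewrite mulrC; exact: (prime_idealM pJ).
  have sE1 : (size E1 < s)%N.
    rewrite -sE -(prednK (_ : 0 < size E)%N) ?size_poly_gt0 // ltnS; apply/leq_sizeP => j.
    rewrite leq_eqVlt => /orP[/eqP <-|hj]; rewrite /E1 coefB coefCM coefXn.
      by rewrite eqxx mulr1 -lead_coefE subrr.
    rewrite gtn_eqF // mulr0 subr0; apply: nth_default; move: hj.
    by case: (size E).
  apply: j0E; rewrite (_ : E`_j0 = E1`_j0 + lead_coef E * ('X^((size E).-1) : {poly (mpoly m K)})`_j0).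
    rewrite polyCD; apply: (prime_idealD pJ); first exact: small.
    by rewrite polyCM mulrC; exact: (prime_idealM pJ).
  by rewrite /E1 coefB coefCM subrK.
(* Characteristic 0: otherwise the leading coefficient of E' could lie in J without that of E. *)
have Ks (k : nat) (x : mpoly m K) : J (x *+ k.+1)%:P -> J x%:P.
  move=> /(prime_idealM pJ (mpolyC m (k.+1%:R)^-1)%:P); rewrite -polyCM.
  rewrite -[x *+ _]mulr_natr mulrCA -(mpolyC_nat m) -mpolyCM mulVf ?pnatr_eq0 // mpolyC1 mulr1.
  done.
have [k sk] : exists k, size E = k.+2.
  case sz : (size E) => [|[|k]]; last by exists k.
    by move/eqP: sz; rewrite size_poly_eq0 (negbTE E0).
  by case: nlc; rewrite lead_coefE sz /= -(size1_polyC (_ : size E <= 1)%N) // sz.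
exists E, k; split=> //.
  move=> /small => /(_ _ k) H; apply: nlc; apply: (Ks k).
  rewrite lead_coefE sk /= -coef_deriv; apply: H.
  by rewrite -sE; exact: lt_size_deriv.
(* The remainder of the pseudo-division lies in J and has smaller degree than E, so minimality
   applies to it. *)
move=> Q JQ; exists (scalp Q E), (Q %/ E), (Q %% E); split; first exact: Pdiv.Idomain.divp_eq.
apply: small; last by rewrite -sE ltn_modp.
have -> : Q %% E = lead_coef E ^+ scalp Q E *: Q + - (Q %/ E * E).
  by rewrite Pdiv.Idomain.divp_eq addrAC subrr add0r.
apply: (prime_idealD pJ); first by rewrite -mul_polyC; exact: (prime_idealM pJ).
by apply: prime_idealN => //; exact: (prime_idealM pJ).
Qed.

End PrimeIdeals.

(** * The correction property *)

Section Tougeron.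
Variable R : realType.
Local Notation C := R[i].
Local Notation Fn N := ('rV[C]_N -> C).

Lemma join_ind (T : Type) n (P : T -> Prop) (f : 'I_n -> T) t :
  (forall j, P (f j)) -> P t -> forall i, P (join f t i).
Proof. by move=> Pf Pt i; rewrite /join; case: unlift. Qed.

Lemma contin_near_comp n N (g : Fn N) (Phi : 'rV[C]_n -> 'rV[C]_N) a :
  contin_near g (Phi a) -> (\forall x \near a, {for x, continuous Phi}) ->
  contin_near (fun x => g (Phi x)) a.
Proof.
move=> cg cP; have ca : {for a, continuous Phi} := nbhs_singleton cP.
have gP : \forall x \near a, {for Phi x, continuous g} by exact: (ca _ cg).
apply: filterS2 cP gP => x cx gx.
exact: (continuous_comp cx gx).
Qed.

Lemma contin_near_vanish n (w f : Fn n) (a : 'rV[C]_n) : contin_near f a ->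
  (\forall x \near a, dense_at w x) -> (\forall x \near a, w x != 0 -> f x = 0) ->
  \forall x \near a, f x = 0.
Proof.
move=> cf dw /nbhs_interior fw; near=> x; apply: (@dense_vanish R n w f x).
- by near: x.
- by near: x; exact: cf.
- by near: x; exact: fw.
Unshelve. all: by end_near.
Qed.

Lemma nashg_meval m N (r : 'I_m -> Fn N) a Q :
  (forall i, nashg a (r i)) -> nashg a (fun x => meval (fun i => r i x) Q).
Proof.
move=> nr; apply: (@meval_closed R _ m (@nashg R N a)) => //.
- exact: nashg_cst.
- exact: nashg_add.
- exact: nashg_mul.
Qed.

Lemma nashg_exp N (f : Fn N) a k : nashg a f -> nashg a (fun x => f x ^+ k).
Proof.
move=> nf; elim: k => [|k IH]; first by under eq_fun do rewrite expr0; exact: nashg_cst.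
by under eq_fun do rewrite exprS; exact: nashg_mul.
Qed.

(** First-order Taylor expansion with the remainder kept in the class [K]. The boolean argument
    carries the value before and after the increment, so that one use of [meval_closed] treats
    both. *)
Lemma meval_increment (T : Type) (K : (T -> C) -> Prop) m (r z : 'I_m -> T -> C) (om : T -> C)
    (Q : mpoly m C) (x0 : T) :
  (forall c, K (fun=> c)) ->
  (forall f g, K f -> K g -> K (fun x => f x + g x)) ->
  (forall f g, K f -> K g -> K (fun x => f x * g x)) ->
  (forall i, K (r i)) -> (forall i, K (z i)) -> K om ->
  exists al, [/\ K al, (forall i, z i x0 = 0) -> al x0 = 0 & forall x,
    meval (fun i => r i x + om x * z i x) Q = meval (fun i => r i x) Q + om x * al x].
Proof.
move=> Kc Ka Km Kr Kz Kom.
pose P (f : T * bool -> C) := K (fun x => f (x, false)) /\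
  exists al, [/\ K al, (forall i, z i x0 = 0) -> al x0 = 0 &
    forall x, f (x, true) = f (x, false) + om x * al x].
have [] : P (fun xb => meval (fun i => r i xb.1 + (if xb.2 then om xb.1 * z i xb.1 else 0)) Q).
  apply: (@meval_closed R _ m P).
  - by move=> c; split=> //; exists (fun=> 0); split=> // x; rewrite mulr0 addr0.
  - move=> i; split; first by under eq_fun do rewrite /= addr0.
    by exists (z i); split=> // x /=; rewrite addr0.
  - move=> f g [Kf [al [Kal al0 hf]]] [Kg [be [Kbe be0 hg]]]; split; first exact: Ka.
    exists (fun x => al x + be x); split; first exact: Ka.
      by move=> z0; rewrite al0 // be0 // addr0.
    by move=> x; rewrite hf hg; ring.
  - move=> f g [Kf [al [Kal al0 hf]]] [Kg [be [Kbe be0 hg]]]; split; first exact: Km.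
    exists (fun x => (al x * g (x, false) + f (x, false) * be x) + om x * (al x * be x)); split.
    + apply: (Ka) (Km _ _ Kom (Km _ _ Kal Kbe)).
      exact: (Ka _ _ (Km _ _ Kal Kg) (Km _ _ Kf Kbe)).
    + by move=> z0; rewrite al0 // be0 //; ring.
    + by move=> x; rewrite hf hg; ring.
move=> _ [al [Kal al0 hal]]; exists al; split=> // x.
by rewrite hal; congr (_ + _); apply: meval_eq => i; rewrite addr0.
Qed.

(** [r] is a zero of I modulo w^M and h(r) divides w up to the unit [v]; [tau] is the cofactor,
    which absorbs further minors in the induction on m. [eta] prescribes the corrections of the
    coordinates that I leaves free. The last clause is uniqueness: a given zero F of I near r(Phi)
    whose correction agrees with [eta] is the one constructed. The exponents M - 2 - i and i + 2 add
    up to M. *)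
Definition tougeron m (I : mpoly m C -> Prop) (h : mpoly m C) :=
  forall N (r : 'I_m -> Fn N) (w v tau : Fn N) (eta : 'I_m -> Fn N) M,
  (m + 2 <= M)%N ->
  [/\ forall i, nashg 0 (r i), nashg 0 w, nashg 0 v, nashg 0 tau & forall i, nashg 0 (eta i)] ->
  [/\ w 0 = 0, v 0 != 0, forall i, eta i 0 = 0 & \forall x \near (0 : 'rV[C]_N), dense_at w x] ->
  (\forall x \near (0 : 'rV[C]_N), tau x * meval (fun i => r i x) h = w x * v x) ->
  (forall Q, I Q -> exists2 e, nashg 0 e &
    \forall x \near (0 : 'rV[C]_N), meval (fun i => r i x) Q = w x ^+ M * e x) ->
  exists xi : 'I_m -> Fn N, [/\ forall i, nashg 0 (xi i), forall i, xi i 0 = 0,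
    forall Q, I Q -> \forall x \near (0 : 'rV[C]_N),
      meval (fun i => r i x + w x ^+ (M - 2 - i) * xi i x) Q = 0 &
    forall n (Phi : 'rV[C]_n -> 'rV[C]_N) (F q : 'I_m -> Fn n),
      (\forall z \near (0 : 'rV[C]_n), {for z, continuous Phi}) -> Phi 0 = 0 ->
      (forall i, contin_near (q i) 0) ->
      (forall i, \forall z \near (0 : 'rV[C]_n), F i z = r i (Phi z) + w (Phi z) ^+ M * q i z) ->
      (forall i, \forall z \near (0 : 'rV[C]_n), eta i (Phi z) = w (Phi z) ^+ (i + 2) * q i z) ->
      (\forall z \near (0 : 'rV[C]_n), dense_at (fun z => w (Phi z)) z) ->
      (forall Q, I Q -> \forall z \near (0 : 'rV[C]_n), meval (fun i => F i z) Q = 0) ->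
      forall i, \forall z \near (0 : 'rV[C]_n), xi i (Phi z) = w (Phi z) ^+ (i + 2) * q i z].

Lemma near_horner_vanish m (T : Type) (F : set_system T) {FF : Filter F}
    (Q : {poly (mpoly m C)}) (y : T -> 'I_m -> C) (t : T -> C) :
  (forall j, F (fun x => meval (y x) (Q`_j) = 0)) ->
  F (fun x => (map_poly (meval (y x)) Q).[t x] = 0).
Proof.
move=> Q0; have : F (fun x => forall j : 'I_(size Q), meval (y x) (Q`_j) = 0).
  by apply: filter_forall_fin => j; exact: Q0.
apply: filterS => x Qx; rewrite (@horner_coef_wide _ (size Q)) ?size_poly //.
by apply: big1 => j _; rewrite coef_map /= Qx mul0r.
Qed.

(** The last coordinate is transcendental over the others: relations restrict only its coefficients,
    so its correction can be the prescribed one. *)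
Lemma tougeron_free m (I : mpoly m.+1 C -> Prop) (h : mpoly m C) :
  (forall Q, I (unsplit_poly Q) -> forall j, I (mwiden (Q`_j))) ->
  tougeron (fun p => I (mwiden p)) h -> tougeron I (mwiden h).
Proof.
move=> free IH N r w v tau eta M hM [nr nw nv ntau neta] [w0 v0 eta0 dw] hw IQ.
pose wd := widen_ord (leqnSn m).
have [|||||xi [nxi xi0 xiI xiU]] := IH N (fun j => r (wd j)) w v tau (fun j => eta (wd j)) M.
- by apply: leq_trans hM; rewrite leq_add2r leqnSn.
- by split=> // j.
- by split=> // j.
- by apply: filterS hw => x; rewrite meval_mwiden.
- by move=> Q /IQ[e ne he]; exists e => //; apply: filterS he => x; rewrite meval_mwiden.
exists (join xi (eta ord_max)); split.
- exact: (@join_ind _ _ (fun f => nashg 0 f)).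
- exact: (@join_ind _ _ (fun f : Fn N => f 0 = 0)).
- move=> Q; rewrite -(split_polyK Q); move: (split_poly Q) => {}Q IQ'.
  have : \forall x \near (0 : 'rV[C]_N),
      (map_poly (meval (fun j => r (wd j) x + w x ^+ (M - 2 - j) * xi j x)) Q).[r ord_max x + w x ^+ (M - 2 - m) * eta ord_max x] = 0.
    by apply: near_horner_vanish => j; exact: xiI (free _ IQ' j).
  apply: filterS => x; rewrite -meval_unsplit => E; rewrite -[RHS]E; apply: meval_eq => i.
  by case: (unliftP ord_max i) => [j ->|->]; rewrite -?widen_lift ?join_widen ?join_max.
- move=> n Phi F q cP P0 cq hF heta dwP FI i; rewrite /join; case: unliftP => [j ->|->] //.
  rewrite -widen_lift.
  have := xiU n Phi (fun j => F (wd j)) (fun j => q (wd j)) cP P0 (fun j => cq (wd j))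
    (fun j => hF (wd j)) (fun j => heta (wd j)) dwP.
  by apply=> Q /FI; apply: filterS => z; rewrite meval_mwiden.
Qed.

End Tougeron.

(** * Correction of an algebraic coordinate *)

Section TougeronGeneric.
Variable R : realType.
Local Notation C := R[i].
Local Notation Fn N := ('rV[C]_N -> C).

Lemma nashg_neq0 N (f : Fn N) : nashg 0 f -> f 0 != 0 -> \forall x \near (0 : 'rV[C]_N), f x != 0.
Proof. by move=> /nashg_contin/nbhs_singleton; exact: contin_neq0. Qed.

(** With the first m coordinates corrected, the last one is a root of E. Putting y_m = r_m + w^b u
    into a suitable multiple of E lets w^(b+1) factor out and leaves an equation g(u) = 0 with g(0)
    = 0 and g'(0) = v(0) at the origin. *)
Lemma tougeron_generic m (I : mpoly m.+1 C -> Prop) (h : mpoly m C) (E : {poly (mpoly m C)}) k :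
  prime_ideal I -> size E = k.+2 -> I (unsplit_poly E) ->
  (forall Q, I (unsplit_poly Q) -> exists a (S T : {poly (mpoly m C)}),
      lead_coef E ^+ a *: Q = S * E + T /\ forall j, I (mwiden (T`_j))) ->
  tougeron (fun p => I (mwiden p)) h ->
  tougeron I (mwiden (h * lead_coef E) * unsplit_poly (deriv E)).
Proof.
move=> pI sE IE divE IH N r w v tau eta M hM [nr nw nv ntau neta] [w0 v0 eta0 dw] hw IQ.
pose wd := widen_ord (leqnSn m); pose lc := lead_coef E.
pose r' := fun j => r (wd j); pose rm := r ord_max.
have rE x : (fun i => r i x) = join (fun j => r' j x) (rm x) by rewrite [LHS]join_split.
pose lcr x := meval (fun j => r' j x) lc.
pose hr x := meval (fun j => r' j x) h.
pose Er x := meval (fun i => r i x) (unsplit_poly (deriv E)).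
have nr' j : nashg 0 (r' j) by exact: nr.
have nlcr : nashg 0 lcr by exact: nashg_meval.
have nhr : nashg 0 hr by exact: nashg_meval.
have nEr : nashg 0 Er by exact: nashg_meval.
have hw' : \forall x \near (0 : 'rV[C]_N), tau x * (hr x * lcr x * Er x) = w x * v x.
  by apply: filterS hw => x <-; rewrite mevalM meval_mwiden mevalM.
(* The two new factors of the minor go into the cofactor. *)
have [|||||xi [nxi xi0 xiI xiU]] := IH N r' w v (fun x => tau x * (lcr x * Er x)) (fun j => eta (wd j)) M.
- by apply: leq_trans hM; rewrite leq_add2r leqnSn.
- by split=> //; apply: nashg_mul => //; exact: nashg_mul.
- by split=> // j.
- by apply: filterS hw' => x <-; rewrite -/(hr x); ring.
- by move=> Q /IQ[e ne he]; exists e => //; apply: filterS he => x; rewrite meval_mwiden.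
have [b b0 bM] : exists2 b, (0 < b)%N & M = (b + m + 2)%N by exists (M - 2 - m)%N; lia.
pose y' j x := r' j x + w x ^+ (M - 2 - j) * xi j x.
pose om x := w x ^+ b.+1.
(* The corrections of the first m coordinates are all multiples of [om] = w^(b+1), one power more
   than the last coordinate will get. *)
pose z : 'I_m.+1 -> Fn N := join (fun j x => w x ^+ (m - j.+1) * xi j x) (fun=> 0).
have nz : forall i, nashg 0 (z i).
  apply: (@join_ind _ _ (nashg 0)); last exact: nashg_cst.
  by move=> j; apply: nashg_mul => //; exact: nashg_exp.
have z0 : forall i, z i 0 = 0.
  by apply: (@join_ind _ _ (fun f : Fn N => f 0 = 0)) => // j; rewrite xi0 mulr0.
have nom : nashg 0 om by exact: nashg_exp.
have om0 : om 0 = 0 by rewrite /om w0 expr0n.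
have yE x : (fun i => r i x + om x * z i x) = join (fun j => y' j x) (rm x).
  rewrite [LHS]join_split; congr join; last by rewrite /z join_max mulr0 addr0.
  apply/funext => j; rewrite /z join_widen mulrA /om -exprD; congr (_ + w x ^+ _ * _).
  by rewrite bM; have := ltn_ord j; lia.
have incr := fun Q => meval_increment Q 0 (@nashg_cst _ _ 0) (@nashg_add _ _ 0) (@nashg_mul _ _ 0) nr nz nom.
have [al [nal /(_ z0) al0 hal]] := incr (unsplit_poly E).
have [be [nbe _ hbe]] := incr (unsplit_poly (deriv E)).
have [ga [nga _ hga]] := incr (mwiden lc).
have [e ne he] := IQ _ IE.
pose al' x := w x ^+ m.+1 * e x + al x.
have nal' : nashg 0 al' by apply: nashg_add => //; apply: nashg_mul => //; exact: nashg_exp.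
pose kap x := tau x * (hr x * lcr x).
pose mu x := tau x * (hr x * Er x).
have nkap : nashg 0 kap by do 2 (apply: nashg_mul => //).
have nmu : nashg 0 mu by do 2 (apply: nashg_mul => //).
pose D (j : nat) x := meval (join (fun j => y' j x) (rm x)) (unsplit_poly (nderivn j E)).
have nD j : nashg 0 (D j).
  rewrite /D; under eq_fun do rewrite -yE.
  apply: nashg_meval => i; apply: nashg_add; first exact: nr.
  by apply: nashg_mul.
have D0 : \forall x \near (0 : 'rV[C]_N), D 0%N x = om x * al' x.
  apply: filterS he => x hx; rewrite /D nderivn0 -yE hal hx /al' mulrDr mulrA /om -exprD.
  by congr (w x ^+ _ * _ + _); rewrite bM; lia.
have D1 x : D 1%N x = Er x + om x * be x by rewrite /D poly.nderivn1 -yE hbe.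
pose v1 x := v x + kap x * (w x ^+ b * be x).
have nv1 : nashg 0 v1.
  by apply: nashg_add => //; do 2 (apply: nashg_mul => //); exact: nashg_exp.
(* Taylor coefficients of E at r_m, times [kap] and divided by w^(b+1). The linear one relies on
   [kap] E'(r) = w v; from degree 2 on w^(b i) has enough factors since b > 0. *)
pose g : 'I_k.+2 -> Fn N := fun i => match val i with
  | 0 => fun x => kap x * al' x
  | 1 => v1
  | j.+2 => fun x => kap x * D j.+2 x * w x ^+ (b * j.+1).-1
  end.
have ng i : nashg 0 (g i).
  rewrite /g; case: (val i) => [|[|j]] //; first exact: nashg_mul.
  exact: (nashg_mul (nashg_mul nkap (nD j.+2)) (nashg_exp (b * j.+1).-1 nw)).
have key : \forall x \near (0 : 'rV[C]_N), forall u,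
    kap x * (map_poly (meval (fun j => y' j x)) E).[rm x + w x ^+ b * u] = om x * (cpoly g x).[u].
  apply: filterS2 D0 hw' => x D0x hwx u.
  rewrite (@nderiv_taylor_wide _ k.+2) ?(leq_trans (size_poly _ _)) ?sE //; last exact: mulrC.
  rewrite (eq_bigr (fun i : 'I_k.+2 => D i x * (w x ^+ b * u) ^+ i)); last first.
    by move=> i _; rewrite nderivn_map -meval_unsplit.
  rewrite horner_cpoly !big_ord_recl /= D0x D1 !mulrDr; congr (_ + (_ + _)).
  - by rewrite !expr0 /g /= /al'; ring.
  - have kE : kap x * Er x = w x * v x by rewrite -hwx /kap; ring.
    rewrite /bump /= add1n !expr1 /g /= /v1 mulrDl mulrDr [X in X + _]mulrA kE /om exprS; ring.
  - rewrite !mulr_sumr; apply: eq_bigr => i _; rewrite /g /= /bump /= !add1n.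
    rewrite exprMn -exprM /om.
    have -> : (b * i.+2 = b.+1 + (b * i.+1).-1)%N by nia.
    by rewrite exprD; ring.
have al'0 : al' 0 = 0 by rewrite /al' w0 expr0n mul0r add0r.
have g0 : (cpoly g 0).[0] = 0.
  rewrite horner_cpoly big1 // => -[[|j] lt] _; rewrite /g /=; last by rewrite expr0n mulr0.
  by rewrite al'0 mulr0 mul0r.
have dg0 : (cpoly g 0)^`().[0] != 0.
  rewrite horner_deriv_cpoly !big_ord_recl /= big1 => [|i _].
    by rewrite mulr0n mulr0 add0r addr0 expr0 mulr1 /g /= /v1 w0 expr0n eqn0Ngt b0 mul0r mulr0 addr0.
  by rewrite expr0n /= mul0rn mulr0.
have [u [nu u0 [ep ep0 hu]]] := nashg_implicit ng g0 dg0.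
have vn0 := nashg_neq0 nv v0.
have kap0 : \forall x \near (0 : 'rV[C]_N), w x != 0 -> kap x != 0.
  apply: filterS2 vn0 hw' => x vx hx wx; apply/eqP => kx.
  have : w x * v x != 0 by rewrite mulf_neq0.
  by rewrite -hx mulrA -/(kap x) kx mul0r eqxx.
(* The leading coefficient at the corrected point, times [mu], is w times the unit v + w^b [mu]
   [ga]. *)
have lc0 : \forall x \near (0 : 'rV[C]_N), w x != 0 -> meval (fun j => y' j x) lc != 0.
  have nvv : nashg 0 (fun x => v x + w x ^+ b * (mu x * ga x)).
    by apply: nashg_add => //; apply: nashg_mul; [exact: nashg_exp|exact: nashg_mul].
  have : v 0 + w 0 ^+ b * (mu 0 * ga 0) != 0 by rewrite w0 expr0n eqn0Ngt b0 mul0r addr0.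
  move=> /(nashg_neq0 nvv); apply: filterS2 hw' => x hx vx wx; apply/eqP => lx.
  have := mulf_neq0 wx vx; suff -> : w x * (v x + w x ^+ b * (mu x * ga x)) =
    mu x * meval (fun j => y' j x) lc by rewrite lx mulr0 eqxx.
  have -> : meval (fun j => y' j x) lc = lcr x + om x * ga x.
    have := hga x; rewrite yE !meval_mwiden => H; rewrite /lcr -H.
    by apply: meval_eq => j; rewrite join_widen.
  have -> : w x * (v x + w x ^+ b * (mu x * ga x)) = w x * v x + om x * (mu x * ga x).
    by rewrite /om exprS; ring.
  by rewrite -hx /mu; ring.
pose ym x := rm x + w x ^+ b * u x.
have Ey : \forall x \near (0 : 'rV[C]_N), w x != 0 ->
    (map_poly (meval (fun j => y' j x)) E).[ym x] = 0.
  apply: filterS3 key kap0 hu => x kx k0 [ux _] /k0 {}k0.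
  by have /eqP := kx (u x); rewrite ux mulr0 mulf_eq0 (negbTE k0) => /eqP.
exists (join xi u); split.
- exact: (@join_ind _ _ (nashg 0)).
- exact: (@join_ind _ _ (fun f : Fn N => f 0 = 0)).
- move=> Q; rewrite -(split_polyK Q); move: (split_poly Q) => {}Q IQ'.
  have nye : forall i, nashg 0 (fun x => r i x + w x ^+ (M - 2 - i) * join xi u i x).
    move=> i; apply: nashg_add; first exact: nr.
    apply: nashg_mul; first exact: nashg_exp.
    exact: (@join_ind _ _ (nashg 0)).
  have yjE x : (fun i => r i x + w x ^+ (M - 2 - i) * join xi u i x) =
      join (fun j => y' j x) (ym x).
    rewrite [LHS]join_split; congr join; last first.
      by rewrite join_max /ym bM; congr (_ + w x ^+ _ * _); rewrite /=; lia.
    by apply/funext => j; rewrite join_widen.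
  apply: (contin_near_vanish _ dw); first by apply: nashg_contin; exact: nashg_meval.
  have [a [S [T [QE TI]]]] := divE _ IQ'.
  have T0 : \forall x \near (0 : 'rV[C]_N), (map_poly (meval (fun j => y' j x)) T).[ym x] = 0.
    by apply: near_horner_vanish => j; exact: xiI (TI j).
  (* At the corrected point E and T vanish, so the power of the leading coefficient times Q does; it
     cancels where w is nonzero. *)
  apply: filterS3 Ey lc0 T0 => x Ex lx Tx wx; rewrite yjE meval_unsplit.
  have := congr1 (fun P => (map_poly (meval (fun j => y' j x)) P).[ym x]) QE.
  rewrite rmorphD rmorphM /= hornerD hornerM (Ex wx) Tx mulr0 addr0 -mul_polyC rmorphM /=.
  rewrite map_polyC hornerM hornerC /= rmorphXn /= => /eqP.
  by rewrite mulf_eq0 expf_eq0 (negbTE (lx wx)) andbF => /eqP.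
- move=> n Phi F q cP P0 cq hF heta dwP FI.
  have FI' : forall Q, I (mwiden Q) -> \forall x \near (0 : 'rV[C]_n), meval (fun j => F (wd j) x) Q = 0.
    by move=> Q /FI; apply: filterS => x; rewrite meval_mwiden.
  have {}xiU := xiU n Phi (fun j => F (wd j)) (fun j => q (wd j)) cP P0 (fun j => cq (wd j))
    (fun j => hF (wd j)) (fun j => heta (wd j)) dwP FI'.
  move=> i; case: (unliftP ord_max i) => [j ->|->].
    by rewrite -widen_lift join_widen; exact: xiU.
  rewrite join_max.
  have near_Phi (P : 'rV[C]_N -> Prop) : (\forall x \near (0 : 'rV[C]_N), P x) ->
      \forall x \near (0 : 'rV[C]_n), P (Phi x).
    by rewrite -P0; exact: (nbhs_singleton cP).
  have contin_Phi f : nashg 0 f -> contin_near (fun x => f (Phi x)) 0.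
    by move=> nf; apply: contin_near_comp cP; rewrite P0; exact: nashg_contin.
  (* The correction that F demands also solves g = 0, since F is a zero of E; being small near 0 it
     is the solution u. *)
  pose s x := w (Phi x) ^+ (m + 2) * q ord_max x.
  have cs : contin_near s 0.
    by apply: contin_nearM => //; apply: (contin_Phi (fun x => w x ^+ (m + 2))); exact: nashg_exp.
  have y'E : \forall x \near (0 : 'rV[C]_n), forall j, y' j (Phi x) = F (wd j) x.
    apply: filter_forall_fin => j; apply: filterS2 (xiU j) (hF (wd j)) => x xj ->.
    rewrite /y' xj mulrA -exprD; congr (_ + _ ^+ _ * _); rewrite bM; have := ltn_ord j; lia.
  have gs : \forall x \near (0 : 'rV[C]_n), (cpoly g (Phi x)).[s x] = 0.
    apply: (contin_near_vanish _ dwP).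
      rewrite (_ : (fun x => _) = (fun x => \sum_(i < k.+2) g i (Phi x) * s x ^+ i)); last first.
        by apply/funext => x; rewrite horner_cpoly.
      apply: filterS2 (filter_forall_fin (fun i => contin_Phi _ (ng i))) cs => x cg csx.
      by apply: contin_sum => i'; apply: continuousM; [exact: cg|exact: continX].
    have := FI _ IE; apply: filterS3 (filterI y'E (hF ord_max)) (near_Phi _ key) => x [yx Fx] kx.
    rewrite [fun i => F i x]join_split meval_unsplit => EF wx.
    have := kx (s x).
    rewrite (_ : rm (Phi x) + w (Phi x) ^+ b * s x = F ord_max x); last first.
      by rewrite Fx /s mulrA -exprD bM addnA.
    rewrite (_ : (fun j => y' j (Phi x)) = (fun j => F (wd j) x)); last by apply/funext.
    rewrite EF mulr0 => /esym/eqP; rewrite mulf_eq0 /om expf_eq0 (negbTE wx) andbF /=.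
    by move/eqP.
  have sep : \forall x \near (0 : 'rV[C]_n), normc (s x - 0) < ep.
    have s0 : s 0 = 0 by rewrite /s P0 w0 expr0n addn2 /= mul0r.
    by rewrite -s0; have /continuous_C := nbhs_singleton cs; apply.
  apply: filterS3 gs sep (near_Phi _ hu) => x gx sx [_ hx].
  by rewrite -(hx _ sx gx).
Qed.

End TougeronGeneric.

(** * The induction on the number of variables *)
Section UniversalDivision.
Variable R : realType.
Local Notation C := R[i].
Local Notation Fn N := ('rV[C]_N -> C).

(** Each algebraic coordinate contributes its leading coefficient and its derivative to h; primality
    keeps the product outside I. *)
Lemma tougeron_exists m (I : mpoly m C -> Prop) : prime_ideal I ->
  exists2 h, ~ I h & tougeron I h.
Proof.
elim: m I => [|m IHm] I pI.
  exists 1; first exact: prime_ideal1 pI.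
  move=> N r w v tau eta M _ _ _ _ _; exists (fun=> (fun=> 0)).
  split=> [[]//|//|Q IQ|n Phi F q _ _ _ _ _ _ _ []//].
  apply: filterE => x; move: IQ; rewrite (nvar0_mpolyC Q); set c := mcoeff _ Q => Ic.
  rewrite mevalC; apply/eqP; apply: contraT => c0; case: (prime_ideal1 pI).
  by have := prime_idealM pI (mpolyC 0 c^-1) Ic; rewrite -mpolyCM mulVf // mpolyC1.
have pI' := prime_ideal_comp (@mwiden m C) pI.
have [h nh IH] := IHm _ pI'.
have pJ := prime_ideal_comp (@unsplit_poly C m) pI.
have [free|[E [k [sE JE nlc nE' divE]]]] := @prime_ideal_generator C m _ pJ.
  exists (mwiden h) => //; apply: tougeron_free IH => Q /free JQ j.
  by rewrite -unsplit_polyC; exact: JQ j.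
exists (mwiden (h * lead_coef E) * unsplit_poly (deriv E)).
  move=> /(prime_idealP pI)[|//]; rewrite mwidenM => /(prime_idealP pI)[//|].
  by rewrite -unsplit_polyC; exact: nlc.
apply: (tougeron_generic pI sE JE _ IH) => Q /divE[a [S [T [QE TI]]]]; exists a, S, T.
split; [exact: QE|by move=> j; rewrite -unsplit_polyC; exact: TI j].
Qed.

Lemma near_roots n S (c : 'I_S -> Fn n) (delta : R) : 0 < delta ->
  (forall j, {for 0, continuous (c j)}) -> (forall j, c j 0 = 0) ->
  \forall x \near (0 : 'rV[C]_n), forall t, root (wpoly c x) t -> normc t < delta.
Proof.
move=> delta0 cc c0; pose d := Num.min delta 1.
have d0 : 0 < d by rewrite lt_min delta0 ltr01.
(* As d <= 1, a root with |t| >= d would satisfy |t|^S <= S/(S+1) |t|^S. *)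
pose e := d ^+ S / S.+1%:R.
have e0 : 0 < e by rewrite divr_gt0 ?exprn_gt0 // ltr0n.
have : \forall x \near (0 : 'rV[C]_n), forall j, normc (c j x) < e.
  apply: filter_forall_fin => j; have /continuous_C/(_ e e0) := cc j.
  by apply: filterS => x; rewrite c0 subr0.
apply: filterS => x cx t /rootP; rewrite horner_wpoly => /eqP; rewrite addr_eq0 => /eqP tS.
rewrite ltNge; apply/negP => dt.
have {}dt : d <= normc t by apply: le_trans dt; rewrite ge_min lexx.
have t0 : 0 < normc t ^+ S by rewrite exprn_gt0 // (lt_le_trans d0).
have : normc t ^+ S <= S%:R * (normc t ^+ S / S.+1%:R).
  rewrite -{1}normcX tS normcN; apply: le_trans (normc_sum _ _ _) _.
  have -> : S%:R * (normc t ^+ S / S.+1%:R) = \sum_(j < S) normc t ^+ S / S.+1%:R.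
    by rewrite sumr_const card_ord -[RHS]mulr_natl.
  apply: ler_sum => j _; rewrite normcM normcX.
  apply: (@le_trans _ _ (e * normc t ^+ j)).
    by rewrite ler_wpM2r ?exprn_ge0 ?normc_ge0 // ltW.
  rewrite /e mulrAC ler_wpM2r ?invr_ge0 ?ler0n //.
  have jS := ltnW (ltn_ord j).
  have -> : normc t ^+ S = normc t ^+ (S - j) * normc t ^+ j by rewrite -exprD subnK.
  rewrite ler_wpM2r ?exprn_ge0 ?normc_ge0 //.
  apply: (@le_trans _ _ (d ^+ (S - j))); last by apply: lerXn2r; rewrite ?nnegrE ?normc_ge0 ?(ltW d0).
  by apply: ler_wiXn2l; [exact: ltW|rewrite /d ge_min lexx orbT|exact: leq_subr].
rewrite mulrCA -{1}[normc t ^+ S]mulr1 ler_pM2l // ler_pdivlMr ?ltr0n // mul1r ler_nat.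
by rewrite ltnn.
Qed.

Variables (K S : nat) (jw : 'I_S -> 'I_K).

(** The Weierstrass polynomial with indeterminate coefficients; the K indeterminates also include
    those of the remainders, selected by other index maps. *)
Definition wuniv : {poly (mpoly K C)} := 'X^S + \sum_(j < S) mpolyX C (mnm1 (jw j)) *: 'X^j.

Lemma wuniv_monic : wuniv \is monic.
Proof.
rewrite monicE lead_coefDl ?lead_coefXn // size_polyXn ltnS.
apply: (leq_trans (size_sum _ _ _)); apply/bigmax_leqP => j _.
by apply: (leq_trans (size_scale_leq _ _)); rewrite size_polyXn.
Qed.

Lemma map_wuniv n (a : 'I_K -> Fn n) x :
  map_poly (meval (fun k => a k x)) wuniv = wpoly (fun j => a (jw j)) x.
Proof.
rewrite rmorphD /= map_polyXn raddf_sum; congr (_ + _); apply: eq_bigr => j _ /=.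
by rewrite -!mul_polyC rmorphM /= map_polyC map_polyXn /= mevalXU.
Qed.

(** Divisibility by w^k becomes polynomial relations between the a: division by a monic polynomial
    commutes with specialization, and the specialized remainder is 0 by [root_division], since the
    roots of w are small for x near 0. *)
Lemma universal_vanish n (a : 'I_K -> Fn n) (P : {poly (mpoly K C)}) k (D : Fn n.+1) :
  (forall j, {for 0, continuous (a (jw j))}) -> (forall j, a (jw j) 0 = 0) ->
  contin_near D 0 ->
  (\forall y \near (0 : 'rV[C]_n.+1),
     (map_poly (meval (fun i => a i (rhead y))) P).[y 0 ord_max] =
     (wpoly (fun j => a (jw j)) (rhead y)).[y 0 ord_max] ^+ k * D y) ->
  forall j, \forall x \near (0 : 'rV[C]_n),
    meval (fun i => a i x) ((Pdiv.Ring.rmodp P (wuniv ^+ k))`_j) = 0.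
Proof.
move=> ca a0 cD PD j.
have [delta delta0 Hd] := (nbhs_rV _ _).1 (filterI cD PD).
have rts := near_roots delta0 ca a0.
have xs : \forall x \near (0 : 'rV[C]_n), forall i, normc ((x : 'rV[C]_n) 0 i) < delta.
  by apply/nbhs_rV; exists delta => // x xd i; have := xd i; rewrite mxE subr0.
apply: filterS2 rts xs => x rx xd.
have {}Hd t : normc t < delta ->
   {for rjoin x t, continuous D} /\
   (map_poly (meval (fun i => a i x)) P).[t] = (wpoly (fun j => a (jw j)) x).[t] ^+ k * D (rjoin x t).
  move=> td; have [|cDt] := Hd (rjoin x t).
    move=> i; rewrite [X in _ - X]mxE subr0 rjoinE; move: i.
    exact: (@join_ind _ _ (fun t => normc t < delta)).
  by rewrite rhead_rjoin rjoinE join_max.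
set Q := Pdiv.Ring.rdivp P (wuniv ^+ k); set p := Pdiv.Ring.rmodp P (wuniv ^+ k).
have mW : wuniv ^+ k \is monic by rewrite monic_exp // wuniv_monic.
have PE : P = Q * wuniv ^+ k + p by exact: Pdiv.RingMonic.rdivp_eq.
have mapW : map_poly (meval (fun i => a i x)) (wuniv ^+ k) = wpoly (fun j => a (jw j)) x ^+ k.
  by rewrite rmorphXn /= map_wuniv.
suff -> : meval (fun i => a i x) p`_j = (map_poly (meval (fun i => a i x)) p)`_j.
  rewrite (_ : map_poly _ p = 0) ?coef0 //.
  apply: (@root_division R (wpoly (fun j => a (jw j)) x ^+ k) _ delta
    (fun t => D (rjoin x t) - (map_poly (meval (fun i => a i x)) Q).[t])).
  - by rewrite monic_exp // wpoly_monic.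
  - apply: (leq_ltn_trans (size_poly _ _)); rewrite -mapW size_map_poly_id0; last first.
      by rewrite (monicP mW) /= meval1 oner_eq0.
    by rewrite Pdiv.Ring.ltn_rmodp monic_neq0.
  - by move=> t /rootP; rewrite horner_exp => /eqP; rewrite expf_eq0 => /andP[_ /rx].
  - move=> t /rootP; rewrite horner_exp => /eqP; rewrite expf_eq0 => /andP[_ /rx/Hd[cDt _]].
    by apply: continuousB; [exact: continuous_rjoin|exact: poly_continuous].
  - move=> t /Hd[_ Pt]; rewrite horner_exp mulrBr -Pt {1}PE rmorphD rmorphM /= hornerD hornerM.
    by rewrite mapW horner_exp; ring.
by rewrite coef_map.
Qed.

End UniversalDivision.

(** * Analytic germs at the origin *)

Section Analytic0.
Variable R : realType.
Local Notation C := R[i].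
Variable n : nat.
Implicit Types f g : 'rV[C]_n -> C.

Lemma analytic0W f : analytic0 f -> exists2 r : R, 0 < r & forall r', r' <= r -> polylim (polydisc r') f.
Proof. by move=> [r r0 fr]; exists r => // r' rr; apply: polylimW fr; exact: polydiscW. Qed.

Lemma analytic0_cst c : analytic0 (fun _ : 'rV[C]_n => c).
Proof. by exists 1 => //; exact: polylim_cst. Qed.

Lemma analytic0_coord i : analytic0 (fun x : 'rV[C]_n => x 0 i).
Proof. by exists 1 => //; exact: polylim_coord. Qed.

Lemma analytic0_common k (f : 'I_k -> 'rV[C]_n -> C) : (forall i, analytic0 (f i)) ->
  exists2 r : R, 0 < r & forall i r', r' <= r -> polylim (polydisc r') (f i).
Proof.
elim: k f => [|k IH] f af; first by exists 1 => // -[].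
have [r1 r10 H1] := IH (fun i => f (lift ord0 i)) (fun i => af _).
have [r2 r20 H2] := analytic0W (af ord0).
exists (Num.min r1 r2) => [|i r']; first by rewrite lt_min r10.
rewrite le_min => /andP[h1 h2]; case: (unliftP ord0 i) => [j ->|->]; [exact: H1|exact: H2].
Qed.

Lemma analytic0_add f g : analytic0 f -> analytic0 g -> analytic0 (fun x => f x + g x).
Proof.
move=> /analytic0W[r r0 fr] /analytic0W[s s0 gs]; exists (Num.min r s); first by rewrite lt_min r0.
by apply: polylimD; [apply: fr|apply: gs]; rewrite ge_min lexx ?orbT.
Qed.

Lemma analytic0_mul f g : analytic0 f -> analytic0 g -> analytic0 (fun x => f x * g x).
Proof.
move=> /analytic0W[r r0 fr] /analytic0W[s s0 gs]; exists (Num.min r s); first by rewrite lt_min r0.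
apply: (@polylimM R n _ (Num.min r s)) => //; [apply: fr|apply: gs]; rewrite ge_min lexx ?orbT //.
Qed.

Lemma analytic0_meval k (f : 'I_k -> 'rV[C]_n -> C) Q : (forall i, analytic0 (f i)) ->
  analytic0 (fun x => meval (fun i => f i x) Q).
Proof.
move=> af; apply: (@meval_closed R _ k (@analytic0 R n)) => //.
- exact: analytic0_cst.
- exact: analytic0_add.
- exact: analytic0_mul.
Qed.

Lemma analytic0_exp f k : analytic0 f -> analytic0 (fun x => f x ^+ k).
Proof.
move=> af; elim: k => [|k IH]; first by under eq_fun do rewrite expr0; exact: analytic0_cst.
by under eq_fun do rewrite exprS; exact: analytic0_mul.
Qed.

Lemma analytic0_contin f : analytic0 f -> contin_near f 0.
Proof. exact: analytic0_continuous. Qed.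

Lemma analytic0_head f : analytic0 f -> analytic0 (fun y : 'rV[C]_n.+1 => f (rhead y)).
Proof.
move=> [r r0 fr]; exists r => //; apply: polylim_head fr => y yr j.
by rewrite mxE; exact: yr.
Qed.

End Analytic0.

Section WeierstrassGerms.
Variable R : realType.
Local Notation C := R[i].
Variable n : nat.
Local Notation Fn N := ('rV[C]_N -> C).

Lemma analytic0_bidisc (f : Fn n.+1) (sig rho : R) : 0 < sig -> 0 < rho ->
  polylim (bidisc sig rho) f -> analytic0 f.
Proof.
move=> s0 r0 fl; exists (Num.min sig rho); first by rewrite lt_min s0.
apply: polylimW fl => y; rewrite [y]rjoin_split => /rjoin_polydisc[xr tr].
apply/rjoin_bidisc; split; first by apply: polydiscW xr; rewrite ge_min lexx.
by apply: le_trans tr _; rewrite ge_min lexx orbT.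
Qed.

Lemma analytic0_wpoly S (c : 'I_S -> 'rV[C]_n -> C) : (forall j, analytic0 (c j)) ->
  analytic0 (fun y : 'rV[C]_n.+1 => (wpoly c (rhead y)).[y 0 ord_max]).
Proof.
move=> ac; under eq_fun do rewrite horner_wpoly.
apply: (@analytic0_add _ n.+1 (fun y => y 0 ord_max ^+ S)).
  by apply: analytic0_exp; exact: analytic0_coord.
apply: (@big_closed R _ _ _ (@analytic0 R n.+1)); first exact: analytic0_cst.
- exact: analytic0_add.
- move=> j; apply: (@analytic0_mul _ n.+1 (fun y => c j (rhead y)) (fun y => y 0 ord_max ^+ j)).
    exact: analytic0_head.
  by apply: analytic0_exp; exact: analytic0_coord.
Qed.

Lemma weierstrass_preparation_germ (g : Fn n.+1) s : analytic0 g -> regular_axis g s ->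
  exists q (c : 'I_s -> Fn n), [/\ analytic0 q, q 0 != 0,
    forall j, analytic0 (c j) /\ c j 0 = 0 &
    \forall y \near (0 : 'rV[C]_n.+1), g y * q y = (wpoly c (rhead y)).[y 0 ord_max]].
Proof.
move=> [r r0 gr] rg; have gb : polylim (bidisc r r) g.
  by apply: polylimW gr => y /bidisc_polydisc; rewrite maxxx.
have [rho [sig [q [c [[/andP[rho0 _] /andP[sig0 _]] [ql q0] cl E]]]]] :=
  weierstrass_preparation r0 r0 gb rg.
exists q, c; split=> //; first exact: analytic0_bidisc ql.
  by move=> j; have [cj cj0] := cl j; split=> //; exists sig.
by apply: filterS (bidisc_nbhs n sig0 rho0) => y; exact: E.
Qed.

(** On the axis w^M is exactly t^(S M), as the c j vanish at 0, so [weierstrass_division] applies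
    with b = 1 and no error there. *)
Lemma weierstrass_division_germ S M (c : 'I_S -> Fn n) (f : Fn n.+1) :
  (forall j, analytic0 (c j) /\ c j 0 = 0) -> analytic0 f ->
  exists q (r : 'I_(S * M) -> Fn n), [/\ analytic0 q, forall j, analytic0 (r j) &
    \forall y \near (0 : 'rV[C]_n.+1), f y =
      (wpoly c (rhead y)).[y 0 ord_max] ^+ M * q y +
      \sum_(j < S * M) r j (rhead y) * y 0 ord_max ^+ j].
Proof.
move=> ac af; pose g (y : 'rV[C]_n.+1) := (wpoly c (rhead y)).[y 0 ord_max] ^+ M.
have /analytic0W[r1 r10 H1] : analytic0 g.
  by apply: analytic0_exp; apply: analytic0_wpoly => j; have [] := ac j.
have /analytic0W[r2 r20 H2] := af.
pose r := Num.min r1 r2; have r0 : 0 < r by rewrite lt_min r10.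
have bW s : s <= r -> @bidisc R n s r `<=` polydisc r.
  by move=> sr y /bidisc_polydisc; rewrite (max_idPr sr).
have [||sig1 /andP[s0 s1] H] := @weierstrass_division R n g r r (S * M) 1 r0 r0 (oner_neq0 _).
- by apply: polylimW (bW _ (lexx _)) _; apply: H1; rewrite ge_min lexx.
- move=> t tr; rewrite /g divr1 rhead_rjoin rjoinE join_max horner_wpoly big1 ?addr0 => [|j _].
    by rewrite -exprM subrr normc0 divr_ge0 ?exprn_ge0 ?ltW // mulr_gt0 // dropC_gt0.
  by have [_ ->] := ac j; rewrite mul0r.
have fl : polylim (bidisc sig1 r) f.
  by apply: polylimW (bW _ s1) _; apply: H2; rewrite ge_min lexx orbT.
have ss : 0 < sig1 <= sig1 by rewrite s0 lexx.
have [q [d [ql dl E]]] := H sig1 ss f fl.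
exists q, d; split; first exact: analytic0_bidisc ql.
  by move=> j; exists sig1.
by apply: filterS (bidisc_nbhs n s0 r0) => y; exact: E.
Qed.

End WeierstrassGerms.

(** * Universal polynomials and their specializations *)

Section Specialization.
Variable R : realType.
Local Notation C := R[i].
Local Notation Fn N := ('rV[C]_N -> C).

Definition spec K (b : 'I_K -> C) (t : C) (P : {poly (mpoly K C)}) : C :=
  (map_poly (meval b) P).[t].

Lemma specD K (b : 'I_K -> C) t P Q : spec b t (P + Q) = spec b t P + spec b t Q.
Proof. by rewrite /spec rmorphD hornerD. Qed.

Lemma specM K (b : 'I_K -> C) t P Q : spec b t (P * Q) = spec b t P * spec b t Q.
Proof. by rewrite /spec rmorphM hornerM. Qed.

Lemma specXn K (b : 'I_K -> C) t P k : spec b t (P ^+ k) = spec b t P ^+ k.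
Proof. by rewrite /spec rmorphXn horner_exp. Qed.

Lemma specX K (b : 'I_K -> C) t : spec b t 'X = t.
Proof. by rewrite /spec map_polyX hornerX. Qed.

Lemma spec_unsplit K (b : 'I_K -> C) t P : spec b t P = meval (join b t) (unsplit_poly P).
Proof. by rewrite meval_unsplit. Qed.

(** The remainder of a Weierstrass division with indeterminate coefficients. *)
Definition runiv K d (j : 'I_d -> 'I_K) : {poly (mpoly K C)} :=
  \sum_(l < d) mpolyX C (mnm1 (j l)) *: 'X^l.

Lemma spec_runiv K d (j : 'I_d -> 'I_K) b t :
  spec b t (runiv j) = \sum_(l < d) b (j l) * t ^+ l.
Proof.
rewrite /spec raddf_sum horner_sum; apply: eq_bigr => l _ /=.
by rewrite -mul_polyC rmorphM /= map_polyC map_polyXn /= mevalXU hornerM hornerC hornerXn.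
Qed.

Definition quniv K m (r : 'I_m -> {poly (mpoly K C)}) (Q : mpoly m C) : {poly (mpoly K C)} :=
  mmap (polyC \o @mpolyC K C) r Q.

Lemma spec_quniv K m (r : 'I_m -> {poly (mpoly K C)}) Q b t :
  spec b t (quniv r Q) = meval (fun i => spec b t (r i)) Q.
Proof.
rewrite /spec /quniv /mmap !raddf_sum horner_sum mevalE; apply: eq_bigr => mm _ /=.
rewrite rmorphM hornerM /= map_polyC hornerC /= mevalC; congr (_ * _).
rewrite /mmap1 rmorph_prod horner_prod; apply: eq_bigr => i _.
by rewrite rmorphXn horner_exp.
Qed.

Lemma spec_closed (T : Type) (P : (T -> C) -> Prop) K (b : 'I_K -> T -> C) (t : T -> C) Q :
  (forall c, P (fun=> c)) -> (forall k, P (b k)) -> P t ->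
  (forall f g, P f -> P g -> P (fun x => f x + g x)) ->
  (forall f g, P f -> P g -> P (fun x => f x * g x)) ->
  P (fun x => spec (fun k => b k x) (t x) Q).
Proof.
move=> Pc Pb Pt Pa Pm; under eq_fun do rewrite spec_unsplit.
rewrite (_ : (fun x => _) = (fun x => meval (fun i => join b t i x) (unsplit_poly Q))).
  by apply: (@meval_closed R _ _ P) => //; exact: (@join_ind _ _ P).
by apply/funext => x; apply: meval_eq => i; rewrite /join; case: unlift.
Qed.

Lemma spec_rmodp K S (jw : 'I_S -> 'I_K) k P b t :
  spec b t P = spec b t (Pdiv.Ring.rdivp P (wuniv R jw ^+ k)) * spec b t (wuniv R jw) ^+ k +
    spec b t (Pdiv.Ring.rmodp P (wuniv R jw ^+ k)).
Proof.
rewrite -specXn -specM -specD; congr spec; apply: Pdiv.RingMonic.rdivp_eq.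
by rewrite monic_exp // wuniv_monic.
Qed.

Lemma spec_wuniv K S (jw : 'I_S -> 'I_K) n (a : 'I_K -> Fn n) x t :
  spec (fun k => a k x) t (wuniv R jw) = (wpoly (fun j => a (jw j)) x).[t].
Proof. by rewrite /spec map_wuniv. Qed.

Lemma dense_at_near n (w w' : Fn n) a : (\forall x \near a, w x = w' x) -> dense_at w a ->
  dense_at w' a.
Proof.
move=> ww dw B aB; have [x [Bx wx] w0] := dw _ (filterI aB ww).
by exists x => //; rewrite -wx.
Qed.

Lemma continuous_row n N (Phi : 'rV[C]_n -> 'rV[C]_N) x :
  (forall i, {for x, continuous (fun y => Phi y 0 i)}) -> {for x, continuous Phi}.
Proof.
move=> cx P /nbhs_rV[d d0 Hd].
have : \forall y \near x, forall i, normc (Phi y 0 i - Phi x 0 i) < d.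
  by apply: filter_forall_fin => i; have /continuous_C := cx i; apply.
by apply: filterS => y; exact: Hd.
Qed.

Lemma near0_lsubmx n k (P : 'rV[C]_n -> Prop) : (\forall x \near (0 : 'rV[C]_n), P x) ->
  \forall y \near (0 : 'rV[C]_(n + k)), P (lsubmx y).
Proof.
move=> /nbhs_rV[d d0 Hd]; apply/nbhs_rV; exists d => // y yd; apply: Hd => i.
by have := yd (lshift k i); rewrite !mxE.
Qed.

Lemma near0_rhead n (P : 'rV[C]_n -> Prop) : (\forall x \near (0 : 'rV[C]_n), P x) ->
  \forall y \near (0 : 'rV[C]_n.+1), P (rhead y).
Proof.
move=> /nbhs_rV[d d0 Hd]; apply/nbhs_rV; exists d => // y yd; apply: Hd => i.
by have := yd (widen_ord (leqnSn n) i); rewrite !mxE.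
Qed.

Lemma analytic0_row_continuous n N (Phi : 'rV[C]_n -> 'rV[C]_N) :
  (forall i, analytic0 (fun x => Phi x 0 i)) ->
  \forall x \near (0 : 'rV[C]_n), {for x, continuous Phi}.
Proof.
move=> aP; have : \forall x \near (0 : 'rV[C]_n), forall i, {for x, continuous (fun y => Phi y 0 i)}.
  by apply: filter_forall_fin => i; exact: analytic0_continuous.
by apply: filterS => x; exact: continuous_row.
Qed.

Lemma analytic0_inv_contin n (f : Fn n) : analytic0 f -> f 0 != 0 ->
  contin_near (fun x => (f x)^-1) 0.
Proof.
move=> af f0; have cf := analytic0_continuous af.
apply: filterS2 cf (contin_neq0 (nbhs_singleton cf) f0) => x cx fx.
exact: continuousV.
Qed.

Lemma regular_axis_mulX n (f : Fn n.+1) s : regular_axis f s ->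
  regular_axis (fun y => y 0 ord_max * f y) s.+1.
Proof.
move=> [b [cb b0 [d d0 H]]]; exists b; split=> //; exists d => // t td.
by rewrite H // rjoinE join_max exprS mulrA.
Qed.

(** The last clause is what allows Phi to be replaced by any nearby map: the relations hold on a
    full neighbourhood in C^N and not just on the image of Phi. *)
Definition nash_factor n m (F : 'I_m -> Fn n) :=
  exists N (Phi : 'rV[C]_n -> 'rV[C]_N) (G : 'I_m -> Fn N),
  [/\ forall j, analytic0 (fun x => Phi x 0 j), Phi 0 = 0, forall i, nashg 0 (G i),
    forall i, \forall x \near (0 : 'rV[C]_n), F i x = G i (Phi x) &
    forall Q, (\forall x \near (0 : 'rV[C]_n), meval (fun i => F i x) Q = 0) ->
      \forall y \near (0 : 'rV[C]_N), meval (fun i => G i y) Q = 0].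

Lemma nash_factor_mulmx n m (F : 'I_m -> Fn n) (L : 'M[C]_n) : L \in unitmx ->
  nash_factor (fun i x => F i (x *m L)) -> nash_factor F.
Proof.
move=> uL [N [Phi [G [aP P0 nG FG QG]]]]; exists N, (fun x => Phi (x *m invmx L)), G; split=> //.
- by move=> j; exact: (analytic0_mulmx (invmx L) (aP j)).
- by rewrite mul0mx.
- move=> i; have := near0_mulmx (invmx L) (FG i); apply: filterS => x.
  by rewrite mulmxKV.
- move=> Q FQ; apply: QG; have := near0_mulmx L FQ; exact: filterS.
Qed.

Lemma nash_factor0 m (F : 'I_m -> Fn 0) : nash_factor F.
Proof.
have x0 (x : 'rV[C]_0) : x = 0 by apply/rowP => -[].
exists 0%N, id, (fun i _ => F i 0); split=> //.
- by move=> [].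
- by move=> i; exact: nashg_cst.
- by move=> i; apply: filterE => x; rewrite (x0 x).
- by move=> Q /nbhs_singleton H; exact: filterE.
Qed.

Lemma vanishing_ideal_prime n m (F : 'I_m -> Fn n) : (forall i, analytic0 (F i)) ->
  prime_ideal (fun Q => \forall x \near (0 : 'rV[C]_n), meval (fun i => F i x) Q = 0).
Proof.
move=> aF; split.
- by apply: filterE => x; rewrite meval0.
- by move=> P Q; apply: filterS2 => x; rewrite mevalD => -> ->; rewrite addr0.
- by move=> P Q; apply: filterS => x; rewrite mevalM => ->; rewrite mulr0.
- by move=> /nbhs_singleton; rewrite meval1 => /eqP; rewrite oner_eq0.
- move=> P Q PQ; apply: analytic0_prime; [exact: analytic0_meval|exact: analytic0_meval|].
  by apply: filterS PQ => x; rewrite mevalM.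
Qed.

End Specialization.

(** * From n to n + 1 variables *)

Section InductionStep.
Variable R : realType.
Local Notation C := R[i].
Local Notation Fn N := ('rV[C]_N -> C).
Variables (n m K S d : nat) (a : 'I_K -> Fn n) (jw : 'I_S -> 'I_K) (jr : 'I_m -> 'I_d -> 'I_K).
Variables (F q : 'I_m -> Fn n.+1).
Local Notation M := (m + 2)%N.
Local Notation w := (fun y => (wpoly (fun j => a (jw j)) (rhead y)).[y 0 ord_max]).
Local Notation ru := (fun i => runiv R (jr i)).
Local Notation ev P := (fun y : 'rV[C]_n.+1 => spec (fun k => a k (rhead y)) (y 0 ord_max) P).
Local Notation wu := (wuniv R jw).
Variables (aa : forall k, analytic0 (a k)) (a0 : forall j, a (jw j) 0 = 0).
Variables (aF : forall i, analytic0 (F i)) (aq : forall i, analytic0 (q i)).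
Variable FE : forall i, \forall y \near (0 : 'rV[C]_n.+1),
  F i y = w y ^+ M * q i y + \sum_(l < d) a (jr i l) (rhead y) * y 0 ord_max ^+ l.

Lemma ev_analytic0 P : analytic0 (ev P).
Proof.
apply: (@spec_closed R _ (@analytic0 R n.+1) K (fun k y => a k (rhead y)) (fun y => y 0 ord_max)).
- exact: analytic0_cst.
- by move=> k; exact: analytic0_head.
- exact: analytic0_coord.
- exact: analytic0_add.
- exact: analytic0_mul.
Qed.

Lemma wfun_analytic0 : analytic0 w.
Proof. by apply: analytic0_wpoly => j; exact: aa. Qed.

Lemma ev_wuniv y : ev wu y = w y.
Proof. exact: (spec_wuniv jw a (rhead y) (y 0 ord_max)). Qed.

Lemma near_remainder : \forall y \near (0 : 'rV[C]_n.+1), forall i,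
  F i y + w y ^+ M * - q i y = ev (runiv R (jr i)) y.
Proof.
apply: filter_forall_fin => i; apply: filterS (FE i) => y ->.
by rewrite spec_runiv mulrN addrAC subrr add0r.
Qed.

(** The remainders are F - w^M q, so Q at them differs from Q(F) by a multiple of w^M. *)
Lemma ev_quniv Q : exists2 al, analytic0 al & \forall y \near (0 : 'rV[C]_n.+1),
  ev (quniv ru Q) y = meval (fun i => F i y) Q + w y ^+ M * al y.
Proof.
have aNq i : analytic0 (fun y => - q i y).
  under eq_fun do rewrite -mulN1r.
  exact: (analytic0_mul (@analytic0_cst R n.+1 (-1)) (aq i)).
have [al [aal _ hal]] := meval_increment Q 0 (@analytic0_cst R n.+1) (@analytic0_add R n.+1)
  (@analytic0_mul R n.+1) aF aNq (analytic0_exp M wfun_analytic0).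
exists al => //; apply: filterS near_remainder => y ry.
by rewrite -hal spec_quniv; apply: meval_eq => i; rewrite -ry.
Qed.

Lemma rem_vanish P k D : contin_near D 0 ->
  (\forall y \near (0 : 'rV[C]_n.+1), ev P y = w y ^+ k * D y) ->
  forall j, \forall x \near (0 : 'rV[C]_n),
    meval (fun i => a i x) ((Pdiv.Ring.rmodp P (wu ^+ k))`_j) = 0.
Proof.
move=> cD PD; apply: (@universal_vanish R K S jw n a P k D) => // j.
exact: nbhs_singleton (analytic0_continuous (aa (jw j))).
Qed.

Lemma rem_vanish_ideal Q : (\forall y \near (0 : 'rV[C]_n.+1), meval (fun i => F i y) Q = 0) ->
  forall j, \forall x \near (0 : 'rV[C]_n),
    meval (fun i => a i x) ((Pdiv.Ring.rmodp (quniv ru Q) (wu ^+ M))`_j) = 0.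
Proof.
move=> FQ; have [al aal hal] := ev_quniv Q.
apply: (@rem_vanish _ _ al); first exact: analytic0_continuous.
by apply: filterS2 FQ hal => y Qy ->; rewrite Qy add0r.
Qed.

Variables (h : mpoly m C) (qh : Fn n.+1).
Variables (aqh : analytic0 qh) (qh0 : qh 0 != 0).
Variable gE : \forall y \near (0 : 'rV[C]_n.+1),
  (y : 'rV[C]_n.+1) 0 ord_max * meval (fun i => F i y) h * qh y = w y.

Local Notation ph := ('X * quniv ru h).
Local Notation dh := (Pdiv.Ring.rdivp ph (wu ^+ 1)).

(** Since t h(F) = w/[qh], replacing F by the remainders changes the cofactor 1/[qh] by a term with
    a factor t, which is 0 at the origin. *)
Lemma ev_ph : exists D, [/\ contin_near D 0, D 0 != 0 &
  \forall y \near (0 : 'rV[C]_n.+1), ev ph y = w y ^+ 1 * D y].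
Proof.
have [al aal hal] := ev_quniv h.
have ci := analytic0_inv_contin aqh qh0.
exists (fun y => (qh y)^-1 + y 0 ord_max * (w y ^+ m.+1 * al y)); split.
- apply: (contin_nearD ci); apply: analytic0_contin.
  apply: (analytic0_mul (@analytic0_coord R n.+1 ord_max)).
  exact: (analytic0_mul (analytic0_exp m.+1 wfun_analytic0) aal).
- by rewrite mxE mul0r addr0 invr_eq0.
- have qn0 := contin_neq0 (nbhs_singleton (analytic0_continuous aqh)) qh0.
  apply: filterS3 hal gE qn0 => y hy gy qy; rewrite specM specX hy expr1.
  have -> : w y * ((qh y)^-1 + y 0 ord_max * (w y ^+ m.+1 * al y)) =
    w y / qh y + y 0 ord_max * (w y ^+ M * al y) by rewrite addn2 (exprS _ m.+1); ring.
  by rewrite -{2}gy mulfK //; ring.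
Qed.

Lemma rem_ph_vanish j : \forall x \near (0 : 'rV[C]_n),
  meval (fun i => a i x) ((Pdiv.Ring.rmodp ph (wu ^+ 1))`_j) = 0.
Proof. by have [D [cD _ hD]] := ev_ph; exact: rem_vanish cD hD j. Qed.

Lemma ev_rem0 (P : {poly (mpoly K C)}) : (forall j, \forall x \near (0 : 'rV[C]_n), meval (fun i => a i x) (P`_j) = 0) ->
  \forall y \near (0 : 'rV[C]_n.+1), ev P y = 0.
Proof.
move=> P0; apply: near_horner_vanish => j.
exact: (near0_rhead (P0 j)).
Qed.

(** The universal quotient, specialized at a, agrees with the cofactor [D] of [ev_ph] where w is
    nonzero and so at 0 by density. It provides the unit [v] of [tougeron]. *)
Lemma ev_dh_neq0 : ev dh 0 != 0.
Proof.
have [D [cD D0 hD]] := ev_ph.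
have : \forall y \near (0 : 'rV[C]_n.+1), ev dh y - D y = 0.
  apply: (@contin_near_vanish R n.+1 w).
  - have cd := analytic0_continuous (ev_analytic0 dh).
    apply: filterS2 cd cD => y c1 c2.
    by apply: continuousB; [exact: c1|exact: c2].
  - by apply: filterE => y; exact: dense_wpoly.
  - apply: filterS2 hD (ev_rem0 rem_ph_vanish) => y Dy ry wy.
    have := spec_rmodp jw 1 ph (fun k => a k (rhead y)) (y 0 ord_max).
    rewrite [X in _ + X]ry addr0 (spec_wuniv jw a) Dy => Ey.
    apply/eqP; rewrite subr_eq0; apply/eqP; apply: (mulfI wy).
    by rewrite -[X in _ = X * _](expr1 (w y)) Ey expr1 mulrC.
by move=> /nbhs_singleton/subr0_eq ->.
Qed.

Variables (N0 : nat) (Phi0 : 'rV[C]_n -> 'rV[C]_N0) (G0 : 'I_K -> Fn N0).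
Variables (aP0 : forall j, analytic0 (fun x => Phi0 x 0 j)) (P00 : Phi0 0 = 0).
Variables (nG0 : forall k, nashg 0 (G0 k)).
Variable GE0 : forall k, \forall x \near (0 : 'rV[C]_n), a k x = G0 k (Phi0 x).
Variable QG0 : forall Q, (\forall x \near (0 : 'rV[C]_n), meval (fun k => a k x) Q = 0) ->
  \forall z \near (0 : 'rV[C]_N0), meval (fun k => G0 k z) Q = 0.

(** The variables of G: those of [G0], then the coordinate t, then the m free corrections [eta]. *)
Local Notation N := (N0 + (1 + m))%N.
Local Notation it := (rshift N0 (lshift m (ord0 : 'I_1))).
Local Notation ie i := (rshift N0 (rshift 1 (i : 'I_m))).
Local Notation gev P := (fun y : 'rV[C]_N => spec (fun k => G0 k (lsubmx y)) (y 0 it) P).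
Local Notation Phi := (fun x : 'rV[C]_n.+1 =>
  row_mx (Phi0 (rhead x)) (row_mx (x 0 ord_max)%:M (\row_(i < m) (w x ^+ (i + 2) * q i x)))).

Lemma gev_nashg P : nashg 0 (gev P).
Proof.
apply: (@spec_closed R _ (@nashg R N 0) K (fun k y => G0 k (lsubmx y)) (fun y => y 0 it)).
- exact: nashg_cst.
- move=> k; apply: (@nashg_comp R N N0 (G0 k) (fun y => lsubmx y)).
    by move=> i; under eq_fun do rewrite mxE; exact: nashg_coord.
  have -> : lsubmx (0 : 'rV[C]_N) = 0 by apply/rowP => i; rewrite !mxE.
  exact: nG0.
- exact: nashg_coord.
- exact: nashg_add.
- exact: nashg_mul.
Qed.

Lemma gev_rem0 (P : {poly (mpoly K C)}) : (forall j, \forall x \near (0 : 'rV[C]_n), meval (fun i => a i x) (P`_j) = 0) ->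
  \forall y \near (0 : 'rV[C]_N), gev P y = 0.
Proof.
move=> P0; apply: near_horner_vanish => j.
apply: (@near0_lsubmx R N0 (1 + m) (fun z => meval (fun k => G0 k z) (P`_j) = 0)).
exact: QG0 (P0 j).
Qed.

Lemma gev_Phi : \forall x \near (0 : 'rV[C]_n.+1), forall P, gev P (Phi x) = ev P x.
Proof.
have : \forall x \near (0 : 'rV[C]_n), forall k, a k x = G0 k (Phi0 x).
  by apply: filter_forall_fin => k; exact: GE0.
move=> /near0_rhead; apply: filterS => x ax P.
rewrite row_mxKl row_mxEr row_mxEl mxE eqxx mulr1n; congr spec.
by apply/funext => k; rewrite ax.
Qed.

Lemma Phi_analytic0 j : analytic0 (fun x => Phi x 0 j).
Proof.
case: (split_ordP j) => k ->; first by under eq_fun do rewrite row_mxEl; exact: (analytic0_head (aP0 k)).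
under eq_fun do rewrite row_mxEr.
case: (split_ordP k) => l ->.
  suff -> : (fun x : 'rV[C]_n.+1 => row_mx (x 0 ord_max)%:M (\row_(i < m) (w x ^+ (i + 2) * q i x)) 0 (lshift m l)) =
    (fun x : 'rV[C]_n.+1 => x 0 ord_max) by exact: analytic0_coord.
  by apply/funext => x; rewrite row_mxEl ord1 mxE eqxx mulr1n.
under eq_fun do rewrite row_mxEr mxE.
exact: (analytic0_mul (analytic0_exp (l + 2) wfun_analytic0) (aq l)).
Qed.

Lemma wfun0 : (0 < S)%N -> w 0 = 0.
Proof.
move=> S0; have r0 : rhead (0 : 'rV[C]_n.+1) = 0 by apply/rowP => i; rewrite !mxE.
rewrite horner_wpoly r0 mxE expr0n eqn0Ngt S0 add0r big1 // => j _.
by rewrite a0 mul0r.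
Qed.

Lemma Phi_0 : (0 < S)%N -> Phi 0 = 0.
Proof.
move=> S0; have r0 : rhead (0 : 'rV[C]_n.+1) = 0 by apply/rowP => i; rewrite !mxE.
have := wfun0 S0 => /= w0.
apply/rowP => j; rewrite [RHS]mxE; case: (split_ordP j) => k ->.
  by rewrite row_mxEl r0 P00 mxE.
rewrite row_mxEr; case: (split_ordP k) => l ->.
  by rewrite row_mxEl !mxE mul0rn.
by rewrite row_mxEr mxE w0 expr0n addn2 mul0r.
Qed.

(** Monic in the coordinate [it], on which the [G0 k] do not depend. *)
Lemma gev_dense y : dense_at (gev wu) y.
Proof.
apply: (@dense_at_monic R N _ it) => x.
exists (wpoly (fun j z => G0 (jw j) (lsubmx z)) x); first exact: wpoly_monic.
move=> t; rewrite (spec_wuniv jw (fun k z => G0 k (lsubmx z))) mxE eqxx.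
congr horner; rewrite /wpoly; congr (_ + _); apply: eq_bigr => j _; congr (G0 _ _ *: _).
by apply/rowP => i; rewrite !mxE; case: eqP => // /(congr1 val) /=; have := ltn_ord i; lia.
Qed.

Variable tI : tougeron (fun Q => \forall y \near (0 : 'rV[C]_n.+1), meval (fun i => F i y) Q = 0) h.

(** The remainders, w and the unit are specialized at the algebraic [G0] in place of a; the
    hypotheses of [tougeron] are relations between the a, so [QG0] transfers them. Its uniqueness
    clause, at Phi, gives F = G o Phi. *)
Lemma nash_factor_step : (0 < S)%N -> nash_factor F.
Proof.
move=> S0.
have cPhi := analytic0_row_continuous Phi_analytic0.
have P0 := Phi_0 S0.
have gP := gev_Phi.
have gP0 P : gev P 0 = ev P 0 by have := nbhs_singleton gP P; rewrite {1 2}P0.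
have near_w : \forall x \near (0 : 'rV[C]_n.+1), gev wu (Phi x) = w x.
  by apply: filterS gP => x /(_ wu) ->; exact: ev_wuniv.
have [|||||xi [nxi _ xiI xiU]] := tI (r := fun i => gev (runiv R (jr i))) (w := gev wu)
    (v := gev dh) (tau := fun y => y 0 it) (eta := fun i y => y 0 (ie i)) (M := M).
- exact: leqnn.
- split; [move=> i| | | |move=> i]; try exact: gev_nashg; exact: nashg_coord.
- split; first by rewrite gP0 ev_wuniv; exact: wfun0.
  + by rewrite gP0; exact: ev_dh_neq0.
  + by move=> i; rewrite mxE.
  + by apply: filterE; exact: gev_dense.
- apply: filterS (gev_rem0 rem_ph_vanish) => y ry.
  have := spec_rmodp jw 1 ph (fun k => G0 k (lsubmx y)) (y 0 it).
  by rewrite ry addr0 specM specX spec_quniv expr1 => ->; rewrite mulrC.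
- move=> Q IQ; exists (gev (Pdiv.Ring.rdivp (quniv ru Q) (wu ^+ M))); first exact: gev_nashg.
  apply: filterS (gev_rem0 (rem_vanish_ideal IQ)) => y ry.
  have := spec_rmodp jw M (quniv ru Q) (fun k => G0 k (lsubmx y)) (y 0 it).
  by rewrite ry addr0 spec_quniv => ->; rewrite mulrC.
have FP i : \forall x \near (0 : 'rV[C]_n.+1),
    F i x = gev (runiv R (jr i)) (Phi x) + gev wu (Phi x) ^+ M * q i x.
  apply: filterS3 gP near_w near_remainder => x gx wx rx.
  by by rewrite wx gx -rx mulrN subrK.
have etaP i : \forall x \near (0 : 'rV[C]_n.+1),
    Phi x 0 (ie i) = gev wu (Phi x) ^+ (i + 2) * q i x.
  by apply: filterS near_w => x ->; rewrite !row_mxEr mxE.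
have dP : \forall x \near (0 : 'rV[C]_n.+1), dense_at (fun x => gev wu (Phi x)) x.
  apply: filterS (nbhs_interior near_w) => x wx; apply: (@dense_at_near R _ w).
    by apply: filterS wx => z ->.
  exact: dense_wpoly.
have xiP := xiU _ Phi F q cPhi P0 (fun i => analytic0_contin (aq i)) FP etaP dP (fun Q IQ => IQ).
exists N, Phi, (fun i y => gev (runiv R (jr i)) y + gev wu y ^+ (M - 2 - i) * xi i y); split=> //.
- exact: Phi_analytic0.
- move=> i; apply: nashg_add; first exact: gev_nashg.
  by apply: nashg_mul => //; apply: nashg_exp; exact: gev_nashg.
- move=> i; apply: filterS2 (FP i) (xiP i) => x -> ->.
  rewrite mulrA -exprD; congr (_ + _ ^+ _ * _); have := ltn_ord i; lia.
Qed.

End InductionStep.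

(** * Factorization through algebraic germs *)

Section Factorization.
Variable R : realType.
Local Notation C := R[i].
Local Notation Fn N := ('rV[C]_N -> C).

Lemma vanishing_ideal_mulmx n m (F : 'I_m -> Fn n) (L : 'M[C]_n) : L \in unitmx ->
  (fun Q => \forall x \near (0 : 'rV[C]_n), meval (fun i => F i (x *m L)) Q = 0) =
  (fun Q => \forall x \near (0 : 'rV[C]_n), meval (fun i => F i x) Q = 0).
Proof.
move=> uL; apply/funext => Q; apply/propext; split=> H.
  by have := near0_mulmx (invmx L) H; apply: filterS => x; rewrite mulmxKV.
by have := near0_mulmx L H; exact: filterS.
Qed.

Lemma nash_factorization n m (F : 'I_m -> Fn n) : (forall i, analytic0 (F i)) -> nash_factor F.
Proof.
elim: n m F => [|n IH] m F aF; first exact: nash_factor0.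
have [h nh tI] := tougeron_exists (vanishing_ideal_prime aF).
have ah : analytic0 (fun x => meval (fun i => F i x) h) by exact: analytic0_meval.
have [L uL [s rs]] := regular_direction ah nh.
apply: (nash_factor_mulmx uL).
rewrite -(vanishing_ideal_mulmx F uL) in tI.
have {aF} : forall i, analytic0 (fun x => F i (x *m L)) by move=> i; exact: analytic0_mulmx.
move: tI; set F' := fun i x => F i (x *m L) => tI aF'.
have ah' : analytic0 (fun x => meval (fun i => F' i x) h) by exact: analytic0_meval.
(* The factor t raises the order from s to s + 1, which guarantees a positive degree. *)
have [qh [c [aqh qh0 ac gE]]] := weierstrass_preparation_germ
  (analytic0_mul (@analytic0_coord R n.+1 ord_max) ah') (regular_axis_mulX rs).
have /choice[qr Hqr] : forall i, exists qr : Fn n.+1 * ('I_(s.+1 * (m + 2)) -> Fn n),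
    [/\ analytic0 qr.1, forall j, analytic0 (qr.2 j) & \forall y \near (0 : 'rV[C]_n.+1),
      F' i y = (wpoly c (rhead y)).[y 0 ord_max] ^+ (m + 2) * qr.1 y +
        \sum_(j < s.+1 * (m + 2)) qr.2 j (rhead y) * y 0 ord_max ^+ j].
  move=> i; have [q [r Hqr]] := weierstrass_division_germ (m + 2) ac (aF' i).
  by exists (q, r).
(* The coefficients of w and of all remainders form one family, because the induction hypothesis
   must preserve the relations between all of them. *)
pose T : finType := ('I_s.+1 + 'I_m * 'I_(s.+1 * (m + 2)))%type.
pose a (k : 'I_#|{: T}|) : Fn n := match enum_val k with
  | inl j => c j | inr p => (qr p.1).2 p.2 end.
pose jw (j : 'I_s.+1) := enum_rank (inl j : T).
pose jr i j := enum_rank (inr (i, j) : T).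
have ajw j : a (jw j) = c j by rewrite /a /jw enum_rankK.
have ajr i j : a (jr i j) = (qr i).2 j by rewrite /a /jr enum_rankK.
have aa k : analytic0 (a k).
  by rewrite /a; case: (enum_val k) => [j|p]; [have [] := ac j|have [_ H _] := Hqr p.1; exact: H].
have wE : (fun j => a (jw j)) = c by apply/funext.
have [N0 [Phi0 [G0 [aP0 P00 nG0 GE0 QG0]]]] := IH _ a aa.
apply: (@nash_factor_step R n m _ s.+1 (s.+1 * (m + 2)) a jw jr F' (fun i => (qr i).1) aa _ aF' _ _
  h qh aqh qh0 _ N0 Phi0 G0 aP0 P00 nG0 GE0 QG0 tI) => //.
- by move=> j; rewrite ajw; have [] := ac j.
- by move=> i; have [] := Hqr i.
- move=> i; have [_ _] := Hqr i; apply: filterS => y ->; rewrite wE; congr (_ + _).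
  by apply: eq_bigr => j _; rewrite ajr.
- by apply: filterS gE => y; rewrite wE.
Qed.

Lemma upd_id n (x : 'rV[C]_n) i : upd x i (x 0 i) = x.
Proof. by apply/rowP => j; rewrite mxE; case: eqP => [->|]. Qed.

Lemma upd_differentiable n (x : 'rV[C]_n) i (t : C) : differentiable (fun t : C => upd x i t) t.
Proof.
rewrite (_ : (fun t : C => upd x i t) =
  (fun t : C => (x - x 0 i *: delta_mx 0 i) + t *: delta_mx 0 i)).
  by apply: differentiableD; [exact: differentiable_cst|exact: differentiableZl].
apply/funext => s; apply/rowP => j; rewrite !mxE eqxx /=.
by case: eqP => [->|_]; rewrite ?mulr1 ?mulr0; ring.
Qed.

(** Differentiability yields continuity at 0, hence boundedness nearby, and differentiability in
    each variable; these are the hypotheses of [separately_polylim]. *)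
Lemma differentiable_analytic0 n (f : Fn n) :
  (\forall x \near (0 : 'rV[C]_n), differentiable f x) -> analytic0 f.
Proof.
move=> df; have cf : {for 0, continuous f}.
  exact: differentiable_continuous (nbhs_singleton df).
have bf : \forall x \near (0 : 'rV[C]_n), normc (f x) <= normc (f 0) + 1.
  have /continuous_C/(_ 1 ltr01) := cf; apply: filterS => x fx.
  rewrite -[f x](subrK (f 0)) addrC; apply: le_trans (le_normcD _ _) _.
  by rewrite lerD2l ltW.
have [d d0 Hd] := (nbhs_rV _ _).1 (filterI df bf).
have {}Hd (x : 'rV[C]_n) : polydisc (d / 2) x ->
    differentiable f x /\ normc (f x) <= normc (f 0) + 1.
  move=> xd; apply: Hd => i; rewrite [X in _ - X]mxE subr0; apply: le_lt_trans (xd i) _.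
  by lra.
exists (d / 4); first by lra.
apply: (@separately_polylim R n f (d / 4) (d / 2) (normc (f 0) + 1)); [lra|lra| |].
  move=> x i /Hd[dx _]; apply: (@differentiable_comp _ _ _ _ (fun t : C => upd x i t) f).
    exact: upd_differentiable.
  by rewrite upd_id.
by move=> x /Hd[].
Qed.

Lemma uniform_cvg_coord n m (A : set 'rV[C]_n) (f : 'rV[C]_n -> 'rV[C]_m)
    (g : nat -> 'rV[C]_n -> 'rV[C]_m) :
  (forall e : R, 0 < e -> \forall nu \near \oo,
     forall x, A x -> forall i, normc (f x 0 i - g nu x 0 i) < e) ->
  {uniform A, g @ \oo --> f}.
Proof.
move=> H P /uniform_nbhs[E [entE EP]]; move: entE; rewrite -entourage_ballE.
move=> [e /= /gt0_complex[d d0 ->] dE]; apply: filterS (H d d0) => nu Hnu.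
apply: EP => x Ax; apply: dE => /=; split; first by rewrite ltcR.
by move=> i j; rewrite (ord1 i) -ball_normE /= normE ltcR; exact: Hnu.
Qed.

Lemma nash_map_nashg n m (A : set 'rV[C]_n) (f : 'rV[C]_n -> 'rV[C]_m) : open A ->
  (forall x, A x -> forall i, nashg x (fun y => f y 0 i)) -> nash_map A f.
Proof.
move=> oA nf; have df x : A x -> differentiable f x.
  by move=> Ax; apply: has_grad_differentiable => i; apply: nashg_grad; exact: nf.
split=> // i; split=> [x Ax|x Ax].
  apply: (@differentiable_comp _ _ _ _ f (fun y : 'rV[C]_m => y 0 i)); first exact: df.
  exact: differentiable_coord.
have [P P0 Pf] := nashg_algebraic (nf x Ax i).
exists (interior [set y | A y /\ meval (row_mx y (f y 0 i)%:M 0) P = 0]); split.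
- exact: open_interior.
- by apply: nbhs_singleton; apply: nbhs_interior; apply: filterS2 (open_nbhs_nbhs (conj oA Ax)) Pf.
- by move=> y /interior_subset[].
- by exists P => // y /interior_subset[].
Qed.

Lemma near_shift n (a : 'rV[C]_n) (P : 'rV[C]_n -> Prop) :
  (\forall x \near (0 : 'rV[C]_n), P x) <-> \forall x \near a, P (x - a).
Proof.
split=> /nbhs_rV[d d0 Hd]; apply/nbhs_rV; exists d => // x xd.
  by apply: Hd => i; move: (xd i); rewrite !mxE subr0.
rewrite -(addrK a x); apply: Hd => i; have := xd i.
by rewrite !mxE subr0 addrK.
Qed.

End Factorization.

(** * Approximation of the inner map of the factorization *)

Theorem theorem3p1 (R : realType) (n m q : nat) (U : set 'rV[R[i]]_n)
    (Q : 'I_q -> mpoly m R[i]) (F : 'rV[R[i]]_n -> 'rV[R[i]]_m)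
    (openU : open U) (holF : holomorphic_on U F)
    (QF0 : forall x, U x -> polynomial_map Q (F x) = 0)
    (x0 : 'rV[R[i]]_n) (Ux0 : U x0) :
  exists (U0 : set 'rV[R[i]]_n) (Fnu : nat -> 'rV[R[i]]_n -> 'rV[R[i]]_m),
    [/\ [/\ open U0, U0 x0 & U0 `<=` U],
        forall nu, nash_map U0 (Fnu nu),
        {uniform U0, Fnu @ \oo --> F} &
        forall nu x, U0 x -> polynomial_map Q (Fnu nu x) = 0].
Proof.
(* All germs live at the origin, so x0 is moved there. *)
have nearU : \forall x \near (0 : 'rV[R[i]]_n), U (x0 + x).
  apply/(near_shift x0); have := open_nbhs_nbhs (conj openU Ux0).
  by apply: filterS => x; rewrite addrC subrK.
pose f i x := F (x0 + x) 0 i.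
have af i : analytic0 (f i).
  apply: differentiable_analytic0; apply: filterS nearU => x /holF dF.
  have d1 : differentiable (fun y : 'rV[R[i]]_n => x0 + y) x.
    by apply: differentiableD; [exact: differentiable_cst|exact: ex_diff].
  have d2 : differentiable (F \o (fun y => x0 + y)) x := differentiable_comp d1 dF.
  exact: (differentiable_comp d2 (differentiable_coord _ 0 i)).
have [N [Phi [G [aP P0 nG FG QG]]]] := nash_factorization af.
have {}QG j : \forall y \near (0 : 'rV[R[i]]_N), meval (fun i => G i y) (Q j) = 0.
  by apply: QG; apply: filterS nearU => x /QF0/rowP/(_ j); rewrite !mxE.
have /choice[Kd HK] : forall i, exists Kd : R * R, [/\ 0 < Kd.1, 0 < Kd.2 & forall x y,
    l1 (x - 0) < Kd.2 -> l1 (y - 0) < Kd.2 -> normc (G i x - G i y) <= Kd.1 * l1 (x - y)].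
  by move=> i; have [K [d H]] := nashg_lipschitz (nG i); exists (K, d).
have nl i : \forall y \near (0 : 'rV[R[i]]_N), l1 (y - 0) < (Kd i).2.
  by apply/near_l1; exists (Kd i).2 => //; have [] := HK i.
(* On this polydisc G is Nash at every point, Lipschitz, and satisfies the equations Q. *)
have [del del0 Hdel] := (nbhs_rV _ _).1 (filterI (filter_forall_fin (fun i => nashg_open (nG i)))
  (filterI (filter_forall_fin nl) (filter_forall_fin QG))).
have {}Hdel (y : 'rV[R[i]]_N) : (forall k, normc (y 0 k) < del) -> [/\ forall i, nashg y (G i),
    forall i, l1 (y - 0) < (Kd i).2 & forall j, meval (fun i => G i y) (Q j) = 0].
  move=> yd; have [|h1 [h2 h3]] := Hdel y; last by split.
  by move=> k; rewrite [X in _ - X]mxE subr0.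
have del20 : 0 < del / 2 by rewrite divr_gt0.
have [r r0 Hr] := analytic0_common aP.
have nP : \forall x \near (0 : 'rV[R[i]]_n), forall k, normc (Phi x 0 k) < del / 2.
  apply: filter_forall_fin => k.
  have /continuous_C/(_ _ del20) := nbhs_singleton (analytic0_continuous (aP k)).
  by rewrite P0; apply: filterS => x; rewrite [X in _ - X]mxE subr0.
pose A x := (polydisc r x /\ U (x0 + x)) /\
  (forall k, normc (Phi x 0 k) < del / 2) /\ forall i, f i x = G i (Phi x).
have nA : \forall x \near (0 : 'rV[R[i]]_n), A x.
  apply: filterS2 (filterI (polydisc_nbhs n r0) nearU) (filterI nP (filter_forall_fin FG)).
  by move=> x [h1 h2] [h3 h4]; split.
(* The precision tends to 0 and is at most [del] / 2 from the start; as Phi is kept below [del] / 2,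
   every approximation maps into the polydisc of radius [del]. *)
have /choice[p Hp] : forall nk : nat * 'I_N, exists p : mpoly n R[i], forall x,
    polydisc r x -> normc (Phi x 0 nk.2 - meval (x 0) p) <= del / 2 / nk.1.+1%:R.
  move=> nk; have := Hr nk.2 r (lexx _) (del / 2 / nk.1.+1%:R); apply.
  by rewrite divr_gt0 ?ltr0n.
pose Psi nu (x : 'rV[R[i]]_n) : 'rV[R[i]]_N := \row_k meval (x 0) (p (nu, k)).
pose B := [set x | A (x - x0)].
have nB : nbhs x0 B := (near_shift x0 A).1 nA.
have Psi_small nu x : polydisc r x -> (forall k, normc (Phi x 0 k) < del / 2) ->
    forall k, normc (Psi nu x 0 k) < del.
  move=> xr Px k; rewrite mxE.
  have dnu : del / 2 / nu.+1%:R <= del / 2.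
    by rewrite ler_pdivrMr ?ltr0n //; apply: ler_peMr; [exact: ltW|rewrite ler1n].
  have pk := le_trans (Hp (nu, k) x xr) dnu.
  rewrite -[X in normc X](subKr (Phi x 0 k)); apply: le_lt_trans (le_normcB _ _) _.
  by rewrite [ltRHS](splitr del); exact: ltr_leD (Px k) pk.
exists (interior B), (fun nu x => \row_i G i (Psi nu (x - x0))); split.
- split; [exact: open_interior|by apply: nbhs_singleton; exact: nbhs_interior|].
  by move=> x /interior_subset[[_ Ux] _]; move: Ux; rewrite addrC subrK.
- move=> nu; apply: nash_map_nashg; first exact: open_interior.
  move=> x /interior_subset[[xr _] [Px _]] i; under eq_fun do rewrite mxE.
  have [nGx _ _] := Hdel _ (Psi_small nu _ xr Px).
  apply: (@nashg_comp _ _ _ (G i) (fun y => Psi nu (y - x0))); last exact: nGx.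
  move=> k; rewrite /Psi; under eq_fun do rewrite mxE.
  apply: (@nashg_meval _ _ _ (fun j (y : 'rV[R[i]]_n) => (y - x0) 0 j)) => j.
  under eq_fun do rewrite mxE.
  by apply: nashg_add; [exact: nashg_coord|exact: nashg_cst].
- apply: uniform_cvg_coord => e e0.
  (* The Lipschitz constant of G times the sum norm of Phi - [Psi nu], over N components. *)
  have nu_near : \forall nu \near \oo, forall i : 'I_m,
      (Kd i).1 * (N%:R * (del / 2 / nu.+1%:R)) < e.
    apply: filter_forall_fin => i; have [K0 _ _] := HK i.
    have c0 : 0 < (Kd i).1 * (N%:R * (del / 2)) + 1.
      by apply: ltr_wpDl => //; apply: mulr_ge0; [exact: ltW|apply: mulr_ge0; [exact: ler0n|exact: ltW]].
    have ec0 : 0 < e / ((Kd i).1 * (N%:R * (del / 2)) + 1) by rewrite divr_gt0.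
    have := near_infty_natSinv_lt (PosNum ec0); apply: filterS => nu /=.
    rewrite ltr_pdivlMr // mulrC => h; apply: le_lt_trans h.
    rewrite mulrDl mul1r -[X in X + _]mulrA -(mulrA N%:R) lerDl.
    by rewrite invr_ge0 ler0n.
  apply: filterS nu_near => nu hnu x /interior_subset[[xr _] [Px fG]] i.
  apply: le_lt_trans (hnu i); rewrite mxE.
  have -> : F x 0 i = G i (Phi (x - x0)) by rewrite -fG /f addrC subrK.
  have [_ l1P _] : [/\ forall i, nashg (Phi (x - x0)) (G i),
      forall i, l1 (Phi (x - x0) - 0) < (Kd i).2 &
      forall j, meval (fun i => G i (Phi (x - x0))) (Q j) = 0].
    by apply: Hdel => k; apply: lt_le_trans (Px k) _; lra.
  have [_ l1Psi _] := Hdel _ (Psi_small nu _ xr Px).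
  have [K0 _ H] := HK i; apply: le_trans (H _ _ (l1P i) (l1Psi i)) _.
  rewrite ler_pM2l // /l1.
  have -> : N%:R * (del / 2 / nu.+1%:R) = \sum_(k < N) del / 2 / nu.+1%:R.
    by rewrite sumr_const card_ord -[RHS]mulr_natl.
  by apply: ler_sum => k _; rewrite !mxE; exact: (Hp (nu, k)).
- move=> nu x /interior_subset[[xr _] [Px _]]; apply/rowP => j; rewrite !mxE.
  have [_ _ QP] := Hdel _ (Psi_small nu _ xr Px).
  by rewrite -(QP j); apply: meval_eq => i; rewrite mxE.
Qed.
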